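(* Consider the Steiner Tree with Minimum Number of Steiner Points problem (ST-MSP) in a space for which $\Delta$ is a constant. Suppose that ST-MSP instances with a constant number of terminals can be solved (optimally) in polynomial time. Then for every constant $\epsilon>0$ there is a polynomial-time approximation algorithm for ST-MSP with approximation ratio $1+\ln(\Delta-1)+\epsilon$. In particular, in the Euclidean plane $\mathbb{R}^2$ (where $\Delta=5$) the ratio is $1+\ln 4+\epsilon<2.3863+\epsilon$.
   Context: Let $(M,d)$ be a metric space (the paper works in an arbitrary normed space). For a set $V\subseteq M$, the unit-disk graph of $V$ has node set $V$ and an edge $uv$ for every $u,v\in V$ with $d(u,v)\le 1$. $\Delta$ denotes the maximum number of points that can be placed in a unit ball such that the distance between any two of them is larger than $1$. ST-MSP: given a finite set $R\subseteq M$ of terminals, find a minimum-size set $S\subseteq M$ of additional (Steiner) points such that the unit-disk graph of $R\cup S$ contains a tree spanning $R$ (equivalently, the terminals all lie in one connected component). Several points may be placed at the same location, and it is assumed that the maximum distance between terminals is polynomial in the number of terminals. *)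

(* Defs.v *)
From HB Require Import structures.
From mathcomp Require Import all_boot all_order all_algebra.
From mathcomp Require Import all_classical all_reals all_analysis.

Set Implicit Arguments.
Unset Strict Implicit.
Unset Printing Implicit Defensive.

Import Order.TTheory GRing.Theory Num.Theory.
Import numFieldNormedType.Exports.

Local Open Scope ring_scope.

(** * The space *)

Definition norm_dist (R : realType) (V : normedModType R) (u v : V) : R :=
  `|u - v|.

(* The library norm on ['rV_2] is the sup norm, hence this explicit metric. *)
Definition eucl_dist (R : realType) (u v : 'rV[R]_2) : R :=
  Num.sqrt (\sum_(i < 2) (u 0 i - v 0 i) ^+ 2).

Section Problem.
Variables (R : realType) (P : eqType) (d : P -> P -> R).

Definition ball_packing (c : P) (s : seq P) : bool :=
  all (fun x => d c x <= 1) s && pairwise (fun x y => 1 < d x y) s.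

(* [is_packing_number Delta] : Delta is the maximum number of points in a
   (closed) unit ball at pairwise distances larger than 1. *)
Definition is_packing_number (Delta : nat) : Prop :=
  (exists c s, ball_packing c s /\ size s = Delta) /\
  (forall c s, ball_packing c s -> (size s <= Delta)%N).

(** * The problem ST-MSP *)

Definition unit_disk_graph (W : seq P) : rel P :=
  fun u v => [&& u \in W, v \in W & d u v <= 1].

(* A solution is a sequence, so that Steiner points may share a location and
   are counted with multiplicity. *)
Definition feasible (T S : seq P) : Prop :=
  forall u v, u \in T -> v \in T ->
    exists p, path (unit_disk_graph (T ++ S)) u p /\ last u p = v.

Definition optimal (T S : seq P) : Prop :=
  feasible T S /\ forall S', feasible T S' -> (size S <= size S')%N.

Definition approximate (rho : R) (T S : seq P) : Prop :=
  feasible T S /\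
  forall S', feasible T S' -> (size S)%:R <= rho * (size S')%:R.

Definition max_dist_le (T : seq P) (x : R) : Prop :=
  forall u v, u \in T -> v \in T -> d u v <= x.

End Problem.

(** * The model of computation

  Real-RAM style computation over an arbitrary structure: Jones' WHILE language
  (binary trees, unit-cost construction and destruction), extended with points
  and scalars as atoms, and with a signature of unit-cost functions and
  relations on atoms.  The signature is a parameter; apart from what it
  provides there is no unit-cost arithmetic, integers being coded by trees. *)

Inductive atom (R : realType) (P : Type) : Type :=
| Point of P
| Scalar of R.
Arguments Point {R P}.
Arguments Scalar {R P}.

(* The number of arguments of a symbol is fixed by each of its occurrences in
   the (finite) program text; constants are applied to [[::]]. *)
Record structure (R : realType) (P : Type) : Type := Structure {
  fun_symbol : Type;
  rel_symbol : Type;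
  fun_interp : fun_symbol -> seq (atom R P) -> atom R P;
  rel_interp : rel_symbol -> seq (atom R P) -> bool
}.

Inductive tree (X : Type) : Type :=
| Leaf
| Atom of X
| Node of tree X & tree X.
Arguments Leaf {X}.
Arguments Atom {X}.
Arguments Node {X}.

Section Machine.
Variables (R : realType) (P : Type) (A : structure R P).

Local Notation value := (tree (atom R P)).

Definition hd_tree (t : value) : value := if t is Node a _ then a else Leaf.
Definition tl_tree (t : value) : value := if t is Node _ b then b else Leaf.
Definition is_leaf (t : value) : bool := if t is Leaf then true else false.
Definition bool_tree (b : bool) : value := if b then Node Leaf Leaf else Leaf.

Fixpoint atoms_of (ts : seq value) : option (seq (atom R P)) :=
  match ts with
  | [::] => Some [::]
  | Atom a :: ts' => omap (cons a) (atoms_of ts')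
  | _ => None
  end.

Definition store := nat -> value.

Definition set_var (s : store) (x : nat) (t : value) : store :=
  fun y => if y == x then t else s y.

Inductive instr : Type :=
| SetLeaf of nat
| Copy of nat & nat
| SetNode of nat & nat & nat
| SetHd of nat & nat
| SetTl of nat & nat
| SetFun of nat & fun_symbol A & seq nat
| SetRel of nat & rel_symbol A & seq nat.

(* A symbol applied to something that is not an atom yields [Leaf]. *)
Definition step (i : instr) (s : store) : store :=
  match i with
  | SetLeaf x => set_var s x Leaf
  | Copy x y => set_var s x (s y)
  | SetNode x y z => set_var s x (Node (s y) (s z))
  | SetHd x y => set_var s x (hd_tree (s y))
  | SetTl x y => set_var s x (tl_tree (s y))
  | SetFun x f ys => set_var s x
      (if atoms_of (map s ys) is Some l then Atom (fun_interp f l) else Leaf)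
  | SetRel x r ys => set_var s x
      (if atoms_of (map s ys) is Some l then bool_tree (rel_interp r l)
       else Leaf)
  end.

Inductive program : Type :=
| Instr of instr
| Seq of program & program
| If of nat & program & program
| While of nat & program.

(* [exec c s s' t] : started in store s, program c halts in store s' after t
   unit-cost operations (instructions and tests); [Leaf] means false. *)
Inductive exec : program -> store -> store -> nat -> Prop :=
| exec_instr i s : exec (Instr i) s (step i s) 1%N
| exec_seq c1 c2 s s1 s2 t1 t2 :
    exec c1 s s1 t1 -> exec c2 s1 s2 t2 -> exec (Seq c1 c2) s s2 (t1 + t2)%N
| exec_if_true x c1 c2 s s' t :
    ~~ is_leaf (s x) -> exec c1 s s' t -> exec (If x c1 c2) s s' t.+1
| exec_if_false x c1 c2 s s' t :
    is_leaf (s x) -> exec c2 s s' t -> exec (If x c1 c2) s s' t.+1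
| exec_while_stop x c s :
    is_leaf (s x) -> exec (While x c) s s 1%N
| exec_while_loop x c s s1 s2 t1 t2 :
    ~~ is_leaf (s x) -> exec c s s1 t1 -> exec (While x c) s1 s2 t2 ->
    exec (While x c) s s2 (t1 + t2).+1%N.

Definition encode (l : seq P) : value :=
  foldr (fun p => Node (Atom (Point p))) Leaf l.

Definition computes (c : program) (input output : seq P) (t : nat) : Prop :=
  exists s', exec c (set_var (fun=> Leaf) 0%N (encode input)) s' t /\
             s' 0%N = encode output.

(* [dom T n] : T is an admissible input whose size parameter is n; running
   times are measured as a function of n. *)
Definition poly_time_solvable (dom : seq P -> nat -> Prop)
    (sol : seq P -> seq P -> Prop) : Prop :=
  exists (c : program) (p : {poly nat}), forall (T : seq P) (n : nat),
    dom T n ->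
    exists (S : seq P) (t : nat),
      computes c T S t /\ (t <= p.[n])%N /\ sol T S.

End Machine.

(** * Polynomial-time algorithms for ST-MSP *)

Section Algorithms.
Variables (R : realType) (P : eqType) (d : P -> P -> R) (A : structure R P).

(* With at most k terminals, k constant, the size of an instance is governed
   by the maximum distance D between terminals: the number of Steiner points
   to be output grows linearly with D. *)
Definition solvable_with_terminals (k : nat) : Prop :=
  poly_time_solvable A
    (fun T D => [/\ uniq T, (size T <= k)%N & max_dist_le d T D%:R])
    (optimal d).

(* For every polynomial bound q on the maximum distance between terminals in
   terms of their number. *)
Definition poly_time_approximable (rho : R) : Prop :=
  forall q : {poly nat},
    poly_time_solvable A
      (fun T n => [/\ uniq T, size T = n & max_dist_le d T (q.[n])%:R])
      (approximate d rho).

End Algorithms.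

(* Main.v *)
Require Import Defs.
From HB Require Import structures.
From mathcomp Require Import all_boot all_order all_algebra.
From mathcomp Require Import all_classical all_reals all_analysis.
From mathcomp Require Import zify ring lra.

(** Let [OPT] be the number of Steiner points of an optimal solution.  The
    algorithm solves every subinstance with at most [k] terminals and then
    greedily merges blocks of terminals, always choosing the subinstance with
    the largest decrease of a potential per Steiner point.  The potential is the
    weight of a minimum spanning tree of the blocks, written as a sum over
    thresholds of numbers of components, so that the decrease caused by a
    subinstance is diminishing under merging.

    Initially the potential is at most [(Delta - 1) * OPT]: when a Steiner point
    is deleted while one of its neighbours is present, the components that it
    joined, over all thresholds together, are represented by points whose
    radial projections form a packing of a unit ball.

    An optimal solution splits into subinstances with few terminals at a total
    cost of [(1 + 4 / r) * OPT]: in a depth-first search tree of the unit-disk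
    graph every vertex has at most [Delta] children, and the tree is cut at every
    [r]-th branching level, the cut vertices being joined to nearby terminals.

    Hence every choice that spends [c] and decreases a potential [x] by [g]
    satisfies [c <= g] and [x * c <= g * M] with [M = (1 + 4 / r) * OPT], and the
    total cost is bounded by the integral of [min 1 (M / t)] for [t] between [0]
    and [(Delta - 1) * OPT], which is at most [M * (1 + ln (Delta - 1))]. *)

Set Implicit Arguments.
Unset Strict Implicit.
Unset Printing Implicit Defensive.

Local Open Scope nat_scope.

(** * Labelings and their merging *)

(** The two bounds on a choice act in different ranges. The averaged bound [x * c <= g * M] alone
    integrates to a logarithm that diverges as the potential tends to 0; once the potential is at
    most [M], the bound [c <= g] takes over and yields the summand 1 of the ratio. The factor is
    [Delta - 1] and not [Delta] because the neighbour still present occupies one place of the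
    packing.

    Connectivity of a family of pieces is expressed by quantifying over all equivalence relations
    that are constant on every piece. No hypergraph or tree is built, and the relation can be
    instantiated with equality of labels, with reachability in the unit-disk graph, or with a
    relation transported from indices to points. The decomposition into small pieces belongs to the
    analysis only; the algorithm never computes it.

    The solver for few terminals is an unknown program, polynomial only on its own instances. Hence
    programs are composed relative to a domain ([ptime]). The geometry is done for any subadditive,
    absolutely homogeneous [N], which covers both the norm of a normed module and [eucl_norm]. *)

Section Labelings.
Variables (X L : eqType).
Implicit Types (V K : seq X) (f : X -> L) (E : X -> X -> Prop).

Definition merge_labels K f : X -> L :=
  fun x => if f x \in map f K then head (f x) (map f K) else f x.

Definition equivalence_rel_on E : Prop :=
  [/\ forall x, E x x, forall x y, E x y -> E y x
    & forall x y z, E x y -> E y z -> E x z].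

Definition constant_on E K : Prop := forall x y, x \in K -> y \in K -> E x y.

Lemma merge_labels_coarser K f x y :
  f x = f y -> merge_labels K f x = merge_labels K f y.
Proof. by rewrite /merge_labels => ->. Qed.

Lemma merge_labels_constant K f x y :
  x \in K -> y \in K -> merge_labels K f x = merge_labels K f y.
Proof.
move=> xK yK; rewrite /merge_labels !map_f //.
by case: K xK yK.
Qed.

(** The universal property of merging; with it, different orders of merging are compared without
    inspecting labels. *)
Lemma merge_labels_finest V K f E : equivalence_rel_on E ->
  {subset K <= V} ->
  (forall x y, x \in V -> y \in V -> f x = f y -> E x y) ->
  constant_on E K ->
  forall x y, x \in V -> y \in V ->
    merge_labels K f x = merge_labels K f y -> E x y.
Proof.
move=> [Er Es Et] KV fE KE x y xV yV; rewrite /merge_labels.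
case: (boolP (f x \in _)) => [/mapP[x' x'K fx]|nx];
  case: (boolP (f y \in _)) => [/mapP[y' y'K fy]|ny].
- move=> _; apply: (Et _ x'); first by apply: fE => //; apply: KV.
  apply: (Et _ y'); first exact: KE.
  by apply: fE => //; apply: KV.
- move=> h; exfalso; move/negP: ny; apply.
  by case: K x'K h {KE KV} => // k K' x'K /= <-; rewrite mem_head.
- move=> h; exfalso; move/negP: nx; apply.
  by case: K y'K h {KE KV} => // k K' y'K /= ->; rewrite mem_head.
- exact: fE.
Qed.

End Labelings.

Lemma undup_map_leq (X L L' : eqType) (V : seq X) (f : X -> L) (g : X -> L') :
  (forall x y, x \in V -> y \in V -> f x = f y -> g x = g y) ->
  size (undup (map g V)) <= size (undup (map f V)).
Proof.
elim: V => [|v V IH] //= h.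
have {}IH := IH (fun x y hx hy => h x y (mem_behead (s := v :: V) hx)
                                       (mem_behead (s := v :: V) hy)).
case: ifPn => gv; case: ifPn => fv //=; first exact: leq_trans IH _.
case/negP: gv; case/mapP: fv => x xV e.
by apply/mapP; exists x => //; apply: h => //; rewrite inE ?eqxx ?xV ?orbT.
Qed.

(** The surviving labels are those not occurring on [K], plus one for the merged block. *)
Lemma undup_map_merge (X L : eqType) (V K : seq X) (f : X -> L) :
  {subset K <= V} -> K != [::] ->
  (size (undup (map (merge_labels K f) V)) + size (undup (map f K))
   = (size (undup (map f V))).+1)%N.
Proof.
move=> KV; case: K KV => [//|k K0] KV _; set K := k :: K0.
set A := undup (map f V); set B := undup (map f K).
have BA : {subset B <= A}.
  by move=> l; rewrite !mem_undup => /mapP[x xK ->]; apply: map_f; apply: KV.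
have -> : size (undup (map (merge_labels K f) V))
          = size (f k :: [seq l <- A | l \notin B]).
  apply: perm_size; apply: uniq_perm; rewrite ?undup_uniq //=.
    by rewrite mem_filter mem_undup mem_head /= filter_uniq ?undup_uniq.
  move=> l; rewrite mem_undup inE mem_filter !mem_undup.
  apply/mapP/idP => [[x xV ->]|].
    rewrite /merge_labels; case: ifPn => [_|nK]; first by rewrite eqxx.
    by rewrite nK map_f ?orbT.
  case/orP => [/eqP ->|/andP[lB /mapP[x xV lx]]].
    exists k; first by apply: KV; rewrite mem_head.
    by rewrite /merge_labels /= mem_head.
  by exists x => //; rewrite /merge_labels -lx (negbTE lB).
rewrite /= addSn; congr _.+1.
rewrite -(count_predC (mem B) A) addnC size_filter; congr (_ + _)%N.
rewrite -size_filter; apply: perm_size; apply: uniq_perm;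
  rewrite ?filter_uniq ?undup_uniq //.
move=> l; rewrite mem_filter /=.
by case: (boolP (l \in B)) => // /BA ->.
Qed.

(* [lab] labels the indices below [size lab]; the classes of the labeling are
   the blocks of the current partition of the terminals. *)
Definition merge (lab : seq nat) (K : seq nat) : seq nat :=
  let ls := map (nth 0 lab) K in
  [seq if l \in ls then head l ls else l | l <- lab].

Definition block_count (lab : seq nat) : nat := size (undup lab).

Definition refines (n : nat) (lab lab' : seq nat) : Prop :=
  forall i j, i < n -> j < n -> nth 0 lab i = nth 0 lab j ->
    nth 0 lab' i = nth 0 lab' j.

Definition refines_rel (n : nat) (lab : seq nat) (E : nat -> nat -> Prop) :=
  forall i j, i < n -> j < n -> nth 0 lab i = nth 0 lab j -> E i j.

Definition below (n : nat) (K : seq nat) : Prop := {subset K <= iota 0 n}.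

Definition touched (lab : seq nat) (K : seq nat) : nat :=
  size (undup (map (nth 0 lab) K)).

(** * Block counts under merging, and independence of the order of merges *)

Section Merge.
Variable n : nat.
Implicit Types (lab K : seq nat) (E : nat -> nat -> Prop).

Lemma size_merge lab K : size (merge lab K) = size lab.
Proof. exact: size_map. Qed.

Lemma nth_merge lab K i : i < size lab ->
  nth 0 (merge lab K) i = merge_labels K (nth 0 lab) i.
Proof. by move=> il; rewrite /merge (nth_map 0). Qed.

Lemma mem_iota0 i : (i \in iota 0 n) = (i < n).
Proof. by rewrite mem_iota. Qed.

Lemma belowP K i : below n K -> i \in K -> i < n.
Proof. by move=> Kn /Kn; rewrite mem_iota0. Qed.

Lemma block_count_nth lab : size lab = n ->
  block_count lab = size (undup (map (nth 0 lab) (iota 0 n))).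
Proof. by move=> <-; rewrite map_nth_iota0 // take_size. Qed.

Lemma refines_merge lab K : size lab = n -> refines n lab (merge lab K).
Proof.
by move=> sl i j il jl e; rewrite !nth_merge ?sl //; exact: merge_labels_coarser.
Qed.

Lemma merge_constant lab K : size lab = n -> below n K ->
  forall i j, i \in K -> j \in K ->
    nth 0 (merge lab K) i = nth 0 (merge lab K) j.
Proof.
move=> sl Kn i j iK jK; rewrite !nth_merge ?sl ?(belowP Kn) //.
exact: merge_labels_constant.
Qed.

Lemma merge_finest lab K E : size lab = n -> below n K ->
  equivalence_rel_on E -> refines_rel n lab E -> constant_on E K ->
  refines_rel n (merge lab K) E.
Proof.
move=> sl Kn eE lE KE i j il jl; rewrite !nth_merge ?sl //.
apply: (merge_labels_finest eE Kn) => //; rewrite ?mem_iota0 //.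
by move=> x y; rewrite !mem_iota0; exact: lE.
Qed.

Lemma block_count_refines lab lab' : size lab = n -> size lab' = n ->
  refines n lab lab' -> block_count lab' <= block_count lab.
Proof.
move=> sl sl' r; rewrite !block_count_nth //.
by apply: undup_map_leq => x y; rewrite !mem_iota0; exact: r.
Qed.

Lemma touched_refines lab lab' K : below n K -> refines n lab lab' ->
  touched lab' K <= touched lab K.
Proof.
move=> Kn r; apply: undup_map_leq => x y xK yK.
by apply: r; apply: belowP Kn _.
Qed.

(** Predecessors count spanning-tree edges instead of components, which also makes the identity hold
    for empty [K]. *)
Lemma block_count_merge lab K : size lab = n -> below n K ->
  (block_count lab).-1 = (block_count (merge lab K)).-1 + (touched lab K).-1.
Proof.
move=> sl Kn; case: (eqVneq K [::]) => [->|K0].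
  by rewrite /merge /touched /= map_id addn0.
have := @undup_map_merge _ _ (iota 0 n) K (nth 0 lab) Kn K0.
have -> : map (merge_labels K (nth 0 lab)) (iota 0 n) = merge lab K.
  rewrite -[RHS](@take_size _ _) size_merge sl.
  rewrite -(@map_nth_iota0 _ 0) ?size_merge ?sl //.
  by apply/eq_in_map => i; rewrite mem_iota0 => il; rewrite nth_merge ?sl.
rewrite -block_count_nth // => e.
have t0 : 0 < size (undup (map (nth 0 lab) K)).
  case: K K0 {Kn e} => // k K _; rewrite -has_predT; apply/hasP.
  by exists (nth 0 lab k); rewrite // mem_undup mem_head.
have b0 : 0 < block_count (merge lab K).
  case: K K0 Kn {e t0} => // k K _ Kn.
  have kn : k < size (merge lab (k :: K)).
    by rewrite size_merge sl; apply: (belowP Kn); rewrite mem_head.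
  rewrite -has_predT; apply/hasP.
  by exists (nth 0 (merge lab (k :: K)) k); rewrite // mem_undup mem_nth.
have e' : block_count (merge lab K) + touched lab K = (block_count lab).+1.
  exact: e.
by have t0' : 0 < touched lab K := t0; lia.
Qed.

Lemma equivalence_nth lab : equivalence_rel_on (fun i j => nth 0 lab i = nth 0 lab j).
Proof. by split=> // x y z -> ->. Qed.

Lemma block_count1 lab i j : size lab = n -> block_count lab <= 1 ->
  i < n -> j < n -> nth 0 lab i = nth 0 lab j.
Proof.
move=> sl; rewrite /block_count => b1 il jl.
have hi : nth 0 lab i \in undup lab by rewrite mem_undup mem_nth ?sl.
have hj : nth 0 lab j \in undup lab by rewrite mem_undup mem_nth ?sl.
case: (undup lab) b1 hi hj => [|x [|y s]] //= _.
by rewrite !inE => /eqP -> /eqP ->.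
Qed.

Lemma block_count_le1 lab : size lab = n ->
  (forall i j, i < n -> j < n -> nth 0 lab i = nth 0 lab j) ->
  block_count lab <= 1.
Proof.
move=> sl h; rewrite /block_count.
have : {subset undup lab <= [:: head 0 lab]}.
  move=> x; rewrite mem_undup => /(nthP 0)[i il <-]; rewrite inE -nth0.
  by apply/eqP/h; rewrite -sl //; case: (lab) il.
by move/(uniq_leq_size (undup_uniq lab)).
Qed.

Definition merge_all lab Ks := foldl merge lab Ks.

Lemma size_merge_all lab Ks : size (merge_all lab Ks) = size lab.
Proof. by elim: Ks lab => //= K Ks IH lab; rewrite IH size_merge. Qed.

Lemma refines_merge_all lab Ks : size lab = n -> refines n lab (merge_all lab Ks).
Proof.
elim: Ks lab => [|K Ks IH] lab sl //= i j il jl e.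
by apply: IH; rewrite ?size_merge //; apply: refines_merge.
Qed.

Lemma merge_all_constant lab Ks : size lab = n ->
  {in Ks, forall K, below n K} ->
  {in Ks, forall K, forall i j, i \in K -> j \in K ->
    nth 0 (merge_all lab Ks) i = nth 0 (merge_all lab Ks) j}.
Proof.
elim: Ks lab => [|K0 Ks IH] lab sl //= Kn K; rewrite inE => /orP[/eqP ->|KK] i j iK jK.
  have K0n : below n K0 by apply: Kn; rewrite mem_head.
  by apply: refines_merge_all; rewrite ?size_merge ?(belowP K0n) //;
     exact: merge_constant.
apply: (IH _ _ _ K) => //; first by rewrite size_merge.
by move=> K' K'K; apply: Kn; rewrite inE K'K orbT.
Qed.

Lemma merge_all_finest lab Ks E : size lab = n ->
  {in Ks, forall K, below n K} ->
  equivalence_rel_on E -> refines_rel n lab E ->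
  {in Ks, forall K, constant_on E K} ->
  refines_rel n (merge_all lab Ks) E.
Proof.
move=> + + eE; elim: Ks lab => [|K0 Ks IH] lab sl //= Kn lE KE.
apply: IH; rewrite ?size_merge //.
- by move=> K KK; apply: Kn; rewrite inE KK orbT.
- by apply: merge_finest => //; [apply: Kn|apply: KE]; rewrite mem_head.
- by move=> K KK; apply: KE; rewrite inE KK orbT.
Qed.

(** The labels of the two sides may differ, but each labeling refines the other by the universal
    property. *)
Lemma merge_all_swap lab K Ks : size lab = n -> below n K ->
  {in Ks, forall K, below n K} ->
  block_count (merge_all (merge lab K) Ks)
  = block_count (merge (merge_all lab Ks) K).
Proof.
move=> sl Kn Ksn; apply/eqP; rewrite eqn_leq; apply/andP; split.
  apply: block_count_refines; rewrite ?size_merge_all ?size_merge ?size_merge_all //.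
  apply: merge_finest; rewrite ?size_merge_all //; first exact: equivalence_nth.
    apply: merge_all_finest => //; first exact: equivalence_nth.
      move=> i j il jl e; apply: refines_merge_all; rewrite ?size_merge //.
      exact: refines_merge.
    by move=> K' K'K i j iK jK; apply: merge_all_constant K'K _ _ iK jK;
       rewrite ?size_merge.
  move=> i j iK jK; apply: refines_merge_all; rewrite ?size_merge ?(belowP Kn) //.
  exact: merge_constant.
apply: block_count_refines; rewrite ?size_merge_all ?size_merge ?size_merge_all //.
apply: merge_all_finest; rewrite ?size_merge //; first exact: equivalence_nth.
  apply: merge_finest => //; first exact: equivalence_nth.
    move=> i j il jl e; apply: refines_merge; rewrite ?size_merge_all //.
    exact: refines_merge_all.
  by move=> i j iK jK; apply: merge_constant; rewrite ?size_merge_all.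
move=> K' K'K i j iK jK; have K'n := Ksn _ K'K.
apply: refines_merge; rewrite ?size_merge_all ?(belowP K'n) //.
exact: merge_all_constant K'K _ _ iK jK.
Qed.

(** Diminishing returns: when its turn comes, a set touches at most as many blocks as it does in
    [lab], because the partition has only become coarser. *)
Lemma block_count_le_touched lab Ks : size lab = n ->
  {in Ks, forall K, below n K} ->
  (block_count lab).-1 <=
    (block_count (merge_all lab Ks)).-1 + \sum_(K <- Ks) (touched lab K).-1.
Proof.
elim: Ks lab => [|K0 Ks IH] lab sl Kn /=; first by rewrite big_nil addn0.
have K0n : below n K0 by apply: Kn; rewrite mem_head.
have Kn' : {in Ks, forall K, below n K}.
  by move=> K KK; apply: Kn; rewrite inE KK orbT.
rewrite (block_count_merge sl K0n) big_cons addnCA addnC leq_add2l.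
apply: leq_trans (IH _ _ Kn') _; rewrite ?size_merge // leq_add2l.
rewrite big_seq [leqRHS]big_seq; apply: leq_sum => K KK.
have := touched_refines (Kn' _ KK) (@refines_merge lab K0 sl); lia.
Qed.

End Merge.

(** * The greedy choice *)

Section Greedy.
Variable P : eqType.

(* A candidate pairs a set of terminal indices with Steiner points joining
   them. *)
Local Notation candidate := (seq nat * seq P)%type.
Implicit Types (C : seq candidate) (lab K : seq nat).

Definition close_upto C (j : nat) lab : seq nat :=
  foldl (fun lab c => if size c.2 <= j then merge lab c.1 else lab) lab C.

(* Weight of a minimum spanning tree of the current blocks, where a candidate
   of cost [c] is an edge of weight [c]: by Kruskal's rule it is the sum over
   all thresholds of the number of components minus one. *)
Definition potential C (J : nat) lab : nat :=
  \sum_(j <- iota 0 J) (block_count (close_upto C j lab)).-1.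

Definition gain C J lab K : nat := potential C J lab - potential C J (merge lab K).

Definition better C J lab (b : (nat * nat) * candidate) (c : candidate) :=
  if b.1.1 * size c.2 < gain C J lab c.1 * b.1.2
  then ((gain C J lab c.1, size c.2), c) else b.

(* The initial choice, of fictitious density 0/1, merges nothing; it survives
   exactly when no candidate has a positive gain. *)
Definition best C J lab : (nat * nat) * candidate :=
  foldl (better C J lab) ((0, 1), ([::], [::])) C.

Definition greedy_step C J (st : candidate) : candidate :=
  (merge st.1 (best C J st.1).2.1, (best C J st.1).2.2 ++ st.2).

(** Connectedness of the hypergraph whose hyperedges are the index sets of [C], in impredicative
    form. *)
Definition connecting (n : nat) (C : seq candidate) : Prop :=
  forall E, equivalence_rel_on E -> {in C, forall c, constant_on E c.1} ->
    forall i j, i < n -> j < n -> E i j.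

(** * Progress and soundness of one greedy choice *)

Section Analysis.
Variables (n : nat) (C : seq candidate) (J : nat).
Hypotheses (C_below : {in C, forall c, below n c.1})
  (C_cost : {in C, forall c, size c.2 < J}) (C_conn : connecting n C).

Let Ks j := [seq c.1 | c <- C & size c.2 <= j].

Lemma close_uptoE j lab : close_upto C j lab = merge_all lab (Ks j).
Proof.
rewrite /close_upto /Ks; elim: (C) lab => [|c C' IH] lab //=.
by rewrite IH; case: ifP.
Qed.

Lemma Ks_below j : {in Ks j, forall K, below n K}.
Proof. by move=> K /mapP[c]; rewrite mem_filter => /andP[_ /C_below] + ->. Qed.

Lemma size_close_upto j lab : size (close_upto C j lab) = size lab.
Proof. by rewrite close_uptoE size_merge_all. Qed.

Lemma potential_merge lab K : size lab = n -> below n K ->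
  potential C J lab = potential C J (merge lab K)
    + \sum_(j <- iota 0 J) (touched (close_upto C j lab) K).-1.
Proof.
move=> sl Kn; rewrite /potential -big_split /=; apply: eq_bigr => j _.
rewrite (@block_count_merge n _ K) ?size_close_upto // !close_uptoE.
by rewrite (@merge_all_swap n) //; apply: Ks_below.
Qed.

Lemma gainE lab K : size lab = n -> below n K ->
  gain C J lab K = \sum_(j <- iota 0 J) (touched (close_upto C j lab) K).-1.
Proof. by move=> sl Kn; rewrite /gain (potential_merge sl Kn) addKn. Qed.

Lemma potential_gain lab K : size lab = n -> below n K ->
  potential C J lab = potential C J (merge lab K) + gain C J lab K.
Proof. by move=> sl Kn; rewrite gainE // -potential_merge. Qed.

(** At each threshold, merging all of [F] leaves a single block, so by diminishing returns the
    separate gains at that threshold already account for all blocks but one. *)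
Lemma potential_le_sum_gain lab (F : seq candidate) : size lab = n ->
  {subset F <= C} -> connecting n F ->
  potential C J lab <= \sum_(c <- F) gain C J lab c.1.
Proof.
move=> sl FC Fconn.
have Fn : {in F, forall c, below n c.1} by move=> c /FC /C_below.
rewrite [leqRHS]big_seq.
under [leqRHS]eq_bigr => c cF do rewrite (gainE sl (Fn _ cF)).
rewrite -[leqRHS]big_seq exchange_big /=; apply: leq_sum => j _.
have sj : size (close_upto C j lab) = n by rewrite size_close_upto.
have Fn' : {in [seq c.1 | c <- F], forall K, below n K}.
  by move=> K /mapP[c /Fn] + ->.
apply: leq_trans (block_count_le_touched sj Fn') _; rewrite big_map.
suff : block_count (merge_all (close_upto C j lab) [seq c.1 | c <- F]) <= 1.
  by case: block_count => [|[]].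
apply: (@block_count_le1 n); first by rewrite size_merge_all.
apply: Fconn; first exact: equivalence_nth.
by move=> c cF i k; apply: (@merge_all_constant n); rewrite // map_f.
Qed.

Lemma close_upto_refines j j' lab : size lab = n -> j <= j' ->
  refines n (close_upto C j lab) (close_upto C j' lab).
Proof.
move=> sl jj'; rewrite !close_uptoE.
apply: merge_all_finest => //; first exact: Ks_below.
- exact: equivalence_nth.
- exact: refines_merge_all.
move=> K /mapP[c]; rewrite mem_filter => /andP[cj cC ->] x y.
apply: (@merge_all_constant n) => //; first exact: Ks_below.
by apply: map_f; rewrite mem_filter cC (leq_trans cj).
Qed.

(** Such a candidate is merged at threshold 0 and hence at all thresholds. This keeps the
    denominators of the densities in [best] positive. *)
Lemma gain_zero_cost lab c : size lab = n -> c \in C -> size c.2 = 0 ->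
  gain C J lab c.1 = 0.
Proof.
move=> sl cC c0; rewrite (gainE sl (C_below cC)); rewrite big1 // => j _.
suff : touched (close_upto C j lab) c.1 <= 1 by case: touched => [|[]].
rewrite /touched; set F := close_upto _ _ _.
have h : {subset undup [seq nth 0 F i | i <- c.1] <= [:: nth 0 F (head 0 c.1)]}.
  move=> l; rewrite mem_undup => /mapP[i ic ->]; rewrite inE; apply/eqP.
  rewrite /F close_uptoE; apply: (@merge_all_constant n) (c.1) _ _ _ _ _ => //.
  + exact: Ks_below.
  + by apply: map_f; rewrite mem_filter cC c0.
  + by case: (c.1) ic => // k K _; rewrite mem_head.
exact: uniq_leq_size (undup_uniq _) h.
Qed.

(** Let [j] be the last threshold with more than one block. Some candidate of cost exactly [j.+1]
    must join distinct blocks at threshold [j]; lower thresholds have finer blocks, so it gains at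
    least one at each of the [j.+1] thresholds up to [j]. *)
Lemma gain_ge_cost lab : size lab = n -> 0 < potential C J lab ->
  exists2 c, c \in C & 0 < size c.2 <= gain C J lab c.1.
Proof.
move=> sl pot.
pose B j := 1 < block_count (close_upto C j lab).
have exj : exists j, (j < J) && B j.
  have : has B (iota 0 J).
    apply/negPn/negP => /hasPn h; move: pot; rewrite lt0n => /negP; apply.
    rewrite /potential big_seq big1 // => j /h; rewrite /B.
    by case: block_count => [|[]].
  by case/hasP => j; rewrite mem_iota => /andP[_ jJ] Bj; exists j; rewrite jJ.
have bnd : forall j, (j < J) && B j -> j <= J by move=> j /andP[/ltnW].
case: (ex_maxnP exj bnd) => j /andP[jJ Bj] jmax.
have next : block_count (close_upto C j.+1 lab) <= 1.
  case: (ltnP j.+1 J) => [j1J|Jj].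
    rewrite leqNgt; apply/negP => h.
    by have := jmax j.+1; rewrite j1J /B h ltnn => /(_ isT).
  (* From threshold [J] on every candidate is merged, since all costs are below [J]. *)
  apply: (@block_count_le1 n); first by rewrite size_close_upto.
  apply: C_conn; first exact: equivalence_nth.
  move=> c cC x y; rewrite close_uptoE.
  apply: (@merge_all_constant n) => //; first exact: Ks_below.
  by apply: map_f; rewrite mem_filter cC ltnW // (leq_trans (C_cost cC)).
set F := close_upto C j lab in Bj.
have sF : size F = n by rewrite size_close_upto.
have [c cC /andP[cj tc]] : exists2 c, c \in C & (size c.2 == j.+1) && (1 < touched F c.1).
  apply/hasP/negPn/negP => /hasPn h.
  suff r : refines n (close_upto C j.+1 lab) F.
    have := block_count_refines _ sF r; rewrite size_close_upto => /(_ sl).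
    by rewrite leqNgt (leq_ltn_trans next).
  rewrite close_uptoE.
  apply: merge_all_finest => //; first exact: Ks_below.
  - exact: equivalence_nth.
  - by rewrite /F close_uptoE; exact: refines_merge_all.
  move=> K /mapP[c]; rewrite mem_filter => /andP[+ cC ->] x y xc yc.
  rewrite leq_eqVlt => /orP[e|cj]; last first.
    rewrite /F close_uptoE; apply: (@merge_all_constant n) xc yc => //.
      exact: Ks_below.
    by apply: map_f; rewrite mem_filter cC -ltnS cj.
  have := h _ cC; rewrite e /= -leqNgt /touched => t1.
  have hx : nth 0 F x \in undup [seq nth 0 F i | i <- c.1] by rewrite mem_undup map_f.
  have hy : nth 0 F y \in undup [seq nth 0 F i | i <- c.1] by rewrite mem_undup map_f.
  case: undup t1 hx hy => [|a [|? ?]] //= _.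
  by rewrite !inE => /eqP -> /eqP ->.
exists c => //; rewrite (eqP cj) /= (gainE sl (C_below cC)).
have -> : iota 0 J = iota 0 j.+1 ++ iota j.+1 (J - j.+1).
  by rewrite -iotaD subnKC.
rewrite big_cat /=; apply: leq_trans (leq_addr _ _).
apply: leq_trans (_ : \sum_(i <- iota 0 j.+1) 1 <= _).
  by rewrite sum1_size size_iota.
rewrite big_seq [leqRHS]big_seq; apply: leq_sum => i; rewrite mem_iota => /andP[_ ij].
have := touched_refines (C_below cC) (@close_upto_refines i j lab sl ij).
by move=> h; have := leq_trans tc h; case: touched => [|[]].
Qed.

Lemma gain_no_potential lab K : potential C J lab = 0 -> gain C J lab K = 0.
Proof. by rewrite /gain => ->. Qed.

Lemma bestP lab : size lab = n ->
  [/\ 0 < (best C J lab).1.2,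
      {in C, forall c, gain C J lab c.1 * (best C J lab).1.2
                       <= (best C J lab).1.1 * size c.2}
    & best C J lab = ((0, 1), ([::], [::])) \/
      (best C J lab).2 \in C /\
      (best C J lab).1 = (gain C J lab (best C J lab).2.1, size (best C J lab).2.2)].
Proof.
move=> sl; pose B C' := foldl (better C J lab) ((0, 1), ([::], [::])) C'.
suff H C' : {subset C' <= C} ->
  [/\ 0 < (B C').1.2,
      {in C', forall c, gain C J lab c.1 * (B C').1.2 <= (B C').1.1 * size c.2}
    & B C' = ((0, 1), ([::], [::])) \/
      (B C').2 \in C /\
      (B C').1 = (gain C J lab (B C').2.1, size (B C').2.2)].
  exact: H.
rewrite /B; elim/last_ind: C' => [|C' c IH] sub; first by split=> //; left.
have {IH} := IH (fun c' h =>
  sub c' (eqbRL (mem_rcons C' c c') (mem_behead (s := c :: C') h))).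
have cC : c \in C by apply: sub; rewrite mem_rcons mem_head.
rewrite foldl_rcons; set b := foldl _ _ _ => -[b0 bmax bC].
rewrite /better; case: ifPn => [lt|]; last first.
  rewrite -leqNgt => ge; split=> // c'; rewrite mem_rcons inE => /orP[/eqP ->//|].
  exact: bmax.
have cpos : 0 < size c.2.
  rewrite lt0n; apply/eqP => c0; move: lt.
  by rewrite (gain_zero_cost sl cC c0) mul0n ltn0.
split=> //=; last by right.
move=> c'; rewrite mem_rcons inE => /orP[/eqP ->//|/bmax h].
(* Transitivity of the order on fractions, with denominators cleared; the denominator of the
   previous choice is the one that cancels. *)
rewrite -(leq_pmul2r b0).
move: h lt; set g' := gain _ _ _ c'.1; set g := gain _ _ _ c.1 => h lt.
have h1 := leq_mul h (leqnn (size c.2)).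
have h2 := leq_mul (ltnW lt) (leqnn (size c'.2)).
rewrite mulnAC; apply: leq_trans h1 _; rewrite mulnAC; apply: leq_trans h2 _.
by rewrite mulnAC.
Qed.

(** The chosen density is at least that of the candidate from [gain_ge_cost], hence at least 1. It
    is also at least the average density of [F], whose gains sum to the potential or more. At
    potential 0 nothing is bought and [c = g = 0]. *)
Lemma greedy_step_progress (st : candidate) (F : seq candidate) :
  size st.1 = n -> {subset F <= C} -> connecting n F ->
  exists c g, [/\ size (greedy_step C J st).2 = c + size st.2,
    potential C J st.1 = potential C J (greedy_step C J st).1 + g,
    c <= g, potential C J st.1 * c <= g * \sum_(c <- F) size c.2
    & 0 < potential C J st.1 -> 0 < g].
Proof.
case: st => lab out /= sl FC Fconn; rewrite /greedy_step /=.
have [b0 bmax bC] := bestP sl.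
case: (posnP (potential C J lab)) => [pot0|pot].
  have {bC}-> : best C J lab = ((0, 1), ([::], [::])).
    case: bC => // -[bC eb].
    suff : forall C', foldl (better C J lab) (0, 1, ([::], [::])) C' = (0, 1, ([::], [::])).
      exact.
    by elim=> [|c C' IH] //=; rewrite {2}/better gain_no_potential.
  exists 0, 0; split=> //=; rewrite ?muln0 ?addn0 //.
  by rewrite /merge /= map_id.
have [c cC /andP[c0 cg]] := gain_ge_cost sl pot.
have hc := bmax _ cC.
have g0 : 0 < (best C J lab).1.1.
  rewrite lt0n; apply/eqP => e; move: hc; rewrite e mul0n leqNgt muln_gt0.
  by rewrite b0 (leq_trans c0 cg).
case: bC => [eb|[bC eb]]; first by rewrite eb in g0.
move: (best C J lab) b0 bmax hc g0 bC eb => [[g s] b] /= s0 bmax hc g0 bC [eg es].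
exists s, g; split=> //; first by rewrite size_cat es.
- by rewrite eg -(potential_gain sl (C_below bC)).
- rewrite -(leq_pmul2r c0).
  by apply: leq_trans hc; rewrite mulnC leq_mul2r cg orbT.
- apply: leq_trans (leq_mul (potential_le_sum_gain sl FC Fconn) (leqnn s)) _.
  rewrite big_distrl big_distrr /= big_seq [leqRHS]big_seq.
  by apply: leq_sum => c' /FC /bmax.
Qed.

(** Soundness invariant: every block is held together by candidates whose Steiner points have all
    been bought. *)
Definition supported (st : candidate) : Prop :=
  forall E, equivalence_rel_on E ->
    {in C, forall c, {subset c.2 <= st.2} -> constant_on E c.1} ->
    refines_rel n st.1 E.

Lemma greedy_step_supported st : size st.1 = n -> supported st ->
  supported (greedy_step C J st).
Proof.
case: st => lab out /= sl sup E eE; rewrite /greedy_step /=.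
have [_ _ bC] := bestP sl; case: bC => [->|[bC _]] /= EC.
  by rewrite /merge /= map_id; exact: sup.
apply: (merge_finest sl (C_below bC) eE).
  apply: sup => // c cC sub; apply: EC => // x /sub xo.
  by rewrite mem_cat xo orbT.
by apply: EC => // x xb; rewrite mem_cat xb.
Qed.

(** Potential 0 means one block at threshold 0, where only candidates without Steiner points are
    added; these need no purchase. *)
Lemma supported_no_potential st : 0 < J -> size st.1 = n -> supported st ->
  potential C J st.1 = 0 ->
  forall E, equivalence_rel_on E ->
    {in C, forall c, {subset c.2 <= st.2} -> constant_on E c.1} ->
    forall i j, i < n -> j < n -> E i j.
Proof.
move=> J0 sl sup pot0 E eE EC i j il jl.
have b1 : block_count (close_upto C 0 st.1) <= 1.
  move/eqP: pot0; rewrite /potential; case: (J) J0 => // J' _.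
  rewrite /= big_cons addn_eq0 => /andP[+ _].
  by case: block_count => [|[]].
have r : refines_rel n (close_upto C 0 st.1) E.
  rewrite close_uptoE; apply: merge_all_finest => //; first exact: Ks_below.
    exact: sup.
  move=> K /mapP[c]; rewrite mem_filter leqn0 => /andP[c0 cC ->].
  by apply: EC => //; move/nilP: c0 => ->.
by apply: r => //; apply: (block_count1 _ b1); rewrite ?size_close_upto ?sl.
Qed.

End Analysis.

End Greedy.

(** * Decomposition into pieces with few terminals *)

Section Connectivity.
Variables (R : realType) (P : eqType) (d : P -> P -> R).
Hypothesis d_sym : forall x y, d x y = d y x.
Implicit Types (W T S K : seq P).

Definition connected_in W x y : Prop :=
  exists p, path (unit_disk_graph d W) x p /\ last x p = y.

Lemma connected_refl W x : connected_in W x x.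
Proof. by exists [::]. Qed.

Lemma connected_trans W x y z :
  connected_in W x y -> connected_in W y z -> connected_in W x z.
Proof.
move=> [p [pp lp]] [q [pq lq]]; exists (p ++ q).
by rewrite cat_path last_cat lp pp pq.
Qed.

Lemma connected_edge W x y : x \in W -> y \in W -> (d x y <= 1)%R ->
  connected_in W x y.
Proof.
by move=> xW yW dxy; exists [:: y]; rewrite /= /unit_disk_graph xW yW dxy.
Qed.

Lemma connected_sym W x y : connected_in W x y -> connected_in W y x.
Proof.
move=> [p [pp lp]]; exists (rev (belast x p)); split; last first.
  by case: p pp lp => [_ /= ->//|z p _ _] /=; rewrite rev_cons last_rcons.
rewrite -lp rev_path; apply: sub_path pp => u v /= /and3P[uW vW duv].
by rewrite /unit_disk_graph uW vW d_sym.
Qed.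

Lemma connected_sub W W' x y : {subset W <= W'} ->
  connected_in W x y -> connected_in W' x y.
Proof.
move=> sub [p [pp lp]]; exists p; split=> //; apply: sub_path pp => u v.
by case/and3P => /sub uW /sub vW duv; rewrite /unit_disk_graph uW vW.
Qed.

Lemma connected_eq W W' x y : W =i W' -> connected_in W x y -> connected_in W' x y.
Proof. by move=> e; apply: connected_sub => z; rewrite e. Qed.

Lemma connected_equivalence W : equivalence_rel_on (connected_in W).
Proof.
split; [exact: connected_refl|exact: connected_sym|].
by move=> x y z; exact: connected_trans.
Qed.

Lemma connected_component W C q x : q \in C ->
  (forall y, y \in W -> connected_in W q y -> y \in C) ->
  connected_in W q x -> connected_in C q x.
Proof.
move=> qC comp [p [+ lp]]; elim/last_ind: p x lp => [|p y IH] x.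
  by move=> /= <- _; exact: connected_refl.
rewrite last_rcons => <-; rewrite rcons_path => /andP[pp e].
apply: connected_trans (IH _ erefl pp) _.
have cl : connected_in W q (last q p) by exists p.
case/and3P: (e) => lW yW dly.
have cy : connected_in W q y by apply: connected_trans cl _; exact: connected_edge.
by apply: connected_edge => //; exact: comp.
Qed.

(** A path without repetitions never returns to [p], so after its first edge it avoids [p]. *)
Lemma connected_first_edge W p x : p != x -> connected_in W p x ->
  exists q, [/\ q \in W, q != p, (d p q <= 1)%R
              & connected_in [seq y <- W | y != p] q x].
Proof.
move=> px [s [ps ls]]; move: ls px; case/shortenP: ps => s' ps' us' _.
case: s' ps' us' => [_ _ /= -> /eqP //|q s' /=] /andP[/and3P[pW qW dpq] pq].
rewrite inE negb_or => /andP[/andP[pnq pns] _] ls _.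
exists q; split=> //; first by rewrite eq_sym.
exists s'; split=> //.
have : q != p by rewrite eq_sym.
elim: s' q {ls dpq qW pnq} pns pq => //= z s' IH q.
rewrite inE negb_or => /andP[pz pns] /andP[/and3P[qW zW dqz] pq] qp.
rewrite /unit_disk_graph !mem_filter qW zW dqz qp (eq_sym z) pz /=.
by apply: IH => //; rewrite eq_sym.
Qed.

Lemma feasible_eq T T' S : T =i T' -> feasible d T S -> feasible d T' S.
Proof.
move=> e f u v; rewrite -!e => uT vT; apply: connected_eq (f u v uT vT) => z.
by rewrite !mem_cat e.
Qed.

Lemma feasible_from T S p : (forall x, x \in T -> connected_in (T ++ S) p x) ->
  feasible d T S.
Proof.
move=> h u v uT vT; apply: connected_trans (h v vT).
exact/connected_sym/h.
Qed.

End Connectivity.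

(** * Cutting a depth-first search tree into small pieces *)

Section Decomposition.
Variables (R : realType) (P : eqType) (d : P -> P -> R).
Hypothesis d_sym : forall x y, d x y = d y x.
Variable Delta : nat.
Hypothesis packing : forall c s, ball_packing d c s -> size s <= Delta.
Hypothesis Delta_gt0 : 0 < Delta.
Variable r' : nat.
Local Notation r := r'.+1.
Implicit Types (W T S K Q : seq P) (F : seq (seq P * seq P)).
Local Notation conn := (connected_in d).

(** A complete piece unites the open pieces of at most [Delta] children, each with at most
    [Delta ^ r] terminals, and one further terminal: its root, or the target of a cut path. *)
Definition terminal_bound : nat := (Delta * Delta ^ r).+1.

(** Residues increase downwards: from a root of residue [i] an open piece reaches through [r - i]
    branching levels, each multiplying the terminals by at most [Delta]. A cut, at residue 0, leaves
    one terminal. *)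
Definition open_bound (i : 'I_r) : nat := if i == ord0 then 1 else Delta ^ (r - i).

Definition cost F : nat := \sum_(c <- F) size c.2.

(* Cutting a tree into pieces with few terminals: the pieces in [F] are
   complete, while the piece with terminals [K] still contains the root. *)
Definition open_family Q K F (b : nat) : Prop :=
  [/\ {subset K <= Q}, forall x, x \in Q -> K != [::], size K <= b,
    {in F, forall c, [/\ {subset c.1 <= Q}, size c.1 <= terminal_bound
                       & feasible d c.1 c.2]}
  & forall E, equivalence_rel_on E -> {in F, forall c, constant_on E c.1} ->
      constant_on E K -> forall x y, x \in Q -> y \in K -> E x y].

(* One decomposition for each of [r] residues: branching vertices are cut when
   their branching level has the residue [i], at an extra cost [ext i]; cutting
   at a vertex costs at most twice its distance [size St] to a terminal below
   it, and these distances sum to at most twice the number [s] of Steiner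
   points. *)
Definition rooted p Q (s : nat) : Prop :=
  exists t St (ext : 'I_r -> nat) (K S : 'I_r -> seq P) (F : 'I_r -> seq (seq P * seq P)),
  [/\ t \in Q, conn (t :: St) p t /\ p \in t :: St,
    \sum_i ext i + 2 * size St <= 4 * s
  & forall i, [/\ p \in K i ++ S i, forall x, x \in K i -> conn (K i ++ S i) p x,
      open_family Q (K i) (F i) (open_bound i)
      & size (S i) + cost (F i) <= s + ext i]].

(** The data of [m] subtrees hanging from [p], before [p] itself is accounted for. [St] is a
    shortest of their paths to a terminal, so the paths of the children together pay for
    [m * size St]. *)
Definition forest p Q (s m : nat) : Prop :=
  exists t St (ext : 'I_r -> nat) (K S : 'I_r -> seq P) (F : 'I_r -> seq (seq P * seq P)),
  [/\ 0 < m -> t \in Q /\ conn (p :: t :: St) p t,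
    forall x, x \in Q -> 0 < m,
    \sum_i ext i + 2 * (m * size St) <= 4 * s
  & forall i, [/\ forall x, x \in K i -> conn (p :: K i ++ S i) p x,
      open_family Q (K i) (F i) (m * open_bound i)
      & size (S i) + cost (F i) <= s + ext i]].

Lemma open_family_eq Q Q' K F b : Q =i Q' -> open_family Q K F b ->
  open_family Q' K F b.
Proof.
move=> e [h1 h2 h3 h4 h5]; split=> //.
- by move=> x /h1; rewrite e.
- by move=> x; rewrite -e; exact: h2.
- by move=> c /h4[s1 s2 s3]; split=> // x /s1; rewrite e.
- by move=> E eE FE KE x y; rewrite -e; exact: h5.
Qed.

Lemma rooted_eq p Q Q' s : Q =i Q' -> rooted p Q s -> rooted p Q' s.
Proof.
move=> e [t [St [ext [K [S [F [tQ cT sum h]]]]]]].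
exists t, St, ext, K, S, F; split; rewrite -?e // => i.
by have [h1 h2 h3 h4] := h i; split=> //; exact: open_family_eq h3.
Qed.

Lemma forest_eq p Q Q' s m : Q =i Q' -> forest p Q s m -> forest p Q' s m.
Proof.
move=> e [t [St [ext [K [S [F [tQ Qm sum h]]]]]]].
exists t, St, ext, K, S, F; split=> //.
- by rewrite -e.
- by move=> x; rewrite -e; exact: Qm.
by move=> i; have [h1 h2 h3] := h i; split=> //; exact: open_family_eq h2.
Qed.

Lemma forest_nil p s : forest p [::] s 0.
Proof.
exists p, [::], (fun=> 0), (fun=> [::]), (fun=> [::]), (fun=> [::]); split=> //.
  by rewrite big1.
by move=> i; split=> //; rewrite /cost big_nil.
Qed.

Lemma cost_cat F F' : cost (F ++ F') = cost F + cost F'.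
Proof. exact: big_cat. Qed.

Lemma cost_cons c F : cost (c :: F) = size c.2 + cost F.
Proof. exact: big_cons. Qed.

Lemma forest_cons p q Q1 Q2 s1 s2 m : (d p q <= 1)%R ->
  rooted q Q1 s1 -> forest p Q2 s2 m -> forest p (Q1 ++ Q2) (s1 + s2) m.+1.
Proof.
move=> dpq [t1 [St1 [ext1 [K1 [S1 [F1 [t1Q [c1 q1] sum1 h1]]]]]]].
move=> [t2 [St2 [ext2 [K2 [S2 [F2 [c2 Qm sum2 h2]]]]]]].
have c1p : conn (p :: t1 :: St1) p t1.
  apply: (@connected_trans _ _ _ _ _ q).
    by apply: connected_edge => //; rewrite ?mem_head // inE q1 orbT.
  by apply: connected_sub c1 => x xt; rewrite inE xt orbT.
(* The shorter of the two paths is kept; [m.+1] copies of it cost at most one copy of the first and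
   [m] of the second. *)
have [t [St [tQ ct le]]] : exists t St, [/\ t \in Q1 ++ Q2, conn (p :: t :: St) p t
    & m.+1 * size St <= size St1 + m * size St2].
  case: (leqP (size St1) (size St2)) => St12.
    by exists t1, St1; split; rewrite ?mem_cat ?t1Q // mulSn leq_add2l leq_mul2l St12 orbT.
  case: (posnP m) => [m0|m_gt0].
    by exists t1, St1; split; rewrite ?mem_cat ?t1Q // m0 mul1n addn0.
  have [t2Q ct2] := c2 m_gt0; exists t2, St2; split; rewrite ?mem_cat ?t2Q ?orbT //.
  by rewrite mulSn leq_add2r ltnW.
exists t, St, (fun i => ext1 i + ext2 i), (fun i => K1 i ++ K2 i),
  (fun i => S1 i ++ S2 i), (fun i => F1 i ++ F2 i); split=> //.
  rewrite big_split /=; move: sum1 sum2 le.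
  by move: (\sum_i _) (\sum_i _) (m.+1 * _) (m * _) => a b c e; lia.
move=> i; have [q1i c1i [K1Q K1n K1b F1Q conn1] cost1] := h1 i.
have [c2i [K2Q K2n K2b F2Q conn2] cost2] := h2 i.
split.
- move=> x; rewrite mem_cat => /orP[xK1|xK2].
    apply: (@connected_trans _ _ _ _ _ q).
      apply: connected_edge => //; first by rewrite mem_head.
      by move: q1i; rewrite inE !mem_cat => /orP[->|->]; rewrite ?orbT.
    apply: connected_sub (c1i _ xK1) => z; rewrite inE !mem_cat.
    by case/orP => ->; rewrite ?orbT.
  apply: connected_sub (c2i _ xK2) => z; rewrite !inE !mem_cat.
  by case/or3P => ->; rewrite ?orbT.
- split.
  + by move=> x; rewrite !mem_cat => /orP[/K1Q ->|/K2Q ->]; rewrite ?orbT.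
  + move=> x _; have := K1n _ t1Q; by case: (K1 i).
  + by rewrite size_cat mulSn leq_add.
  + move=> c; rewrite mem_cat => /orP[/F1Q[h ? ?]|/F2Q[h ? ?]]; split=> // x /h;
    by rewrite mem_cat => ->; rewrite ?orbT.
  + move=> E eE FE KE; case: (eE) => Er Es Et.
    have e1 : forall x y, x \in Q1 -> y \in K1 i -> E x y.
      apply: conn1 => //; first by move=> c cF; apply: FE; rewrite mem_cat cF.
      by move=> x y xK yK; apply: KE; rewrite mem_cat ?xK ?yK.
    have e2 : forall x y, x \in Q2 -> y \in K2 i -> E x y.
      apply: conn2 => //; first by move=> c cF; apply: FE; rewrite mem_cat cF orbT.
      by move=> x y xK yK; apply: KE; rewrite mem_cat ?xK ?yK orbT.
    move=> x y; rewrite mem_cat => /orP[xQ|xQ] yK.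
      have [z zK] : exists z, z \in K1 i.
        by have := K1n _ xQ; case: (K1 i) => // z *; exists z; rewrite mem_head.
      by apply: Et (e1 _ _ xQ zK) _; apply: KE => //; rewrite mem_cat zK.
    have [z zK] : exists z, z \in K2 i.
      by have := K2n _ xQ; case: (K2 i) => // z *; exists z; rewrite mem_head.
    by apply: Et (e2 _ _ xQ zK) _; apply: KE => //; rewrite mem_cat zK orbT.
- by rewrite cost_cat size_cat; lia.
Qed.

Lemma open_bound_le (i : 'I_r) : open_bound i <= Delta ^ r.
Proof.
rewrite /open_bound; case: ifP => _; first by rewrite expn_gt0 Delta_gt0.
by rewrite leq_pexp2l // leq_subr.
Qed.

Lemma piece_size m (i : 'I_r) K x : size K <= m * open_bound i -> m <= Delta ->
  size (x :: K) <= terminal_bound.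
Proof.
move=> Kb mD; rewrite /= /terminal_bound ltnS; apply: leq_trans Kb _.
exact: leq_mul (open_bound_le i).
Qed.

(** A cut at a terminal is free, because [p] can belong to both pieces. It is made for every
    residue, and the path to a terminal becomes empty. *)
Lemma rooted_terminal p Q s m : m <= Delta -> forest p Q s m -> rooted p (p :: Q) s.
Proof.
move=> mD [t [St [ext [K [S [F [ct Qm sum h]]]]]]].
exists p, [::], ext, (fun=> [:: p]), (fun=> [::]),
  (fun i => (p :: K i, S i) :: F i); split.
- by rewrite mem_head.
- by split; [exact: connected_refl|rewrite mem_head].
- by rewrite muln0 addn0; apply: leq_trans sum; rewrite leq_addr.
move=> i; have [ci [KQ Kn Kb FQ conni] costi] := h i; split.
- by rewrite mem_head.
- by move=> x; rewrite inE => /eqP ->; exact: connected_refl.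
- split.
  + by move=> x; rewrite inE => /eqP ->; rewrite mem_head.
  + by [].
  + by rewrite /open_bound; case: ifP => // _; rewrite expn_gt0 Delta_gt0.
  + move=> c; rewrite inE => /orP[/eqP ->|/FQ[h1 h2 h3]]; last first.
      by split=> // x /h1 xQ; rewrite inE xQ orbT.
    split=> /=; [|exact: piece_size Kb mD|].
      by move=> x; rewrite !inE => /orP[->//|/KQ ->]; rewrite orbT.
    apply: (feasible_from d_sym (p := p)) => x; rewrite inE => /orP[/eqP ->|/ci //].
    exact: connected_refl.
  + move=> E eE FE _ x y + yp; case: (eE) => Er Es Et.
    have hE := FE _ (mem_head _ _).
    have -> : y = p by move: yp; rewrite inE => /eqP.
    rewrite inE => /orP[/eqP ->|xQ]; first exact: Er.
    have [z zK] : exists z, z \in K i.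
      by have := Kn _ xQ; case: (K i) => // z *; exists z; rewrite mem_head.
    apply: (Et _ z); last by apply: hE; rewrite !inE ?eqxx ?zK ?orbT.
    apply: conni => // [c cF|u v uK vK].
      by apply: FE; rewrite inE cF orbT.
    by apply: hE; rewrite inE ?uK ?vK orbT.
- by rewrite cost_cons /=.
Qed.

(** Origin of the constant 4: a cut costs at most [2 * (size St).+1], and the reserve for the new
    path is again [2 * (size St).+1]. With at least two children the released reserve
    [2 * (m * size St)] covers all but 4, which [p] pays. A single child causes no branching: [p]
    only lengthens the path. *)
Lemma rooted_steiner p Q s m : 0 < m -> m <= Delta -> forest p Q s m ->
  rooted p Q s.+1.
Proof.
move=> m0 mD [t [St [ext [K [S [F [ct Qm sum h]]]]]]].
have [tQ ctp] := ct m0.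
have root : conn (t :: p :: St) p t /\ p \in t :: p :: St.
  split; last by rewrite !inE eqxx orbT.
  by apply: connected_eq ctp => z; rewrite !inE orbCA.
have link i x : x \in K i -> conn (K i ++ p :: S i) p x.
  have [ci _ _] := h i; move=> /ci; apply: connected_eq => z.
  by rewrite !(inE, mem_cat) orbCA.
case: (ltnP 1 m) => [m2|m1]; last first.
  have {m1 m0} m1 : m = 1 by lia.
  exists t, (p :: St), ext, K, (fun i => p :: S i), F; split=> //.
    by rewrite m1 /= in sum *; lia.
  move=> i; have [ci fam costi] := h i; split.
  - by rewrite mem_cat mem_head orbT.
  - exact: link.
  - by rewrite m1 mul1n in fam.
  - by rewrite /=; lia.
(* Passing a branching vertex shifts the residue: the children use the family of [ordS i]. *)
pose cut (i : 'I_r) := i == ord0.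
pose K' (i : 'I_r) := if cut i then [:: t] else K (ordS i).
pose S' (i : 'I_r) := if cut i then p :: St else p :: S (ordS i).
(* At a cut the path is bought twice: to attach [t] to the piece being completed, and to join [p] to
   [t] in the new open piece. *)
pose F' (i : 'I_r) := if cut i
  then (t :: K (ordS i), p :: S (ordS i) ++ St) :: F (ordS i) else F (ordS i).
exists t, (p :: St), (fun i => ext (ordS i) + (if cut i then 2 * (size St).+1 else 0)),
  K', S', F'; split=> //.
  rewrite big_split /= -big_mkcond /= big_pred1_eq.
  rewrite -(reindex_inj (P := xpredT) (F := ext) (@ordS_inj r)) /=.
  have h2 : 2 * size St <= m * size St by rewrite leq_mul2r m2 orbT.
  by rewrite /= in sum *; move: (m * size St) sum h2 => X; lia.
move=> i; rewrite /K' /S' /F'; have [ci [KQ Kn Kb FQ conni] costi] := h (ordS i).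
case: ifPn => ci0.
- split.
  + by rewrite !inE eqxx orbT.
  + by move=> x; rewrite inE => /eqP ->; case: root.
  + split.
    * by move=> x; rewrite inE => /eqP ->.
    * by [].
    * by rewrite /open_bound -/(cut i) ci0.
    * move=> c; rewrite inE => /orP[/eqP ->|/FQ //]; split=> /=.
      - by move=> x; rewrite inE => /orP[/eqP ->//|/KQ].
      - exact: piece_size Kb mD.
      apply: (feasible_from d_sym (p := p)) => x; rewrite inE => /orP[/eqP ->|xK].
        apply: connected_sub ctp => z; rewrite !(inE, mem_cat).
        by case/or3P => ->; rewrite ?orbT.
      apply: connected_sub (link _ _ xK) => z; rewrite !(inE, mem_cat).
      by case/or3P => ->; rewrite ?orbT.
    * move=> E eE FE _ x y xQ yt; case: (eE) => Er Es Et.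
      have hE := FE _ (mem_head _ _).
      have -> : y = t by move: yt; rewrite inE => /eqP.
      have [z zK] : exists z, z \in K (ordS i).
        by have := Kn _ xQ; case: (K _) => // z *; exists z; rewrite mem_head.
      apply: (Et _ z); last by apply: hE; rewrite !inE ?eqxx ?zK ?orbT.
      apply: conni => // [c cF|u v uK vK].
        by apply: FE; rewrite inE cF orbT.
      by apply: hE; rewrite inE ?uK ?vK orbT.
  + by rewrite cost_cons /= size_cat; lia.
- split.
  + by rewrite mem_cat mem_head orbT.
  + exact: link.
  + split=> //; apply: leq_trans Kb _.
    apply: leq_trans (leq_mul mD (leqnn _)) _.
    rewrite /open_bound -/(cut i) (negbTE ci0); have i0 : 0 < i.
      by rewrite lt0n; apply: contraNneq ci0 => e; apply/eqP/val_inj.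
    case: (ltngtP i.+1 r) (ltn_ord i) => // [ir|ir] _.
      have -> : (ordS i == ord0) = false.
        by apply/negP => /eqP/(congr1 val) /=; rewrite modn_small.
      by rewrite /= modn_small // -expnS subnSK.
    have -> : ordS i == ord0 by apply/eqP/val_inj => /=; rewrite ir modnn.
    have -> : r - i = 1 by lia.
    by rewrite muln1 expn1.
  + by rewrite /=; lia.
Qed.

(** Components of [W0] are peeled off one by one and rooted at a neighbour of [p]; [U] is the union
    of those not yet treated. Components without terminals are discarded. Roots in different
    components are more than 1 apart. *)
Lemma dfs_forest T p W0 :
  (forall q C, size C <= size W0 -> uniq C -> q \in C -> has (mem T) C ->
     (forall x, x \in C -> x \in T -> conn C q x) ->
     rooted q [seq x <- C | x \in T] (count (fun x => x \notin T) C)) ->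
  (forall x, x \in W0 -> x \in T ->
     exists q, [/\ q \in W0, (d p q <= 1)%R & conn W0 q x]) ->
  forall U, uniq U -> {subset U <= W0} ->
  (forall x y, x \in U -> y \in W0 -> conn W0 x y -> y \in U) ->
  exists rs : seq P, [/\ {subset rs <= U}, all (fun q => d p q <= 1)%R rs,
    pairwise (fun x y => 1 < d x y)%R rs
    & forest p [seq x <- U | x \in T] (count (fun x => x \notin T) U) (size rs)].
Proof.
move=> IHC entry U; have [n] := ubnP (size U).
elim: n U => // n IH U Un uU UW closed.
have [/hasP[x xU xT]|noT] := boolP (has (mem T) U); last first.
  exists [::]; split=> //; have -> : [seq x <- U | x \in T] = [::].
    by apply/eqP; rewrite -[_ == _]negbK -has_filter.
  exact: forest_nil.
have [q [qW dpq cqx]] := entry _ (UW _ xU) xT.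
have qU : q \in U by apply: closed xU qW _; exact: connected_sym.
pose inC y := `[< conn W0 q y >].
pose C := [seq y <- U | inC y]; pose U' := [seq y <- U | predC inC y].
have szU : size C + size U' = size U by rewrite !size_filter count_predC.
have qC : q \in C by rewrite mem_filter qU andbT; apply/asboolP/connected_refl.
have C0 : 0 < size C by case: (C) qC.
have CW : size C <= size W0.
  by apply: uniq_leq_size; [rewrite filter_uniq|move=> y; rewrite mem_filter => /andP[_ /UW]].
have [] := IH U'; [by lia|by rewrite filter_uniq| | |].
- by move=> y; rewrite mem_filter => /andP[_ /UW].
- move=> y z; rewrite !mem_filter /= => /andP[yC yU] zW cyz; rewrite (closed y) // andbT.
  apply: contra yC => /asboolP cqz; apply/asboolP.
  by apply: connected_trans cqz _; exact: connected_sym.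
move=> rs [rsU ars prs frs]; exists (q :: rs); split.
- move=> y; rewrite inE => /orP[/eqP ->//|/rsU].
  by rewrite mem_filter => /andP[].
- by rewrite /= dpq ars.
- rewrite /= prs andbT; apply/allP => y /rsU; rewrite mem_filter /= => /andP[yC yU].
  rewrite Order.TotalTheory.ltNge; apply: contra yC => dqy; apply/asboolP.
  by apply: connected_edge => //; exact: UW.
have rC : rooted q [seq x <- C | x \in T] (count (fun x => x \notin T) C).
  apply: IHC => //; first by rewrite filter_uniq.
    apply/hasP; exists x => //; rewrite mem_filter xU andbT; exact/asboolP.
  move=> y; rewrite mem_filter => /andP[/asboolP cqy yU] _.
  apply: connected_component cqy => // z zW cqz.
  by rewrite mem_filter (closed q) // andbT; apply/asboolP.
have := forest_cons dpq rC frs.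
rewrite -count_cat; have -> : count (fun x => x \notin T) (C ++ U') = count (fun x => x \notin T) U.
  by apply/permP; rewrite perm_filterC.
apply: forest_eq => y; rewrite mem_cat !mem_filter /=.
by case: (y \in T); case: (inC y); rewrite ?andbT ?andbF ?orbF.
Qed.

(* Depth-first search: distinct children of a vertex lie in distinct components
   of the rest, hence at distance larger than 1, and there are at most [Delta]
   of them. *)
Lemma dfs T W p : uniq W -> p \in W -> has (mem T) W ->
  (forall x, x \in W -> x \in T -> conn W p x) ->
  rooted p [seq x <- W | x \in T] (count (fun x => x \notin T) W).
Proof.
have [n] := ubnP (size W); elim: n W p => // n IH W p Wn uW pW hT cW.
pose W0 := [seq y <- W | y != p].
have permW : perm_eq W (p :: W0).
  apply: uniq_perm => //=; first by rewrite mem_filter eqxx filter_uniq.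
  by move=> y; rewrite inE mem_filter; case: eqP => // ->.
have sW0 : size W = (size W0).+1 by rewrite (perm_size permW).
have [] := @dfs_forest T p W0 _ _ W0.
- move=> q C CW0 uC qC hC cC; apply: IH => //; lia.
- move=> x; rewrite mem_filter => /andP[xp xW] xT.
  have [|q [qW qp dpq cq]] := connected_first_edge _ (cW _ xW xT); first by rewrite eq_sym.
  by exists q; rewrite mem_filter qp qW.
- by rewrite filter_uniq.
- by [].
- by [].
move=> rs [rsW ars prs frs].
have szrs : size rs <= Delta by apply: (packing (c := p)); rewrite /ball_packing ars.
rewrite (permP permW) /=; case: (boolP (p \in T)) => pT.
  rewrite add0n; apply: rooted_eq (rooted_terminal szrs frs) => x.
  rewrite inE !mem_filter; case: eqP => [->|_] //=.
  by rewrite pT pW.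
rewrite add1n; apply: rooted_eq (rooted_steiner _ szrs frs).
  move=> x; rewrite !mem_filter; case: eqP => [->|_] //=.
  by rewrite (negbTE pT).
case: frs => t [St [ext [K [S [F [_ Qm _ _]]]]]].
case/hasP: hT => x xW xT; apply: (Qm x); rewrite !mem_filter xW andbT /=.
have xT' : x \in T := xT; rewrite xT' /=.
by apply: contraNneq pT => <-.
Qed.

Lemma restricted_decomposition T S : T != [::] -> feasible d T S ->
  exists F, [/\ {in F, forall c, [/\ {subset c.1 <= T},
      size c.1 <= terminal_bound & feasible d c.1 c.2]},
    forall E, equivalence_rel_on E -> {in F, forall c, constant_on E c.1} ->
      constant_on E T
    & r * cost F <= (r + 4) * size S].
Proof.
case: T => // p T' _; set T := p :: T' => fT.
have pT : p \in T by rewrite mem_head.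
(* Repeated Steiner points and those located at terminals are dropped, which can only lower their
   number. *)
pose W := undup (T ++ S).
have memW : W =i T ++ S by move=> x; rewrite mem_undup.
have [] : rooted p [seq x <- W | x \in T] (count (fun x => x \notin T) W).
  apply: dfs; first exact: undup_uniq.
  - by rewrite memW mem_cat pT.
  - by apply/hasP; exists p; rewrite // memW mem_cat pT.
  - move=> x xW xT; apply: (connected_eq (W := T ++ S)) => [y|]; first by rewrite memW.
    exact: fT.
move=> t [St [ext [K [S' [F [_ _ sum h]]]]]].
set s := count _ _ in sum h.
have sS : s <= size S.
  rewrite /s -size_filter; apply: uniq_leq_size; first by rewrite filter_uniq // undup_uniq.
  move=> x; rewrite mem_filter memW mem_cat => /andP[/negbTE ->].
  by [].
(* The cheapest of the [r] residues has at most the average extra cost, [4 * s / r]. *)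
pose i := [arg min_(i < ord0 : 'I_r) ext i].
have imin j : ext i <= ext j.
  by rewrite /i; case: arg_minnP => // i0 _; exact.
have exti : r * ext i <= \sum_j ext j.
  have -> : r * ext i = \sum_(j < r) ext i by rewrite sum_nat_const card_ord.
  by apply: leq_sum => j _; exact: imin.
have [pi ci [KQ Kn Kb FQ conni] costi] := h i.
have QT x : x \in [seq x <- W | x \in T] = (x \in T).
  by rewrite mem_filter memW mem_cat; case: (x \in T).
exists ((K i, S' i) :: F i); split.
- move=> c; rewrite inE => /orP[/eqP ->|/FQ[h1 h2 h3]] /=; last first.
    by split=> // x /h1; rewrite QT.
  split; first by move=> x /KQ; rewrite QT.
    have h1 := leq_trans Kb (open_bound_le i).
    apply: leq_trans h1 _; rewrite /terminal_bound leqW // leq_pmull //.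
  exact: (feasible_from d_sym (p := p)).
- move=> E eE FE x y xT yT; case: (eE) => Er Es Et.
  have KE := FE _ (mem_head _ _).
  have [z zK] : exists z, z \in K i.
    have := Kn x; rewrite QT => /(_ xT).
    by case: (K i) => // z *; exists z; rewrite mem_head.
  have hz u : u \in T -> E u z.
    move=> uT; apply: conni => //; last by rewrite QT.
    by move=> c cF; apply: FE; rewrite inE cF orbT.
  exact: Et (hz _ xT) (Es _ _ (hz _ yT)).
- rewrite cost_cons /=.
  have h1 : r * (size (S' i) + cost (F i)) <= r * (s + ext i) by rewrite leq_mul2l costi orbT.
  have h2 : (r + 4) * s <= (r + 4) * size S by rewrite leq_mul2l sS orbT.
  apply: leq_trans h1 (leq_trans _ h2); rewrite mulnDr mulnDl leq_add2l.
  by apply: leq_trans exti _; apply: leq_trans sum; rewrite leq_addr.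
Qed.

End Decomposition.

(** * Spanning trees of the terminals *)

Section SpanningBound.
Import Order.TTheory GRing.Theory Num.Theory.
Local Open Scope ring_scope.
Variables (R : realType) (V : lmodType R) (N : V -> R).
Hypothesis N_triangle : forall x y, N (x + y) <= N x + N y.
Hypothesis N_scale : forall a x, N (a *: x) = `|a| * N x.

Definition dist_of_norm (x y : V) : R := N (x - y).
Local Notation d := dist_of_norm.

Lemma norm_fun0 : N 0 = 0.
Proof. by rewrite -(scale0r 0) N_scale normr0 mul0r. Qed.

Lemma norm_funN x : N (- x) = N x.
Proof. by rewrite -scaleN1r N_scale normrN1 mul1r. Qed.

Lemma dist_sym x y : d x y = d y x.
Proof. by rewrite /d -norm_funN opprB. Qed.

Lemma dist_triangle y x z : d x z <= d x y + d y z.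
Proof. by rewrite /d; apply: le_trans (N_triangle _ _); rewrite addrA subrK. Qed.

Lemma dist_refl x : d x x = 0. Proof. by rewrite /d subrr norm_fun0. Qed.

(** [j] equally spaced points leave [j.+1] gaps; hence threshold [j] on costs corresponds to length
    [j.+1]. *)
Lemma segment_feasible u v j : d u v <= j.+1%:R ->
  exists2 S, (size S <= j)%N & feasible d [:: u; v] S.
Proof.
move=> duv; pose w i := u + (i%:R / j.+1%:R) *: (v - u).
have j0 : 0 < j.+1%:R :> R by rewrite ltr0n.
have wS i : d (w i) (w i.+1) <= 1.
  rewrite /d; have -> : w i - w i.+1 = - (j.+1%:R^-1) *: (v - u).
    rewrite /w opprD addrACA subrr add0r -scalerBl; congr (_ *: _).
    by rewrite -[i.+1%:R]natr1 mulrDl mul1r opprD addrA subrr add0r.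
  rewrite N_scale normrN ger0_norm; last by rewrite invr_ge0 ltW.
  by rewrite ler_pdivrMl // mulr1 -/(d v u) dist_sym.
exists [seq w i | i <- iota 1 j]; first by rewrite size_map size_iota.
set S := map _ _.
have w0 : w 0%N = u by rewrite /w mul0r scale0r addr0.
have w1 : w j.+1 = v.
  by rewrite /w divff ?lt0r_neq0 // scale1r addrC subrK.
have wW i : (i <= j.+1)%N -> w i \in [:: u; v] ++ S.
  case: i => [_|i]; first by rewrite w0 mem_head.
  rewrite ltnS leq_eqVlt => /orP[/eqP ->|ij]; first by rewrite w1 !inE eqxx orbT.
  by rewrite mem_cat; apply/orP; right; apply: map_f; rewrite mem_iota; lia.
have cw i : (i <= j.+1)%N -> connected_in d ([:: u; v] ++ S) u (w i).
  elim: i => [_|i IH ij]; first by rewrite w0; exact: connected_refl.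
  apply: connected_trans (IH (ltnW ij)) _.
  by apply: connected_edge; [exact/wW/ltnW|exact: wW|exact: wS].
apply: (feasible_from dist_sym (p := u)) => x; rewrite !inE => /orP[]/eqP ->.
  exact: connected_refl.
by have := cw j.+1 (leqnn _); rewrite w1.
Qed.

(** After scaling by [N a]: shortening [b] to the length of [a] moves it by [N b - N a], so a
    distance larger than [N a] remains. *)
Lemma normalized_apart a b : 0 < N a -> N a <= N b -> N b < N (a - b) ->
  1 < N ((N a)^-1 *: a - (N b)^-1 *: b).
Proof.
move=> a0 ab h; have b0 : 0 < N b by apply: lt_le_trans ab.
rewrite -(ltr_pM2l a0) mulr1.
have -> : N a * N ((N a)^-1 *: a - (N b)^-1 *: b) = N (a - (N a / N b) *: b).
  rewrite -{1}[N a]ger0_norm ?ltW // -N_scale scalerBr !scalerA divff ?scale1r //.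
  exact: lt0r_neq0.
have : N (a - b) <= N (a - (N a / N b) *: b) + N ((N a / N b) *: b - b).
  by apply: le_trans (N_triangle _ _); rewrite addrA subrK.
have -> : N ((N a / N b) *: b - b) = N b - N a.
  have -> : (N a / N b) *: b - b = (N a / N b - 1) *: b by rewrite scalerBl scale1r.
  rewrite N_scale ler0_norm; last first.
    by rewrite subr_le0 ler_pdivrMr // mul1r.
  by rewrite opprB mulrBl mul1r divfK // lt0r_neq0.
by lra.
Qed.

(** Radial projection to the unit sphere around [p]. It serves for the star of a deleted Steiner
    point and, in the plane, to move a packing onto the unit circle. *)
Lemma star_packing p X : {in X, forall x, 0 < d x p} ->
  pairwise (fun x y => (d x p < d x y) && (d y p < d x y)) X ->
  exists s, [/\ ball_packing d p s, {in s, forall x, d p x = 1} & size s = size X].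
Proof.
move=> X0 pX; pose u x := p + (N (x - p))^-1 *: (x - p).
have u1 : {in map u X, forall x, d p x = 1}.
  move=> _ /mapP[x xX ->]; have x0 := X0 _ xX.
  rewrite /d /u opprD addNKr norm_funN N_scale ger0_norm; last by rewrite invr_ge0 ltW.
  by rewrite mulVf // lt0r_neq0.
exists (map u X); split=> //; last by rewrite size_map.
rewrite /ball_packing; apply/andP; split.
  by apply/allP => x /u1 ->; rewrite lexx.
rewrite pairwise_map.
have uB x y : d (u x) (u y) = N ((N (x - p))^-1 *: (x - p) - (N (y - p))^-1 *: (y - p)).
  by rewrite /d /u opprD addrACA subrr add0r.
apply: (sub_in_pairwise (P := mem X)) pX; last exact/allP.
move=> x y xX yX /= /andP[h1 h2]; rewrite uB.
have xy : (x - p) - (y - p) = x - y by rewrite opprB addrA subrK.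
have [le|/ltW le] := leP (N (x - p)) (N (y - p)).
  by apply: normalized_apart; rewrite ?xy //; exact: X0.
rewrite -norm_funN opprB; apply: normalized_apart => //; first exact: X0.
have -> : y - p - (x - p) = - (x - y) by rewrite -xy [RHS]opprB.
by rewrite norm_funN.
Qed.

(** Rescaling reuses the unit-disk graph at every threshold: its edges are the pairs at distance at
    most [j.+1]. *)
Definition scaled (j : nat) (x y : V) : R := d x y / j.+1%:R.

Lemma scaled_sym j x y : scaled j x y = scaled j y x.
Proof. by rewrite /scaled dist_sym. Qed.

Lemma scaled_le1 j x y : (scaled j x y <= 1) = (d x y <= j.+1%:R).
Proof. by rewrite /scaled ler_pdivrMr ?ltr0n // mul1r. Qed.

Local Notation conn j := (connected_in (scaled j)).

Definition component_repr j (W : seq V) x : V :=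
  head x [seq y <- W | `[< conn j W x y >]].

Lemma component_reprP j W x y : x \in W -> y \in W ->
  component_repr j W x = component_repr j W y <-> conn j W x y.
Proof.
have mem z : z \in W -> conn j W z (component_repr j W z).
  move=> zW; rewrite /component_repr.
  have : z \in [seq y <- W | `[< conn j W z y >]].
    by rewrite mem_filter zW andbT; apply/asboolP; exact: connected_refl.
  have : all (fun y => `[< conn j W z y >]) [seq y <- W | `[< conn j W z y >]].
    exact: filter_all.
  by case: [seq y <- W | `[< conn j W z y >]] => // a s /= /andP[/asboolP].
move=> xW yW; split=> [e|cxy].
  apply: connected_trans (mem x xW) _; rewrite e.
  by apply: (connected_sym (@scaled_sym j)); exact: mem.
rewrite /component_repr.
have -> : [seq z <- W | `[< conn j W x z >]] = [seq z <- W | `[< conn j W y z >]].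
  apply: eq_filter => z; apply/asboolP/asboolP => h.
    by apply: connected_trans h; exact: (connected_sym (@scaled_sym j)).
  exact: connected_trans h.
have : y \in [seq y0 <- W | `[< conn j W y y0 >]].
  by rewrite mem_filter yW andbT; apply/asboolP; exact: connected_refl.
by case: [seq z <- W | `[< conn j W y z >]].
Qed.

Definition component_count j (W : seq V) : nat :=
  size (undup (map (component_repr j W) W)).

Lemma distinct_labels (X L : eqType) (f : X -> L) (l : seq X) :
  exists l', [/\ {subset l' <= l}, uniq (map f l') & map f l' =i map f l].
Proof.
elim: l => [|x l [l' [sub u e]]]; first by exists [::].
case: (boolP (f x \in map f l)) => h.
  exists l'; split=> // [y /sub yl|y]; first by rewrite inE yl orbT.
  by rewrite e /= inE; case: eqP => // ->.
exists (x :: l'); split=> [y|/=|y] /=.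
- by rewrite !inE => /orP[->//|/sub ->]; rewrite orbT.
- by rewrite u andbT e.
- by rewrite !inE e.
Qed.

(** * Deleting one Steiner point next to a remaining point *)

Section RemovePoint.
Variables (p p' : V) (W : seq V).
Hypotheses (p'W : p' \in W) (dpp' : d p p' <= 1).

Let touches j x := exists u, [/\ u \in W, d u p <= j.+1%:R & conn j W x u].

Lemma connected_through j x y : x \in W -> y \in W -> conn j (p :: W) x y ->
  conn j W x y \/ touches j x /\ touches j y.
Proof.
move=> xW yW [s [ps ls]].
have [[e]|//] : (y = p /\ touches j x) \/
    (y \in W /\ (conn j W x y \/ touches j x /\ touches j y)); last by case.
  elim/last_ind: s y {yW} ls ps => [|s z IH] y.
    by move=> /= <- _; right; split=> //; left; exact: connected_refl.
  rewrite last_rcons => <-; rewrite rcons_path => /andP[/(IH _ erefl) {}IH].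
  set w := last x s in IH *; case/and3P => wW zW; rewrite scaled_le1 => dwz.
  move: zW; rewrite inE; case: (eqVneq z p) => [zp _|zp /= zW].
    left; split=> //; case: IH => [[]//|[wW' [cw|[]//]]].
    by exists w; split=> //; rewrite -zp.
  right; split=> //; case: IH => [[wp tx]|[wW' h]].
    right; split=> //; exists z; split=> //; last exact: connected_refl.
    by rewrite dist_sym -wp.
  have cwz : conn j W w z by apply: connected_edge => //; rewrite scaled_le1.
  case: h => [cw|[tx [u [uW du cu]]]]; first by left; apply: connected_trans cwz.
  right; split=> //; exists u; split=> //; apply: connected_trans cu.
  exact: (connected_sym (@scaled_sym j)).
by move=> tx; rewrite e in yW *; right; split=> //; exists p; split=> //;
   [rewrite dist_refl|exact: connected_refl].
Qed.

(** [X] takes one point near [p] from each nearby component other than that of [p']. The components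
    not represented in [X] stay distinct when [p] is added, since the only one of them that can
    reach [p] is that of [p']. *)
Lemma component_count_remove j : exists X, [/\ uniq X /\ {subset X <= W},
   {in X, forall x, d x p <= j.+1%:R /\ ~ conn j W p' x},
   {in X &, forall x y, x != y -> ~ conn j W x y}
 & (component_count j W <= component_count j (p :: W) + size X)%N].
Proof.
pose f := component_repr j W; pose g := component_repr j (p :: W).
pose nb := [seq x <- W | (d x p <= j.+1%:R) && ~~ `[< conn j W p' x >]].
have [X [Xnb uX eX]] := distinct_labels f nb.
have Xn x : x \in X -> [/\ x \in W, d x p <= j.+1%:R & ~ conn j W p' x].
  by move/Xnb; rewrite mem_filter => /andP[/andP[h1 /asboolPn h2] h3].
exists X; split.
- by split; [exact: map_uniq uX|move=> x /Xn[]].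
- by move=> x /Xn[].
- move=> x y xX yX xy c; move/negP: xy; apply; apply/eqP.
  have [xW _ _] := Xn _ xX; have [yW _ _] := Xn _ yX.
  have fxy : f x = f y by apply/component_reprP.
  have [i iX ei] := nthP x xX; have [k kX ek] := nthP x yX.
  have := nth_uniq (f x) _ _ uX; rewrite size_map => /(_ i k iX kX).
  by rewrite !(nth_map x) // ei ek fxy eqxx => /esym/eqP ik; rewrite -ei -ek ik.
pose W' := [seq x <- W | f x \notin map f X].
have step1 : (component_count j W <= size (undup (map f W')) + size X)%N.
  rewrite /component_count -(size_map f X) -size_cat; apply: uniq_leq_size.
    exact: undup_uniq.
  move=> l; rewrite mem_undup => /mapP[x xW ->]; rewrite mem_cat mem_undup.
  case: (boolP (f x \in map f X)) => h; first by rewrite orbT.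
  by rewrite map_f // mem_filter h.
apply: leq_trans step1 _; rewrite leq_add2r.
have sep x : x \in W' -> touches j x -> conn j W x p'.
  rewrite mem_filter => /andP[fx xW] [u [uW du cxu]].
  case: (pselect (conn j W p' u)) => [h|h].
    by apply: connected_trans cxu _; exact: (connected_sym (@scaled_sym j)).
  case/negP: fx; rewrite eX; have -> : f x = f u by apply/component_reprP.
  by apply: map_f; rewrite mem_filter uW du andbT; apply/asboolPn.
apply: leq_trans (_ : size (undup (map g W')) <= _)%N.
  apply: undup_map_leq => x y xW' yW' e.
  have xW : x \in W by move: xW'; rewrite mem_filter => /andP[].
  have yW : y \in W by move: yW'; rewrite mem_filter => /andP[].
  apply/component_reprP => //.
  have cxy : conn j (p :: W) x y by apply/component_reprP => //; rewrite inE ?xW ?yW orbT.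
  have [//|[tx ty]] := connected_through xW yW cxy.
  apply: connected_trans (sep _ xW' tx) _.
  by apply: (connected_sym (@scaled_sym j)); exact: sep.
apply: uniq_leq_size; first exact: undup_uniq.
move=> l; rewrite !mem_undup => /mapP[x + ->]; rewrite mem_filter => /andP[_ xW].
by apply: map_f; rewrite inE xW orbT.
Qed.

(** The thresholds contribute to one common star. A point found earlier is within [J] of [p], hence
    within [J.+1] of [p'], and so lies in the component of [p'] at threshold [J]; new
    representatives avoid that component and are farther than [J.+1] from all its points. *)
Lemma component_count_remove_sum J : exists X,
  [/\ {in X, forall x, [/\ x \in W, 0 < d x p, d x p <= J%:R & d x p < d x p' /\ d p' p < d x p']},
    pairwise (fun x y => (d x p < d x y) && (d y p < d x y)) X
  & (\sum_(j <- iota 0 J) component_count j W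
     <= \sum_(j <- iota 0 J) component_count j (p :: W) + size X)%N].
Proof.
elim: J => [|J [X [X1 X2 X3]]]; first by exists [::]; rewrite !big_nil.
have [Y [[uY YW] Yd Yc Yn]] := component_count_remove J.
have far x y : x \in W -> d x p <= J%:R -> y \in Y -> J.+1%:R < d x y.
  move=> xW dx yY; rewrite ltNge; apply/negP => dxy.
  have [_ []] := Yd _ yY; apply: connected_trans (_ : conn J W p' x) _.
    apply: connected_edge => //; rewrite scaled_le1 dist_sym.
    apply: le_trans (dist_triangle p _ _) _; rewrite -natr1; exact: lerD.
  by apply: connected_edge => //; [exact: YW|rewrite scaled_le1].
have p'y y : y \in Y -> J.+1%:R < d y p'.
  move=> yY; rewrite ltNge; apply/negP => dxy.
  have [_ []] := Yd _ yY; apply: connected_edge => //; first exact: YW.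
  by rewrite scaled_le1 dist_sym.
have J1 : (1 : R) <= J.+1%:R by rewrite ler1n.
have dp1 : d p' p <= 1 by rewrite dist_sym.
exists (X ++ Y); split.
- move=> x; rewrite mem_cat => /orP[/X1[h1 h2 h3 h4]|xY].
    by split=> //; apply: le_trans h3 _; rewrite ler_nat.
  have [dx nx] := Yd _ xY; split=> //; first exact: YW.
    have h1 := p'y _ xY; have h2 := dist_triangle p x p'; have h3 := dpp'; lra.
  have := p'y _ xY; split; lra.
- rewrite pairwise_cat X2 /=; apply/andP; split.
    apply/allrelP => x y xX yY; have [xW _ dx _] := X1 _ xX.
    have := far _ _ xW dx yY; have [dy _] := Yd _ yY.
    have : (J%:R : R) <= J.+1%:R by rewrite ler_nat.
    by move=> *; apply/andP; split; lra.
  have : pairwise (fun x y => x != y) Y by rewrite -uniq_pairwise.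
  apply: (sub_in_pairwise (P := mem Y)); last exact/allP.
  move=> x y xY yY /= xy; have := Yc _ _ xY yY xy.
  have [dx _] := Yd _ xY; have [dy _] := Yd _ yY => nc.
  have dxy : J.+1%:R < d x y.
    rewrite ltNge; apply/negP => h; apply: nc.
    by apply: connected_edge; rewrite ?YW // scaled_le1.
  by apply/andP; split; lra.
- rewrite -addn1 iotaD !big_cat /= add0n !big_seq1 size_cat.
  by rewrite [leqRHS]addnACA leq_add.
Qed.

Lemma component_count_remove_le Delta J :
  (forall c s, ball_packing d c s -> size s <= Delta)%N ->
  (\sum_(j <- iota 0 J) component_count j W
     <= \sum_(j <- iota 0 J) component_count j (p :: W) + Delta.-1)%N.
Proof.
move=> pack; have [X [X1 X2 X3]] := component_count_remove_sum J.
apply: leq_trans X3 _; rewrite leq_add2l.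
(* A representative [x0] forces [d p' p] to be positive, so that [p'] can be projected along with
   [X]. *)
case: X X1 X2 => [//|x0 X0] X1 X2; set X := x0 :: X0 in X1 X2 *.
have [||s [ps _ ss]] := @star_packing p (p' :: X).
- move=> x; rewrite inE => /orP[/eqP ->|/X1[]//].
  have [_ _ _ [h1 h2]] := X1 x0 (mem_head _ _).
  by have := dist_triangle p x0 p'; rewrite [d p p']dist_sym; lra.
- rewrite pairwise_cons X2 andbT; apply/allP => x /X1[_ _ _ [h1 h2]].
  by rewrite [d p' x]dist_sym h1 h2.
by have := pack _ _ ps; rewrite ss /=; lia.
Qed.

End RemovePoint.

(** The list is in order of deletion: when its head is removed, a neighbour of it is left. *)
Fixpoint attached (T s : seq V) : Prop :=
  if s is p :: s' then
    [/\ p \notin s' ++ T, exists2 p', p' \in s' ++ T & d p p' <= 1 & attached T s']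
  else True.

Lemma attached_extend (T S s : seq V) : attached T s -> {subset s <= S} ->
  exists s' : seq V, [/\ attached T s', {subset s' <= S}
    & forall x y, x \in s' ++ T -> y \in S -> d x y <= 1 -> y \in s' ++ T].
Proof.
have [n] := ubnP (size [seq y <- S | y \notin s ++ T]).
elim: n s => // n IH s sn att sS.
case: (pselect (exists x y, [/\ x \in s ++ T, y \in S, d x y <= 1 & y \notin s ++ T])); last first.
  move=> h; exists s; split=> // x y xs yS dxy; apply/negPn/negP => yn.
  by apply: h; exists x, y.
move=> [x [y [xs yS dxy yn]]]; apply: (IH (y :: s)).
- rewrite ltnS in sn; apply: leq_trans sn.
  have yS' : y \in [seq y0 <- S | y0 \notin s ++ T] by rewrite mem_filter yn.
  have -> : [seq y0 <- S | y0 \notin (y :: s) ++ T]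
      = [seq y0 <- [seq y0 <- S | y0 \notin s ++ T] | y0 != y].
    by rewrite -filter_predI; apply: eq_filter => z; rewrite /= inE negb_or.
  rewrite size_filter -(count_predC (fun z => z != y) [seq y0 <- S | y0 \notin s ++ T]).
  rewrite -[ltnLHS]addn0 ltn_add2l -has_count; apply/hasP; exists y => //=.
  by rewrite negbK.
- by split=> //; exists x; rewrite // dist_sym.
- by move=> z; rewrite inE => /orP[/eqP ->|/sS].
Qed.

Lemma attached_uniq T s : attached T s -> uniq s.
Proof.
by elim: s => //= p s IH [ps _ /IH ->]; rewrite andbT; move: ps; rewrite mem_cat negb_or => /andP[].
Qed.

Lemma attached_connected T s t : attached T s ->
  (forall x, x \in T -> connected_in d (s ++ T) t x) ->
  forall x, x \in s ++ T -> connected_in d (s ++ T) t x.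
Proof.
move=> att cT.
have H s1 s2 : s = s1 ++ s2 -> forall x, x \in s2 ++ T -> connected_in d (s ++ T) t x.
  elim: s2 s1 att cT => [|p s2 IH] s1 att cT es x; first exact: cT.
  have {}IH := IH (rcons s1 p) att cT; rewrite cat_rcons in IH.
  have {}IH := IH es.
  rewrite inE => /orP[/eqP ->|]; last exact: IH.
  have [q qs dpq] : exists2 p', p' \in s2 ++ T & d p p' <= 1.
    by rewrite es in att; elim: s1 att {IH es} => [[]//|a s1 IHs /= [_ _ /IHs]].
  apply: connected_trans (IH _ qs) _; apply: connected_edge.
  - by rewrite es -catA mem_cat inE qs !orbT.
  - by rewrite es !mem_cat mem_head orbT.
  - by rewrite dist_sym.
exact: (H [::]).
Qed.

(* Removing the Steiner points one at a time, each while a neighbour of it is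
   still present, raises the weight of the minimum spanning tree by at most
   [Delta - 1] per point. *)
Lemma component_count_terminals Delta T S J :
  (forall c s, ball_packing d c s -> size s <= Delta)%N ->
  T != [::] -> feasible d T S ->
  (\sum_(j <- iota 0 J) component_count j T <= J + Delta.-1 * size S)%N.
Proof.
move=> pack T0 fT.
have [s [att sS closed]] := @attached_extend T S [::] I (fun x (h : x \in [::]) => match notF h with end).
have drop s' : attached T s' -> (\sum_(j <- iota 0 J) component_count j T
    <= \sum_(j <- iota 0 J) component_count j (s' ++ T) + Delta.-1 * size s')%N.
  elim: s' => [|p s' IH] /=; first by rewrite muln0 addn0.
  move=> [_ [p' p's dpp'] /IH {}IH]; apply: leq_trans IH _.
  rewrite mulnS addnA leq_add2r; exact: component_count_remove_le dpp' _ _ pack.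
apply: leq_trans (drop s att) _; apply: leq_add; last first.
  rewrite leq_mul2l; apply/orP; right; apply: uniq_leq_size => //.
  exact: attached_uniq att.
have [t tT] : exists t, t \in T by case: (T) T0 => // t *; exists t; rewrite mem_head.
have cT x : x \in T -> connected_in d (s ++ T) t x.
  move=> xT; apply: (@connected_component _ _ d (T ++ S)); last exact: fT.
    by rewrite mem_cat tT orbT.
  move=> y _ [q [+ lq]]; elim/last_ind: q y lq => [|q z IH] y.
    by move=> /= <- _; rewrite mem_cat tT orbT.
  rewrite last_rcons => <-; rewrite rcons_path => /andP[/(IH _ erefl) h].
  case/and3P => _ zTS dz; move: zTS; rewrite mem_cat => /orP[zT|zS].
    by rewrite mem_cat zT orbT.
  exact: closed h zS dz.
have all1 j : (component_count j (s ++ T) <= 1)%N.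
  have sub : {subset undup (map (component_repr j (s ++ T)) (s ++ T))
      <= [:: component_repr j (s ++ T) t]}.
    move=> l; rewrite mem_undup => /mapP[x xs ->]; rewrite inE; apply/eqP.
    have c := attached_connected att cT xs.
    apply/component_reprP => //; first by rewrite mem_cat tT orbT.
    apply: (connected_sym (@scaled_sym j)).
    case: c => q [pq lq]; exists q; split=> //; apply: sub_path pq => u v.
    case/and3P => uW vW duv; rewrite /unit_disk_graph uW vW scaled_le1 /=.
    by apply: le_trans duv _; rewrite ler1n.
  exact: uniq_leq_size (undup_uniq _) sub.
apply: leq_trans (_ : \sum_(j <- iota 0 J) 1 <= _)%N; first exact: leq_sum.
by rewrite sum1_size size_iota.
Qed.

End SpanningBound.

(** * The logarithmic cost function *)

Section LogCost.
Import Order.TTheory GRing.Theory Num.Theory.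
Local Open Scope ring_scope.
Variable R : realType.
Implicit Types M x y c : R.

(* The integral of [min 1 (M / t)] over [[0, x]]. *)
Definition log_cost M x : R := if x <= M then x else M * (1 + ln (x / M)).

(** The integrand is nonincreasing, so the integral over [[y, x]] is at least [x - y] times its
    value at [x], which is at least [c]. The logarithms enter only through
    [1 - b / a <= ln (a / b)]. *)
Lemma log_cost_step M x y c : 0 < M -> 0 <= y -> y <= x ->
  c <= x - y -> x * c <= (x - y) * M -> c <= log_cost M x - log_cost M y.
Proof.
move=> M0 y0 yx c1 c2; rewrite /log_cost.
case: (leP x M) => xM; first by rewrite (le_trans yx xM).
have x0 : 0 < x by lra.
have lnge (a b : R) : 0 < a -> 0 < b -> 1 - b / a <= ln (a / b).
  move=> a0 b0; have -> : a / b = (b / a)^-1 by rewrite invf_div.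
  have ba0 : 0 < b / a by rewrite divr_gt0.
  rewrite lnV ?posrE //; have := @le_ln1Dx R (b / a - 1); rewrite subrKC.
  by move=> /(_ _); lra.
have c3 : c <= M - y * (M / x).
  have -> : M - y * (M / x) = ((x - y) * M) / x by field; rewrite gt_eqF.
  by rewrite ler_pdivlMr // mulrC.
case: (leP y M) => yM.
  have h := lnge x M x0 M0.
  have h2 : M * (1 - M / x) <= M * ln (x / M) by rewrite ler_pM2l.
  have h3 : 0 <= (M - y) * (1 - M / x).
    by rewrite mulr_ge0 ?subr_ge0 // ler_pdivrMr // mul1r ltW.
  by rewrite mulrDr mulr1; nra.
have y1 : 0 < y by lra.
have h := lnge x y x0 y1.
have -> : ln (x / M) = ln (x / y) + ln (y / M).
  by rewrite -lnM ?posrE ?divr_gt0 // mulrA divfK // gt_eqF.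
have h2 : M * (1 - y / x) <= M * ln (x / y) by rewrite ler_pM2l.
have e : M * (1 - y / x) = M - y * (M / x) by ring.
by rewrite e in h2; nra.
Qed.

Lemma log_cost0 M : 0 < M -> log_cost M 0 = 0.
Proof. by move=> M0; rewrite /log_cost ltW. Qed.

Lemma log_cost_le M x D : 0 < M -> 1 <= D -> x <= D * M ->
  log_cost M x <= M * (1 + ln D).
Proof.
move=> M0 D1 xD; rewrite /log_cost; have lD := ln_ge0 D1.
case: (leP x M) => xM.
  apply: le_trans xM _; rewrite mulrDr mulr1 lerDl mulr_ge0 //; exact: ltW.
rewrite ler_pM2l // lerD2l ler_ln ?posrE; last 2 first.
- by rewrite divr_gt0 // (lt_trans M0).
- by rewrite (lt_le_trans _ D1).
by rewrite ler_pdivrMr.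
Qed.

Lemma expR_ge_series x n : 0 <= x -> series (exp_coeff x) n <= expR x.
Proof.
move=> x0; apply: nondecreasing_cvgn_le; last exact: is_cvg_series_exp_coeff.
by apply: nondecreasing_series => k _ _; exact: exp_coeff_ge0.
Qed.

Lemma series_exp9 x : series (exp_coeff x) 9 =
  1 + x * (1 + x / 2 * (1 + x / 3 * (1 + x / 4 * (1 + x / 5 * (1 + x / 6 *
    (1 + x / 7 * (1 + x / 8))))))).
Proof.
have tS n : exp_coeff x n.+1 = exp_coeff x n * (x / n.+1%:R).
  rewrite /exp_coeff /= exprSr factS mulnC natrM invfM.
  by rewrite mulrACA.
have t0 : exp_coeff x 0 = 1 by rewrite /exp_coeff /= expr0 fact0 divr1.
rewrite /series /= !big_nat_recr //= big_geq // !tS t0.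
by field.
Qed.

(** This fraction exceeds [ln 2] by less than 2 millionths, and its double is still below 1.3863.
    The Taylor polynomial of degree 8 of the exponential already exceeds 2 there. *)
Lemma ln2_lt : ln 2 < 951 / 1372 :> R.
Proof.
rewrite -ltr_expR lnK ?posrE //.
have x0 : 0 <= 951 / 1372 :> R by lra.
have := expR_ge_series 9 x0; rewrite series_exp9.
by apply: lt_le_trans; lra.
Qed.

Lemma ln4_lt : ln 4 < 1 + 3863 / 10 ^+ 4 :> R.
Proof.
have -> : (4 : R) = 2 ^+ 2 by rewrite expr2; lra.
rewrite lnXn // mulr2n; have := ln2_lt.
have -> : (10 ^+ 4 : R) = 100 * 100 by rewrite !exprS expr0; lra.
by lra.
Qed.

End LogCost.

(** * The Euclidean plane *)

Section EuclideanPlane.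
Import Order.TTheory GRing.Theory Num.Theory.
Local Open Scope ring_scope.
Variable R : realType.

Definition eucl_norm (u : 'rV[R]_2) : R := Num.sqrt (u 0 0 ^+ 2 + u 0 1 ^+ 2).

Lemma eucl_distE : @eucl_dist R = dist_of_norm eucl_norm.
Proof.
apply/funext => u; apply/funext => v; rewrite /eucl_dist /dist_of_norm /eucl_norm.
rewrite big_ord_recl big_ord1 !mxE.
by have -> : lift ord0 ord0 = 1 :> 'I_2 by apply/val_inj.
Qed.

Lemma eucl_norm_sqr u : eucl_norm u ^+ 2 = u 0 0 ^+ 2 + u 0 1 ^+ 2.
Proof. by rewrite sqr_sqrtr // addr_ge0 // sqr_ge0. Qed.

Lemma eucl_norm_ge0 u : 0 <= eucl_norm u. Proof. exact: sqrtr_ge0. Qed.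

Lemma eucl_norm_triangle u v : eucl_norm (u + v) <= eucl_norm u + eucl_norm v.
Proof.
have s0 := eucl_norm_ge0 u; have t0 := eucl_norm_ge0 v.
rewrite -(ler_pXn2r (n := 2)) ?nnegrE ?addr_ge0 ?eucl_norm_ge0 //.
rewrite eucl_norm_sqr !mxE.
move: (eucl_norm_sqr u) (eucl_norm_sqr v) s0 t0.
move: (eucl_norm u) (eucl_norm v) (u 0 0) (u 0 1) (v 0 0) (v 0 1).
move=> s t a b c e hs ht s0 t0.
suff h : a * c + b * e <= s * t by nra.
rewrite leNgt; apply/negP => h.
have h0 : 0 <= s * t by rewrite mulr_ge0.
have h1 : (s * t) ^+ 2 < (a * c + b * e) ^+ 2 by rewrite ltr_pXn2r ?nnegrE // ltW // (le_lt_trans h0).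
have h2 : (s * t) ^+ 2 = (a * c + b * e) ^+ 2 + (a * e - b * c) ^+ 2.
  by rewrite exprMn hs ht; ring.
by have := sqr_ge0 (a * e - b * c); lra.
Qed.

Lemma eucl_norm_scale (a : R) u : eucl_norm (a *: u) = `|a| * eucl_norm u.
Proof.
rewrite /eucl_norm !mxE !exprMn -mulrDr sqrtrM ?sqr_ge0 //.
by rewrite sqrtr_sqr.
Qed.

Lemma eucl_norm_le1 u : (eucl_norm u <= 1) = (u 0 0 ^+ 2 + u 0 1 ^+ 2 <= 1).
Proof. by rewrite -eucl_norm_sqr expr_le1 ?eucl_norm_ge0. Qed.

(* Two unit vectors in a common sector of 60 degrees have inner product at
   least 1/2. *)
Lemma sector_inner (c e c' e' : R) : c ^+ 2 + e ^+ 2 = 1 -> c' ^+ 2 + e' ^+ 2 = 1 ->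
  c < 1 / 2 -> c' < 1 / 2 -> (0 <= e) = (0 <= e') ->
  (- (1 / 2) <= c) = (- (1 / 2) <= c') -> 1 / 2 <= c * c' + e * e'.
Proof.
move=> h h' c1 c1' se sc.
have ee : 0 <= e * e'.
  case: (leP 0 e) se => [e0|e0] /esym; first by move=> ?; rewrite mulr_ge0.
  by move/negbT; rewrite -ltNge => ?; rewrite ltW // nmulr_lgt0.
have sq : (e * e') ^+ 2 = (1 - c ^+ 2) * (1 - c' ^+ 2).
  have -> : 1 - c ^+ 2 = e ^+ 2 by lra.
  have -> : 1 - c' ^+ 2 = e' ^+ 2 by lra.
  by rewrite exprMn.
case: (leP (- (1 / 2)) c) sc => [c2|c2] /esym.
  move=> c2'.
  have k : c ^+ 2 <= 1 / 4 by nra.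
  have k' : c' ^+ 2 <= 1 / 4 by nra.
  have : 3 / 4 <= e * e'.
    rewrite leNgt; apply/negP => lt.
    have : (e * e') ^+ 2 < (3 / 4) ^+ 2 by rewrite ltr_pXn2r ?nnegrE //; lra.
    by rewrite sq; nra.
  by nra.
move/negbT; rewrite -ltNge => c2'.
case: (leP (1 / 2) (c * c')) => [|cc]; first by lra.
have k : - 1 <= c by nra.
have k' : - 1 <= c' by nra.
have q : (c - c') ^+ 2 <= 1 / 4 by nra.
suff : 1 / 2 - c * c' <= e * e' by lra.
rewrite leNgt; apply/negP => lt.
have : (e * e') ^+ 2 < (1 / 2 - c * c') ^+ 2 by rewrite ltr_pXn2r ?nnegrE //; lra.
by rewrite sq; nra.
Qed.

(** In coordinates relative to the first vector [v], the others avoid the 120 degrees around [v].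
    The rest splits into four sectors of 60 degrees, told apart by two comparisons, with at most one
    vector in each. *)
Lemma unit_vectors_apart (l : seq (R * R)) :
  {in l, forall v, v.1 ^+ 2 + v.2 ^+ 2 = 1} ->
  pairwise (fun v w => v.1 * w.1 + v.2 * w.2 < 1 / 2) l -> (size l <= 5)%N.
Proof.
case: l => // v l unit; rewrite pairwise_cons => /andP[/allP vl pl].
have v1 := unit v (mem_head _ _).
have u w : w \in l -> w.1 ^+ 2 + w.2 ^+ 2 = 1.
  by move=> wl; apply: unit; rewrite inE wl orbT.
pose c w := v.1 * w.1 + v.2 * w.2; pose e w := v.1 * w.2 - v.2 * w.1.
have ce w w' : c w * c w' + e w * e w' = w.1 * w'.1 + w.2 * w'.2.
  rewrite -[RHS]mul1r -v1 /c /e; ring.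
pose sector w := (0 <= e w, - (1 / 2) <= c w).
have us : uniq (map sector l).
  rewrite uniq_pairwise pairwise_map.
  apply: (sub_in_pairwise (P := mem l)) pl; last exact/allP.
  move=> w w' wl w'l /= lt; apply/negP => /eqP[s1 s2].
  have := @sector_inner (c w) (e w) (c w') (e w').
  rewrite !expr2 !ce -!expr2 (u _ wl) (u _ w'l) => /(_ erefl erefl).
  by move/(_ (vl _ wl) (vl _ w'l) s1 s2); rewrite leNgt lt.
rewrite /= ltnS -(size_map sector) -(card_uniqP us).
by apply: leq_trans (max_card _) _; rewrite card_prod card_bool.
Qed.

Lemma eucl_packing_le5 c s : ball_packing (dist_of_norm eucl_norm) c s ->
  (size s <= 5)%N.
Proof.
move=> /andP[/allP s1 s2]; case: (leqP (size s) 1) => [|sz]; first by move/leq_trans; apply.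
have dsym := dist_sym eucl_norm_scale.
(* A second point at distance larger than 1 shows that no point is the centre, as radial projection
   requires. *)
have s2' : {in s, forall x, exists2 y, y \in s & 1 < dist_of_norm eucl_norm x y}.
  move=> x; case/(nthP x) => i il <-.
  pose j := if i == 0%N then 1%N else 0%N.
  have jl : (j < size s)%N by rewrite /j; case: ifP => // _; apply: ltn_trans sz.
  exists (nth x s j); first exact: mem_nth.
  move/(pairwiseP x): s2 => s2; rewrite /j in jl *.
  case: eqP jl => [i0|/eqP i0] jl; first by rewrite i0; apply: s2; rewrite ?inE //; lia.
  by rewrite dsym; apply: s2; rewrite ?inE // lt0n.
have [||t [pt t1 <-]] := @star_packing R _ eucl_norm eucl_norm_triangle eucl_norm_scale c s.
- move=> x xs; have [y ys xy] := s2' _ xs.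
  have := dist_triangle eucl_norm_triangle c x y.
  by have := s1 _ ys; lra.
- apply: (sub_in_pairwise (P := mem s)) s2; last exact/allP.
  move=> x y xs ys /= xy; have := s1 _ xs; have := s1 _ ys; rewrite !(dsym c) => h1 h2.
  by apply/andP; split; lra.
rewrite -(size_map (fun x : 'rV[R]_2 => (x 0 0 - c 0 0, x 0 1 - c 0 1))).
have t1' x : x \in t -> (x 0 0 - c 0 0) ^+ 2 + (x 0 1 - c 0 1) ^+ 2 = 1.
  move=> /t1; rewrite dsym => e; have := eucl_norm_sqr (x - c).
  by rewrite -[eucl_norm _]/(dist_of_norm eucl_norm x c) e !mxE expr1n => <-.
apply: unit_vectors_apart.
  by move=> _ /mapP[x xt ->] /=; exact: t1'.
rewrite pairwise_map; case/andP: pt => _.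
apply: (sub_in_pairwise (P := mem t)); last exact/allP.
move=> x y xt yt /=; rewrite ltNge eucl_norm_le1 -ltNge !mxE.
by have := t1' _ xt; have := t1' _ yt; nra.
Qed.

Definition plane_point (x y : R) : 'rV[R]_2 := \row_i (if i == 0 then x else y).

Lemma eucl_packing_number : is_packing_number (@eucl_dist R) 5.
Proof.
rewrite eucl_distE; split; last exact: eucl_packing_le5.
have D x y z w : (dist_of_norm eucl_norm (plane_point x y) (plane_point z w) <= 1)
    = ((x - z) ^+ 2 + (y - w) ^+ 2 <= 1).
  by rewrite /dist_of_norm eucl_norm_le1 !mxE /=.
(* A regular pentagon with its vertices rounded to rational points of the disk. *)
exists (plane_point 0 0), [:: plane_point 0 1; plane_point (19 / 20) (3 / 10);
  plane_point (29 / 50) (- (4 / 5)); plane_point (- (29 / 50)) (- (4 / 5));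
  plane_point (- (19 / 20)) (3 / 10)]; split=> //.
rewrite /ball_packing /= !ltNge !D !andbT -!ltNge.
by do !(apply/andP; split); lra.
Qed.

End EuclideanPlane.

(** * Polynomial-time programs *)

(** The base is at least 2, so a larger exponent absorbs constants and sums; closure under
    composition is then immediate. *)
Definition poly_bounded (f : nat -> nat) : Prop :=
  exists b, forall n, f n <= (n + 2) ^ b.

Lemma leq_exp_base m n e : m <= n -> m ^ e <= n ^ e.
Proof. by case: e => [|e] mn; rewrite ?expn0 // leq_exp2r. Qed.

Lemma poly_bounded_leq (f g : nat -> nat) : (forall n, f n <= g n) ->
  poly_bounded g -> poly_bounded f.
Proof. by move=> fg [b gb]; exists b => n; apply: leq_trans (fg n) (gb n). Qed.

Lemma poly_bounded_cst c : poly_bounded (fun=> c).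
Proof.
exists c => n; apply: leq_trans (_ : 2 ^ c <= _); first exact/ltnW/ltn_expl.
by apply: leq_exp_base; rewrite leq_addl.
Qed.

Lemma poly_bounded_id : poly_bounded id.
Proof. by exists 1 => n; rewrite expn1 leq_addr. Qed.

Lemma poly_boundedM (f g : nat -> nat) : poly_bounded f -> poly_bounded g ->
  poly_bounded (fun n => f n * g n).
Proof. by move=> [b fb] [c gc]; exists (b + c) => n; rewrite expnD leq_mul. Qed.

Lemma poly_boundedD (f g : nat -> nat) : poly_bounded f -> poly_bounded g ->
  poly_bounded (fun n => f n + g n).
Proof.
move=> [b fb] [c gc]; exists (b + c).+1 => n.
have h k l : (n + 2) ^ k <= (n + 2) ^ (k + l) by rewrite leq_exp2l ?addn2 // leq_addr.
rewrite expnS; apply: leq_trans (_ : 2 * (n + 2) ^ (b + c) <= _).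
  rewrite mul2n -addnn; apply: leq_add.
    exact: leq_trans (fb n) (h _ _).
  by apply: leq_trans (gc n) _; rewrite [b + c]addnC h.
by rewrite leq_mul2r leq_addl orbT.
Qed.

Lemma poly_bounded_comp (f g : nat -> nat) : poly_bounded f -> poly_bounded g ->
  poly_bounded (fun n => f (g n)).
Proof.
move=> [b fb] pg.
have [c gc] := poly_boundedD pg (poly_bounded_cst 2).
exists (c * b) => n; apply: leq_trans (fb _) _.
by rewrite expnM leq_exp_base.
Qed.

Lemma poly_bounded_horner (p : {poly nat}) : poly_bounded (fun n => p.[n]%R).
Proof.
elim/poly_ind: p => [|p c IH].
  by apply: poly_bounded_leq (poly_bounded_cst 0) => n; rewrite horner0.
apply: poly_bounded_leq
  (poly_boundedD (poly_boundedM IH poly_bounded_id) (poly_bounded_cst c)) => n.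
by rewrite hornerMXaddC.
Qed.

Lemma poly_bounded_poly (f : nat -> nat) : poly_bounded f ->
  exists p : {poly nat}, forall n, f n <= p.[n]%R.
Proof.
case=> b fb; exists (('X + 2%:R%:P) ^+ b)%R => n; apply: leq_trans (fb n) _.
rewrite horner_exp hornerD hornerX hornerC.
elim: b {fb} => // b IH; rewrite expnS GRing.exprS; exact: leq_mul.
Qed.

Ltac poly_bound := repeat
  first [ assumption | exact: poly_bounded_id | apply: poly_bounded_cst
        | apply: poly_boundedD | apply: poly_boundedM | apply: poly_bounded_comp ].

(** * Determinism, growth of values, and relocation of programs *)

Section Machine.
Variables (R : realType) (P : Type) (A : structure R P).

Local Notation value := (tree (atom R P)).
Implicit Types (s : store R P) (c : program A).

Fixpoint tree_size (t : value) : nat :=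
  if t is Node a b then (tree_size a + tree_size b).+1 else 1.

(** [SetNode] may use a value twice, so sizes can double at each instruction, whereas depth grows by
    at most one. For encoded lists of points depth bounds length, so running time bounds the length
    of the output. *)
Fixpoint tree_depth (t : value) : nat :=
  if t is Node a b then (maxn (tree_depth a) (tree_depth b)).+1 else 1.

Lemma tree_size_gt0 t : 0 < tree_size t.
Proof. by case: t. Qed.

Lemma exec_deterministic c s s1 t1 s2 t2 :
  exec c s s1 t1 -> exec c s s2 t2 -> s1 = s2 /\ t1 = t2.
Proof.
move=> e1; elim: e1 s2 t2 => {c s s1 t1}.
- by move=> i s s2 t2 e; inversion e; subst.
- move=> c1 c2 s s1 s1' t1 t1' _ IH1 _ IH2 s2 t2 e.
  inversion e as [|? ? ? s3 ? t3 ? e3 e4| | | |]; subst.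
  have [? ?] := IH1 _ _ e3; subst.
  by have [? ?] := IH2 _ _ e4; subst.
- move=> x c1 c2 s s' t sx _ IH s2 t2 e.
  inversion e as [| |? ? ? ? ? ? ? e3|? ? ? ? ? ? sx'| |]; subst.
    by have [? ?] := IH _ _ e3; subst.
  by rewrite sx' in sx.
- move=> x c1 c2 s s' t sx _ IH s2 t2 e.
  inversion e as [| |? ? ? ? ? ? sx'|? ? ? ? ? ? ? e3| |]; subst.
    by rewrite sx in sx'.
  by have [? ?] := IH _ _ e3; subst.
- move=> x c s sx s2 t2 e.
  inversion e as [| | | | |? ? ? ? ? ? ? sx']; subst => //.
  by rewrite sx in sx'.
- move=> x c s s1 s1' t1 t1' sx _ IH1 _ IH2 s2 t2 e.
  inversion e as [| | | |? ? ? sx'|? ? ? ? ? ? ? ? e3 e4]; subst.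
    by rewrite sx' in sx.
  have [? ?] := IH1 _ _ e3; subst.
  by have [? ?] := IH2 _ _ e4; subst.
Qed.

Lemma step_depth (i : instr A) s B : 0 < B ->
  (forall x, tree_depth (s x) <= B) ->
  forall x, tree_depth (step i s x) <= B.+1.
Proof.
move=> B0 sB x; have hs y : tree_depth (s y) <= B.+1 by apply: leq_trans (sB y) _.
case: i => [y|y z|y z w|y z|y z|y f ys|y r ys] /=; rewrite /set_var; case: eqP => //= _.
- by rewrite ltnS geq_max !sB.
- by apply: leq_trans (hs z); case: (s z) => //= a b; rewrite ltnW // ltnS leq_maxl.
- by apply: leq_trans (hs z); case: (s z) => //= a b; rewrite ltnW // ltnS leq_maxr.
- by case: atoms_of.
- by case: atoms_of => //= l; case: rel_interp.
Qed.

Lemma exec_depth c s s' t B : exec c s s' t -> 0 < B ->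
  (forall x, tree_depth (s x) <= B) ->
  forall x, tree_depth (s' x) <= B + t.
Proof.
move=> e; elim: e B => {c s s' t}.
- by move=> i s B B0 sB; rewrite addn1; exact: step_depth.
- move=> c1 c2 s s1 s2 t1 t2 _ IH1 _ IH2 B B0 sB; rewrite addnA.
  by apply: IH2; [rewrite addn_gt0 B0|exact: IH1].
- move=> x c1 c2 s s' t _ _ IH B B0 sB y; rewrite addnS; apply: leq_trans (IH B B0 sB y) _.
  by rewrite leqnSn.
- move=> x c1 c2 s s' t _ _ IH B B0 sB y; rewrite addnS; apply: leq_trans (IH B B0 sB y) _.
  by rewrite leqnSn.
- by move=> x c s _ B B0 sB y; rewrite addn1; apply: leq_trans (sB y) _.
- move=> x c s s1 s2 t1 t2 _ _ IH1 _ IH2 B B0 sB y.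
  have := IH2 (B + t1) _ (IH1 B B0 sB) y; rewrite addn_gt0 B0 => /(_ isT) h.
  by apply: leq_trans h _; rewrite addnS addnA leqnSn.
Qed.

Lemma size_le_depth (l : seq P) : size l <= tree_depth (encode R l).
Proof. by elim: l => //= x l IH; rewrite ltnS (leq_trans IH) // leq_maxr. Qed.

Lemma depth_encode (l : seq P) : tree_depth (encode R l) <= (size l).+2.
Proof. by elim: l => //= x l IH; rewrite ltnS geq_max /= IH. Qed.

Lemma encode_inj : injective (encode R (P := P)).
Proof. by elim=> [|x l IH] [|y l'] //= [-> /IH ->]. Qed.

(** Relocation lets a given program, which reads variable 0, run above variables already in use. *)
Definition shift_instr (m : nat) (i : instr A) : instr A :=
  match i with
  | SetLeaf x => SetLeaf A (m + x)
  | Copy x y => Copy A (m + x) (m + y)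
  | SetNode x y z => SetNode A (m + x) (m + y) (m + z)
  | SetHd x y => SetHd A (m + x) (m + y)
  | SetTl x y => SetTl A (m + x) (m + y)
  | SetFun x f ys => SetFun (m + x) f (map (addn m) ys)
  | SetRel x r ys => SetRel (m + x) r (map (addn m) ys)
  end.

Fixpoint shift_program (m : nat) c : program A :=
  match c with
  | Instr i => Instr (shift_instr m i)
  | Seq c1 c2 => Seq (shift_program m c1) (shift_program m c2)
  | If x c1 c2 => If (m + x) (shift_program m c1) (shift_program m c2)
  | While x c => While (m + x) (shift_program m c)
  end.

Definition instr_below (V : nat) (i : instr A) : bool :=
  match i with
  | SetLeaf x => x < V
  | Copy x y | SetHd x y | SetTl x y => (x < V) && (y < V)
  | SetNode x y z => [&& x < V, y < V & z < V]
  | SetFun x _ ys | SetRel x _ ys => (x < V) && all (fun y => y < V) ys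
  end.

Fixpoint program_below (V : nat) c : bool :=
  match c with
  | Instr i => instr_below V i
  | Seq c1 c2 => program_below V c1 && program_below V c2
  | If x c1 c2 => [&& x < V, program_below V c1 & program_below V c2]
  | While x c => (x < V) && program_below V c
  end.

Lemma instr_below_mono V V' i : V <= V' -> instr_below V i -> instr_below V' i.
Proof.
move=> VV; have h x : x < V -> x < V' by move=> xV; apply: leq_trans VV.
have ha ys : all (fun y => y < V) ys -> all (fun y => y < V') ys.
  by apply: sub_all => y; exact: h.
case: i => [y|y z|y z w|y z|y z|y f ys|y r ys] /=.
- exact: h.
- by case/andP => /h -> /h.
- by case/and3P => /h -> /h -> /h.
- by case/andP => /h -> /h.
- by case/andP => /h -> /h.
- by case/andP => /h -> /ha.
- by case/andP => /h -> /ha.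
Qed.

Lemma program_below_mono V V' c : V <= V' -> program_below V c -> program_below V' c.
Proof.
move=> VV; have h x : x < V -> x < V' by move=> xV; apply: leq_trans VV.
elim: c => [i|c1 IH1 c2 IH2|x c1 IH1 c2 IH2|x c IH] /=.
- exact: instr_below_mono.
- by case/andP => /IH1 -> /IH2.
- by case/and3P => /h -> /IH1 -> /IH2.
- by case/andP => /h -> /IH.
Qed.

Lemma instr_below_ex i : exists V, instr_below V i.
Proof.
have ha (ys : seq nat) : exists V, all (fun y => y < V) ys.
  elim: ys => [|y ys [V yV]]; first by exists 0.
  exists (maxn y.+1 V) => /=; rewrite leq_maxl /=.
  by apply: sub_all yV => z zV; rewrite leq_max zV orbT.
case: i => [y|y z|y z w|y z|y z|y f ys|y r ys].
- by exists y.+1 => /=.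
- by exists (y + z).+1 => /=; lia.
- by exists (y + z + w).+1 => /=; lia.
- by exists (y + z).+1 => /=; lia.
- by exists (y + z).+1 => /=; lia.
- have [V hV] := ha ys; exists (maxn y.+1 V) => /=; rewrite leq_maxl /=.
  by apply: sub_all hV => z zV; rewrite leq_max zV orbT.
- have [V hV] := ha ys; exists (maxn y.+1 V) => /=; rewrite leq_maxl /=.
  by apply: sub_all hV => z zV; rewrite leq_max zV orbT.
Qed.

Lemma program_below_ex c : exists V, program_below V c.
Proof.
elim: c => [i|c1 [V1 h1] c2 [V2 h2]|x c1 [V1 h1] c2 [V2 h2]|x c [V h]].
- exact: instr_below_ex.
- by exists (maxn V1 V2) => /=; rewrite (program_below_mono _ h1) ?leq_maxl //
     (program_below_mono _ h2) ?leq_maxr.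
- exists (maxn x.+1 (maxn V1 V2)) => /=; rewrite leq_maxl /=.
  by rewrite (program_below_mono _ h1) ?(program_below_mono _ h2) //; lia.
- exists (maxn x.+1 V) => /=; rewrite leq_maxl /=.
  by rewrite (program_below_mono _ h) // leq_maxr.
Qed.

Definition shifted (m V : nat) s s2 : Prop :=
  forall x, x < V -> s2 (m + x) = s x.

Lemma shifted_step m V i s s2 : instr_below V i -> shifted m V s s2 ->
  shifted m V (step i s) (step (shift_instr m i) s2) /\
  (forall y, y < m -> step (shift_instr m i) s2 y = s2 y).
Proof.
move=> iV ss.
have H z u v : u = v ->
    shifted m V (set_var s z u) (set_var s2 (m + z) v) /\
    (forall y, y < m -> set_var s2 (m + z) v y = s2 y).
  move=> ->; split=> [x xV|y ym]; rewrite /set_var ?eqn_add2l.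
    by case: eqP => // _; exact: ss.
  by case: eqP => // e; move: ym; rewrite e ltnNge leq_addr.
have Hm ys : all (fun y => y < V) ys -> map s2 (map (addn m) ys) = map s ys.
  move=> /allP ysV; rewrite -map_comp; apply/eq_in_map => y /ysV yV /=.
  exact: ss.
case: i iV => [y|y z|y z w|y z|y z|y f ys|y r ys] /= iV; apply: H.
- by [].
- by rewrite ss //; case/andP: iV.
- by case/and3P: iV => _ zV wV; rewrite !ss.
- by rewrite ss //; case/andP: iV.
- by rewrite ss //; case/andP: iV.
- by rewrite Hm //; case/andP: iV.
- by rewrite Hm //; case/andP: iV.
Qed.

Lemma exec_shift m V c s s' t : exec c s s' t -> program_below V c ->
  forall s2, shifted m V s s2 ->
  exists s2', [/\ exec (shift_program m c) s2 s2' t, shifted m V s' s2'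
                & forall y, y < m -> s2' y = s2 y].
Proof.
elim=> {c s s' t} /=.
- move=> i s iV s2 ss; have [h1 h2] := shifted_step iV ss.
  by exists (step (shift_instr m i) s2); split=> //; constructor.
- move=> c1 c2 s s1 s1' t1 t2 _ IH1 _ IH2 /andP[V1 V2] s2 ss.
  have [s3 [e3 h3 f3]] := IH1 V1 _ ss; have [s4 [e4 h4 f4]] := IH2 V2 _ h3.
  exists s4; split=> //; first exact: exec_seq e3 e4.
  by move=> y ym; rewrite f4 ?f3.
- move=> x c1 c2 s s' t sx _ IH /and3P[xV V1 V2] s2 ss.
  have [s3 [e3 h3 f3]] := IH V1 _ ss; exists s3; split=> //.
  by apply: exec_if_true => //; rewrite ss.
- move=> x c1 c2 s s' t sx _ IH /and3P[xV V1 V2] s2 ss.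
  have [s3 [e3 h3 f3]] := IH V2 _ ss; exists s3; split=> //.
  by apply: exec_if_false => //; rewrite ss.
- move=> x c s sx /andP[xV V1] s2 ss; exists s2; split=> //.
  by apply: exec_while_stop; rewrite ss.
- move=> x c s s1 s1' t1 t2 sx _ IH1 _ IH2 V2 s2 ss; case/andP: (V2) => xV V1.
  have [s3 [e3 h3 f3]] := IH1 V1 _ ss; have [s4 [e4 h4 f4]] := IH2 V2 _ h3.
  exists s4; split=> //; last by move=> y ym; rewrite f4 ?f3.
  by apply: exec_while_loop e3 e4; rewrite ss.
Qed.

Fixpoint clear_from (m V : nat) : program A :=
  if V is V'.+1 then Seq (Instr (SetLeaf A m)) (clear_from m.+1 V')
  else Instr (SetLeaf A m).

Lemma exec_clear m V s : exists s', [/\ exec (clear_from m V) s s' V.+1,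
  forall y, y < m -> s' y = s y & forall y, m <= y <= m + V -> s' y = Leaf].
Proof.
elim: V m s => [|V IH] m s /=.
  exists (set_var s m Leaf); split; first exact: exec_instr.
    by move=> y ym; rewrite /set_var; case: eqP => // e; lia.
  by move=> y ym; rewrite /set_var; case: eqP => // e; lia.
have [s' [e h1 h2]] := IH m.+1 (set_var s m Leaf).
exists s'; split.
- by rewrite -[V.+2]add1n; apply: exec_seq e; exact: exec_instr.
- by move=> y ym; rewrite h1 ?leqW // /set_var; case: eqP => // ?; lia.
- move=> y ym; case: (ltngtP m y) => [my|my|<-]; first by apply: h2; lia.
    by lia.
  by rewrite h1 // /set_var eqxx.
Qed.

End Machine.

(** * Combinators for polynomial-time programs *)

Section PolyTime.
Variables (R : realType) (P : Type) (A : structure R P).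

Local Notation value := (tree (atom R P)).

Class encodable (X : Type) := enc : X -> value.

#[global] Instance enc_point : encodable P := fun p => Atom (Point p).
#[global] Instance enc_bool : encodable bool := fun b => bool_tree R P b.
#[global] Instance enc_nat : encodable nat := fun n => iter n (Node Leaf) Leaf.
#[global] Instance enc_pair X Y (eX : encodable X) (eY : encodable Y) :
  encodable (X * Y) := fun p => Node (enc p.1) (enc p.2).
(** On sequences of points this is convertible to [encode], so [ptime] and [computes] share their
    format. *)
#[global] Instance enc_seq X (eX : encodable X) : encodable (seq X) :=
  fun l => foldr (fun x => Node (enc x)) Leaf l.

Definition code_size {X} {eX : encodable X} (x : X) : nat := tree_size (enc x).

(* [C m] reads its argument in the variable [m], leaves its result there and
   does not touch the variables below [m]; this is what makes the programs
   compose.  The parameter [n] plays the role of the input size. *)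
Definition ptime {X Y} {eX : encodable X} {eY : encodable Y}
    (D : X -> nat -> Prop) (f : X -> Y) : Prop :=
  exists (C : nat -> program A) (B : nat -> nat), poly_bounded B /\
  forall m s x n, D x n -> s m = enc x ->
  exists s' t, [/\ exec (C m) s s' t, s' m = enc (f x),
    forall y, y < m -> s' y = s y, t <= B n & code_size (f x) <= B n].

Definition size_le {X} {eX : encodable X} (x : X) (n : nat) : Prop :=
  code_size x <= n.

Definition polytime {X Y} {eX : encodable X} {eY : encodable Y} (f : X -> Y) :=
  ptime size_le f.

Lemma size_le_code_size {X} {eX : encodable X} (l : seq X) : size l < code_size l.
Proof.
rewrite /code_size; elim: l => //= x l IH; rewrite ltnS.
by apply: leq_trans IH _; rewrite leq_addl.
Qed.

Ltac store := rewrite /= /set_var; repeat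
  match goal with
  | |- context [@eq_op _ ?a ?b] => case: (@eqP _ a b) => [?|_] //; try lia
  end; try lia.

Section Combinators.
Context {X : Type} {eX : encodable X} (D : X -> nat -> Prop).

Lemma ptime_ext {Y} {eY : encodable Y} (f g : X -> Y) :
  (forall x n, D x n -> f x = g x) -> ptime D f -> ptime D g.
Proof.
move=> fg [C [B [pB h]]]; exists C, B; split=> // m s x n Dx sx.
by rewrite -(fg _ _ Dx); exact: h Dx sx.
Qed.

(** The same program serves for any two types whose values have equal codes, such as lists and
    pairs. *)
Lemma ptime_recode {Y Z} {eY : encodable Y} {eZ : encodable Z}
    (f : X -> Y) (g : X -> Z) :
  (forall x n, D x n -> enc (f x) = enc (g x)) -> ptime D f -> ptime D g.
Proof.
move=> fg [C [B [pB h]]]; exists C, B; split=> // m s x n Dx sx.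
by rewrite /code_size -(fg _ _ Dx); exact: h Dx sx.
Qed.

Lemma ptime_sub {Y} {eY : encodable Y} (D' : X -> nat -> Prop) (f : X -> Y)
    (r : nat -> nat) : poly_bounded r ->
  (forall x n, D x n -> D' x (r n)) -> ptime D' f -> ptime D f.
Proof.
move=> pr DD [C [B [pB h]]]; exists C, (fun n => B (r n)); split.
  exact: poly_bounded_comp.
by move=> m s x n Dx sx; exact: h (DD _ _ Dx) sx.
Qed.

Lemma ptime_comp_in {Y Z} {eY : encodable Y} {eZ : encodable Z}
    (D' : Y -> nat -> Prop) (r : nat -> nat) (f : X -> Y) (g : Y -> Z) :
  poly_bounded r -> (forall x n, D x n -> D' (f x) (r n)) ->
  ptime D' g -> ptime D f -> ptime D (fun x => g (f x)).
Proof.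
move=> pr DD [Cg [Bg [pBg hg]]] [Cf [Bf [pBf hf]]].
exists (fun m => Seq (Cf m) (Cg m)), (fun n => Bf n + Bg (r n)); split.
  by poly_bound.
move=> m s x n Dx sx; have [s1 [t1 [e1 v1 f1 le1 _]]] := hf _ _ _ _ Dx sx.
have [s2 [t2 [e2 v2 f2 le2 z2]]] := hg _ _ _ _ (DD _ _ Dx) v1.
exists s2, (t1 + t2); split=> //; first exact: exec_seq e1 e2.
- by move=> y ym; rewrite f2 ?f1.
- by rewrite leq_add.
- by rewrite (leq_trans z2) // leq_addl.
Qed.

Lemma ptime_comp {Y Z} {eY : encodable Y} {eZ : encodable Z}
    (f : X -> Y) (g : Y -> Z) :
  polytime g -> ptime D f -> ptime D (fun x => g (f x)).
Proof.
move=> pg pf; have [C0 [B [pB h]]] := pf.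
apply: ptime_comp_in pB _ pg pf => x n Dx.
by have [s1 [t1 []]] := h 0 (fun _ : nat => @enc X eX x) x n Dx erefl.
Qed.

Lemma ptime_pair {Y Z} {eY : encodable Y} {eZ : encodable Z}
    (f : X -> Y) (g : X -> Z) :
  ptime D f -> ptime D g -> ptime D (fun x => (f x, g x)).
Proof.
move=> [Cf [Bf [pBf hf]]] [Cg [Bg [pBg hg]]].
exists (fun m => Seq (Instr (Copy A m.+1 m)) (Seq (Cf m.+1)
  (Seq (Instr (Copy A m.+2 m)) (Seq (Cg m.+2) (Instr (SetNode A m m.+1 m.+2)))))),
  (fun n => Bf n + Bg n + 3); split; first by poly_bound.
move=> m s x n Dx sx.
set s0 := step (Copy A m.+1 m) s.
have v0 : s0 m.+1 = enc x by rewrite /s0; store.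
have [s1 [t1 [e1 v1 f1 le1 z1]]] := hf _ _ _ _ Dx v0.
set s2 := step (Copy A m.+2 m) s1.
have v2 : s2 m.+2 = enc x by rewrite /s2; store; rewrite f1 // /s0; store.
have [s3 [t3 [e3 v3 f3 le3 z3]]] := hg _ _ _ _ Dx v2.
have v31 : s3 m.+1 = enc (f x) by rewrite f3 // /s2; store.
exists (step (SetNode A m m.+1 m.+2) s3), (1 + (t1 + (1 + (t3 + 1)))); split.
- do !apply: exec_seq; try exact: exec_instr; [exact: e1|exact: e3].
- by rewrite /= /set_var eqxx v31 v3.
- move=> y ym; store; rewrite f3; last by lia.
  by rewrite /s2; store; rewrite f1 /s0; store.
- by lia.
- by rewrite /code_size /= in z1 z3 *; rewrite -/(code_size _) /code_size; lia.
Qed.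

Lemma ptime_if {Y} {eY : encodable Y} (b : X -> bool) (f g : X -> Y) :
  ptime D b -> ptime D f -> ptime D g ->
  ptime D (fun x => if b x then f x else g x).
Proof.
move=> [Cb [Bb [pBb hb]]] [Cf [Bf [pBf hf]]] [Cg [Bg [pBg hg]]].
exists (fun m => Seq (Instr (Copy A m.+1 m)) (Seq (Cb m.+1)
  (If m.+1 (Cf m) (Cg m)))), (fun n => Bb n + Bf n + Bg n + 2); split.
  by poly_bound.
move=> m s x n Dx sx.
set s0 := step (Copy A m.+1 m) s.
have v0 : s0 m.+1 = enc x by rewrite /s0; store.
have [s1 [t1 [e1 v1 f1 le1 z1]]] := hb _ _ _ _ Dx v0.
have v2 : s1 m = enc x by rewrite f1 // /s0; store.
have fr y : y < m -> s1 y = s y by move=> ym; rewrite f1 /s0; store.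
case: (boolP (b x)) => bx.
- have [s3 [t3 [e3 v3 f3 le3 z3]]] := hf _ _ _ _ Dx v2.
  exists s3, (1 + (t1 + t3.+1)); split=> //.
  + do !apply: exec_seq; [exact: exec_instr|exact: e1|].
    by apply: exec_if_true => //; rewrite v1 bx.
  + by move=> y ym; rewrite f3 // fr.
  + by lia.
  + by lia.
- have [s3 [t3 [e3 v3 f3 le3 z3]]] := hg _ _ _ _ Dx v2.
  exists s3, (1 + (t1 + t3.+1)); split=> //.
  + do !apply: exec_seq; [exact: exec_instr|exact: e1|].
    by apply: exec_if_false => //; rewrite v1 (negbTE bx).
  + by move=> y ym; rewrite f3 // fr.
  + by lia.
  + by lia.
Qed.

Lemma ptime_foldl {Y Z} {eY : encodable Y} {eZ : encodable Z}
    (D' : X * (Z * Y) -> nat -> Prop) (r r' : nat -> nat)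
    (g : X -> Z -> Y -> Z) (a : X -> Z) (l : X -> seq Y) :
  poly_bounded r -> poly_bounded r' -> ptime D' (fun p => g p.1 p.2.1 p.2.2) ->
  ptime D a -> ptime D l ->
  (forall x n l1 y l2, D x n -> l x = l1 ++ y :: l2 ->
     D' (x, (foldl (g x) (a x) l1, y)) (r n)) ->
  (forall x n, D x n -> code_size (foldl (g x) (a x) (l x)) <= r' n) ->
  ptime D (fun x => foldl (g x) (a x) (l x)).
Proof.
move=> pr pr' [Cg [Bg [pBg hg]]] [Ca [Ba [pBa ha]]] [Cl [Bl [pBl hl]]] DD DS.
(* Variable [m] keeps the argument, [m.+1] the rest of the list, [m.+2] the accumulator; [m.+3] is
   where [g] runs. *)
pose body m := Seq (Instr (SetHd A m.+3 m.+1)) (Seq (Instr (SetNode A m.+3 m.+2 m.+3))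
  (Seq (Instr (SetNode A m.+3 m m.+3)) (Seq (Cg m.+3)
  (Seq (Instr (Copy A m.+2 m.+3)) (Instr (SetTl A m.+1 m.+1)))))).
exists (fun m => Seq (Instr (Copy A m.+1 m)) (Seq (Cl m.+1)
  (Seq (Instr (Copy A m.+2 m)) (Seq (Ca m.+2)
  (Seq (While m.+1 (body m)) (Instr (Copy A m m.+2))))))),
  (fun n => Ba n + Bl n + Bl n * (Bg (r n) + 6) + r' n + 4); split.
  by poly_bound.
move=> m s x n Dx sx.
have loop l1 l2 s0 : l x = l1 ++ l2 -> s0 m = enc x -> s0 m.+1 = enc l2 ->
    s0 m.+2 = enc (foldl (g x) (a x) l1) ->
    exists s' t, [/\ exec (While m.+1 (body m)) s0 s' t,
      s' m.+2 = enc (foldl (g x) (a x) (l x)),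
      forall y, y < m.+1 -> s' y = s0 y & t <= size l2 * (Bg (r n) + 6) + 1].
  elim: l2 l1 s0 => [|y l2 IH] l1 s0 el v0 v1 v2.
    exists s0, 1; split=> //.
      by apply: exec_while_stop; rewrite v1.
    by rewrite el cats0.
  set s1 := step (SetHd A m.+3 m.+1) s0.
  set s2 := step (SetNode A m.+3 m.+2 m.+3) s1.
  set s3 := step (SetNode A m.+3 m m.+3) s2.
  have v3 : s3 m.+3 = enc (x, (foldl (g x) (a x) l1, y)).
    have -> : s3 m.+3 = Node (s0 m) (Node (s0 m.+2) (hd_tree (s0 m.+1))).
      by rewrite /s3 /s2 /s1 /= /set_var !eqxx;
         repeat (case: eqP => [?|_]; first lia).
    by rewrite v0 v1 v2.
  have Dg := DD _ _ _ _ _ Dx el.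
  have [s4 [t4 [e4 v4 f4 le4 z4]]] := hg _ _ _ _ Dg v3.
  have fr z : z < m.+3 -> s4 z = s0 z.
    by move=> zm; rewrite f4 // /s3 /s2 /s1; store.
  set s5 := step (Copy A m.+2 m.+3) s4.
  set s6 := step (SetTl A m.+1 m.+1) s5.
  have [||||s7 [t7 [e7 v7 f7 le7]]] := IH (rcons l1 y) s6.
  - by rewrite cat_rcons.
  - by rewrite /s6 /s5; store; rewrite fr //; lia.
  - have -> : s6 m.+1 = tl_tree (s4 m.+1) by rewrite /s6 /s5; store.
    by rewrite fr ?v1 //; lia.
  - have -> : s6 m.+2 = s4 m.+3 by rewrite /s6 /s5; store.
    by rewrite v4 foldl_rcons.
  exists s7, ((1 + (1 + (1 + (t4 + (1 + 1))))) + t7).+1; split=> //.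
  + apply: exec_while_loop e7; first by rewrite v1.
    do !apply: exec_seq; try exact: exec_instr; exact: e4.
  + by move=> z zm; rewrite f7 // /s6 /s5; store; rewrite fr; store.
  + by rewrite /= mulSn; lia.
set s0 := step (Copy A m.+1 m) s.
have v0 : s0 m.+1 = enc x by rewrite /s0; store.
have [s1 [t1 [e1 v1 f1 le1 z1]]] := hl _ _ _ _ Dx v0.
set s2 := step (Copy A m.+2 m) s1.
have v2 : s2 m.+2 = enc x by rewrite /s2; store; rewrite f1 // /s0; store.
have [s3 [t3 [e3 v3 f3 le3 z3]]] := ha _ _ _ _ Dx v2.
have [||||s4 [t4 [e4 v4 f4 le4]]] := loop [::] (l x) s3 => //.
- rewrite f3; last by lia.
  by rewrite /s2; store; rewrite f1 /s0; store.
- by rewrite f3 // /s2; store.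
exists (step (Copy A m m.+2) s4), (1 + (t1 + (1 + (t3 + (t4 + 1))))); split.
- by do !apply: exec_seq; try exact: exec_instr; [exact: e1|exact: e3|exact: e4].
- by rewrite /= /set_var eqxx.
- move=> y ym; store; rewrite f4; last by lia.
  rewrite f3; last by lia.
  by rewrite /s2; store; rewrite f1 /s0; store.
- have : size (l x) * (Bg (r n) + 6) <= Bl n * (Bg (r n) + 6).
    rewrite leq_mul2r; apply/orP; right.
    by apply: leq_trans z1; apply: ltnW; exact: size_le_code_size.
  by lia.
- by have := DS _ _ Dx; lia.
Qed.

Lemma ptime_uncons {Y Z} {eY : encodable Y} {eZ : encodable Z}
    (l : X -> seq Y) (f : X -> Z) (g : X -> Y * seq Y -> Z) :
  ptime D (fun x => x) -> ptime D l -> ptime D f ->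
  polytime (fun p : X * (Y * seq Y) => g p.1 p.2) ->
  ptime D (fun x => if l x is y :: l' then g x (y, l') else f x).
Proof.
move=> [C0 [B0 [pB0 h0]]] [Cl [Bl [pBl hl]]] [Cf [Bf [pBf hf]]] [Cg [Bg [pBg hg]]].
exists (fun m => Seq (Instr (Copy A m.+1 m)) (Seq (Cl m.+1)
  (If m.+1 (Seq (Instr (SetNode A m m m.+1)) (Cg m)) (Cf m)))),
  (fun n => Bl n + Bf n + Bg (B0 n + Bl n + 1) + 3); split.
  by poly_bound.
move=> m s x n Dx sx.
set s0 := step (Copy A m.+1 m) s.
have v0 : s0 m.+1 = enc x by rewrite /s0; store.
have [s1 [t1 [e1 v1 f1 le1 z1]]] := hl _ _ _ _ Dx v0.
have v2 : s1 m = enc x by rewrite f1 // /s0; store.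
have fr y : y < m -> s1 y = s y by move=> ym; rewrite f1 /s0; store.
case el : (l x) => [|y l'].
- have [s3 [t3 [e3 v3 f3 le3 z3]]] := hf _ _ _ _ Dx v2.
  exists s3, (1 + (t1 + t3.+1)); split=> //.
  + do !apply: exec_seq; [exact: exec_instr|exact: e1|].
    by apply: exec_if_false => //; rewrite v1 el.
  + by move=> y ym; rewrite f3 // fr.
  + by move=> /=; lia.
  + by move=> /=; lia.
- set s2 := step (SetNode A m m m.+1) s1.
  have v3 : s2 m = enc (x, (y, l')) by rewrite /s2; store; rewrite v2 v1 el.
  have z0 : code_size x <= B0 n by have [? [? []]] := h0 _ _ _ _ Dx sx.
  have D2 : size_le (x, (y, l')) (B0 n + Bl n + 1).
    move: z1; rewrite el /size_le /code_size /= in z0 * => z1.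
    by rewrite addn1 ltnS leq_add.
  have [s3 [t3 [e3 v4 f3 le3 z3]]] := hg _ _ _ _ D2 v3.
  exists s3, (1 + (t1 + (1 + t3).+1)); split=> //.
  + do !apply: exec_seq; [exact: exec_instr|exact: e1|].
    apply: exec_if_true => //; first by rewrite v1 el.
    by apply: exec_seq e3; exact: exec_instr.
  + by move=> z zm; rewrite f3 // /s2; store; rewrite fr.
  + by move=> /=; lia.
  + by move: z3 => /=; lia.
Qed.

End Combinators.

Section Basic.
Context {X Y : Type} {eX : encodable X} {eY : encodable Y}.

Lemma polytime_id : polytime (fun x : X => x).
Proof.
exists (fun m => Instr (Copy A m m)), (fun n => n + 1); split; first by poly_bound.
move=> m s x n Dx sx; exists (step (Copy A m m) s), 1; split=> //.
- exact: exec_instr.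
- by rewrite /= /set_var eqxx.
- by move=> y ym; store.
- by lia.
- by apply: leq_trans Dx _; rewrite leq_addr.
Qed.

Lemma polytime_fst : polytime (fun p : X * Y => p.1).
Proof.
exists (fun m => Instr (SetHd A m m)), (fun n => n + 1); split; first by poly_bound.
move=> m s x n Dx sx; exists (step (SetHd A m m) s), 1; split=> //.
- exact: exec_instr.
- by rewrite /= /set_var eqxx sx.
- by move=> y ym; store.
- by lia.
- by move: Dx; rewrite /size_le /code_size /=; lia.
Qed.

Lemma polytime_snd : polytime (fun p : X * Y => p.2).
Proof.
exists (fun m => Instr (SetTl A m m)), (fun n => n + 1); split; first by poly_bound.
move=> m s x n Dx sx; exists (step (SetTl A m m) s), 1; split=> //.
- exact: exec_instr.
- by rewrite /= /set_var eqxx sx.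
- by move=> y ym; store.
- by lia.
- by move: Dx; rewrite /size_le /code_size /=; lia.
Qed.

Lemma ptime_leaf (D : X -> nat -> Prop) (y : Y) : enc y = Leaf -> ptime D (fun=> y).
Proof.
move=> ey; exists (fun m => Instr (SetLeaf A m)), (fun n => 1); split; first by poly_bound.
move=> m s x n Dx sx; exists (step (SetLeaf A m) s), 1; split=> //.
- exact: exec_instr.
- by rewrite /= /set_var eqxx.
- by move=> z zm; store.
- by rewrite /code_size ey.
Qed.

End Basic.

End PolyTime.

(** * List operations and unary arithmetic *)

Section Derived.
Variables (R : realType) (P : Type) (A : structure R P).

Local Notation PT := (polytime (R := R) (P := P) A).
Local Notation code := (code_size (R := R) (P := P)).
Local Notation encodable := (encodable R P).

Section Lists.
Context {X : Type} {eX : encodable X}.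

Lemma code_size_pair {Y} {eY : encodable Y} (p : X * Y) :
  code p = (code p.1 + code p.2).+1.
Proof. by []. Qed.

Lemma code_size_cons (x : X) l : code (x :: l) = (code x + code l).+1.
Proof. by []. Qed.

Lemma code_size_gt0 (x : X) : 0 < code x.
Proof. exact: tree_size_gt0. Qed.

Lemma code_size_cat (l l' : seq X) : code (l ++ l') <= code l + code l'.
Proof.
elim: l => [|x l IH] /=; first by rewrite leq_addl.
by rewrite !code_size_cons addSn ltnS -addnA leq_add2l.
Qed.

Lemma code_size_mem (x : X) l1 l2 : code x <= code (l1 ++ x :: l2).
Proof.
elim: l1 => [|y l1 IH] /=; rewrite code_size_cons; first by rewrite leqW // leq_addr.
by apply: leq_trans IH _; rewrite leqW // leq_addl.
Qed.

End Lists.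

Lemma polytime_size {X Y} {eX : encodable X} {eY : encodable Y} (f : X -> Y) : PT f ->
  exists2 b, poly_bounded b & forall x n, code x <= n -> code (f x) <= b n.
Proof.
case=> C [B [pB h]]; exists B => // x n Dx.
by have [s [t []]] := h 0 (fun _ : nat => @enc _ _ X eX x) x n Dx erefl.
Qed.

Section Foldl.
Context {X Y Z : Type} {eX : encodable X} {eY : encodable Y} {eZ : encodable Z}.

Lemma polytime_foldl (g : X -> Z -> Y -> Z) (a : X -> Z) (l : X -> seq Y) r :
  poly_bounded r -> PT (fun p : X * (Z * Y) => g p.1 p.2.1 p.2.2) -> PT a -> PT l ->
  (forall x n l1 l2, l x = l1 ++ l2 -> code x <= n ->
     code (foldl (g x) (a x) l1) <= r n) ->
  PT (fun x => foldl (g x) (a x) (l x)).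
Proof.
move=> pr pg pa pl H; have [b pb hb] := polytime_size pl.
refine (@ptime_foldl R P A X eX (@size_le R P _ _) Y Z eY eZ (@size_le R P _ _) (fun n => n + r n + b n + 2) r g a l _ pr pg pa pl _ _).
- by poly_bound.
- move=> x n l1 y l2 Dx el; rewrite /size_le !code_size_pair /=.
  have h1 := H x n l1 (y :: l2) el Dx.
  have h2 : code y <= code (l x) by rewrite el; exact: code_size_mem.
  have h3 := leq_trans h2 (hb x n Dx).
  by move: Dx; rewrite /size_le; lia.
- by move=> x n Dx; apply: (H _ _ _ [::] _ Dx); rewrite cats0.
Qed.

(** Iterating a polynomial-time step can make the accumulator explode. Growth by an amount
    independent of the accumulator rules this out. *)
Lemma polytime_foldl_add (g : X -> Z -> Y -> Z) (a : X -> Z) (l : X -> seq Y) r :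
  poly_bounded r -> PT (fun p : X * (Z * Y) => g p.1 p.2.1 p.2.2) -> PT a -> PT l ->
  (forall x n z y, code x + code y <= n -> code (g x z y) <= code z + r n) ->
  PT (fun x => foldl (g x) (a x) (l x)).
Proof.
move=> pr pg pa pl H.
have [ba pba hba] := polytime_size pa; have [bl pbl hbl] := polytime_size pl.
apply: (@polytime_foldl g a l (fun n => ba n + bl n * r (n + bl n))) => //.
  by poly_bound.
move=> x n l1 l2 el Dx.
have szl : size (l x) <= bl n by apply: leq_trans (hbl _ _ Dx); apply/ltnW/size_le_code_size.
have szl1 : size l1 <= bl n by apply: leq_trans szl; rewrite el size_cat leq_addr.
have h : code (foldl (g x) (a x) l1) <= ba n + size l1 * r (n + bl n).
  elim/last_ind: l1 l2 el {szl1} => [|l1 y IH] l2 el.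
    by rewrite /= addn0; exact: hba.
  rewrite foldl_rcons size_rcons mulSn addnCA addnC.
  have el' : l x = l1 ++ y :: l2 by rewrite el cat_rcons.
  have yl : code y <= bl n.
    by apply: leq_trans (hbl _ _ Dx); rewrite el'; exact: code_size_mem.
  apply: leq_trans (leq_add (IH _ el') (leqnn _)).
  by apply: H; rewrite leq_add.
by apply: leq_trans h _; rewrite leq_add2l leq_mul2r szl1 orbT.
Qed.

Lemma polytime_comp2 {W} {eW : encodable W} (g : Y -> Z -> W) (f1 : X -> Y) (f2 : X -> Z) :
  PT (fun p : Y * Z => g p.1 p.2) -> PT f1 -> PT f2 -> PT (fun x => g (f1 x) (f2 x)).
Proof.
move=> pg p1 p2.
exact: (ptime_comp pg (ptime_pair p1 p2)).
Qed.

End Foldl.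

Lemma PT_ext {X Y} {eX : encodable X} {eY : encodable Y} (f g : X -> Y) :
  f =1 g -> PT f -> PT g.
Proof. by move=> fg; apply: ptime_ext => x n _; exact: fg. Qed.

Lemma PT_recode {X Y Z} {eX : encodable X} {eY : encodable Y} {eZ : encodable Z}
    (f : X -> Y) (g : X -> Z) :
  (forall x, enc (f x) = enc (g x) :> tree (atom R P)) -> PT f -> PT g.
Proof. by move=> fg; apply: ptime_recode => x n _; exact: fg. Qed.

Section Constructors.
Context {X : Type} {eX : encodable X}.
Implicit Types (b : X -> bool) (n : X -> nat).

Lemma PT_id : PT (fun x : X => x). Proof. exact: polytime_id. Qed.

Lemma PT_fst {Y Z} {eY : encodable Y} {eZ : encodable Z} (f : X -> Y * Z) :
  PT f -> PT (fun x => (f x).1).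
Proof. exact: (ptime_comp (@polytime_fst _ _ A Y Z eY eZ)). Qed.

Lemma PT_snd {Y Z} {eY : encodable Y} {eZ : encodable Z} (f : X -> Y * Z) :
  PT f -> PT (fun x => (f x).2).
Proof. exact: (ptime_comp (@polytime_snd _ _ A Y Z eY eZ)). Qed.

Lemma PT_pair {Y Z} {eY : encodable Y} {eZ : encodable Z} (f : X -> Y) (g : X -> Z) :
  PT f -> PT g -> PT (fun x => (f x, g x)).
Proof. exact: ptime_pair. Qed.

Lemma PT_if {Y} {eY : encodable Y} b (f g : X -> Y) : PT b -> PT f -> PT g ->
  PT (fun x => if b x then f x else g x).
Proof. exact: ptime_if. Qed.

Lemma PT_nil {Y} {eY : encodable Y} : PT (fun _ : X => [::] : seq Y).
Proof. exact: ptime_leaf. Qed.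

Lemma PT_0 : PT (fun _ : X => 0). Proof. exact: ptime_leaf. Qed.

Lemma PT_false : PT (fun _ : X => false). Proof. exact: ptime_leaf. Qed.

Lemma PT_cons {Y} {eY : encodable Y} (f : X -> Y) (l : X -> seq Y) :
  PT f -> PT l -> PT (fun x => f x :: l x).
Proof. by move=> pf pl; apply: PT_recode (PT_pair pf pl). Qed.

Lemma PT_S n : PT n -> PT (fun x => (n x).+1).
Proof. by move=> pn; apply: PT_recode (PT_pair PT_0 pn). Qed.

Lemma PT_true : PT (fun _ : X => true).
Proof. by apply: PT_recode (PT_pair PT_0 PT_0). Qed.

(** Numbers are coded in unary, as lists of zeros; arithmetic is thereby reduced to list
    programs. *)
Lemma enc_nseq (k : nat) : enc (nseq k 0) = enc k :> tree (atom R P).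
Proof. by elim: k => //= k; rewrite /enc /= => ->. Qed.

Lemma PT_nseq n : PT n -> PT (fun x => nseq (n x) 0).
Proof. by apply: PT_recode => x; rewrite enc_nseq. Qed.

Lemma PT_of_nseq n : PT (fun x => nseq (n x) 0) -> PT n.
Proof. by apply: PT_recode => x; rewrite enc_nseq. Qed.

Lemma PT_uncons {Y Z} {eY : encodable Y} {eZ : encodable Z}
    (l : X -> seq Y) (f : X -> Z) (g : X -> Y * seq Y -> Z) :
  PT l -> PT f -> PT (fun p : X * (Y * seq Y) => g p.1 p.2) ->
  PT (fun x => if l x is y :: l' then g x (y, l') else f x).
Proof.
move=> pl pf pg.
exact: (@ptime_uncons R P A X eX (@size_le R P _ _) Y Z eY eZ l f g PT_id pl pf pg).
Qed.

Lemma PT_andb b1 b2 : PT b1 -> PT b2 -> PT (fun x => b1 x && b2 x).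
Proof. by move=> p1 p2; exact: (PT_if p1 p2 PT_false). Qed.

Lemma PT_orb b1 b2 : PT b1 -> PT b2 -> PT (fun x => b1 x || b2 x).
Proof. by move=> p1 p2; exact: (PT_if p1 PT_true p2). Qed.

Lemma PT_nilp {Y} {eY : encodable Y} (l : X -> seq Y) :
  PT l -> PT (fun x => nilp (l x)).
Proof.
move=> pl; apply: PT_ext (PT_uncons (g := fun _ _ => false) pl PT_true _).
  by move=> x; case: (l x).
exact: ptime_leaf.
Qed.

End Constructors.

Section Destructors.
Context {X : Type} {eX : encodable X}.

Lemma PT_behead {Y} {eY : encodable Y} (l : X -> seq Y) :
  PT l -> PT (fun x => behead (l x)).
Proof.
move=> pl; apply: PT_ext (PT_uncons (g := fun _ q => q.2) pl (PT_nil) _).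
  by move=> x; case: (l x).
by apply: PT_snd; apply: PT_snd; exact: PT_id.
Qed.

Lemma PT_head {Y} {eY : encodable Y} (d : X -> Y) (l : X -> seq Y) :
  PT d -> PT l -> PT (fun x => head (d x) (l x)).
Proof.
move=> pd pl; apply: PT_ext (PT_uncons (g := fun _ q => q.1) pl pd _).
  by move=> x; case: (l x).
by apply: PT_fst; apply: PT_snd; exact: PT_id.
Qed.

Lemma PT_rev {Y} {eY : encodable Y} (l : X -> seq Y) :
  PT l -> PT (fun x => rev (l x)).
Proof.
move=> pl.
have := @polytime_foldl_add X Y (seq Y) eX eY (enc_seq eY) (fun _ z y => y :: z) (fun=> [::]) l
  (fun k => k + 1).
move=> H; apply: PT_ext (H _ _ PT_nil pl _).
- move=> x; rewrite -[RHS]cats0 -[rev _]/(catrev (l x) [::]) cats0.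
  elim: (l x) [::] => //=.
- by poly_bound.
- by apply: PT_cons; do !apply: PT_snd || apply: PT_fst; exact: PT_id.
- by move=> x k z y h; rewrite code_size_cons; lia.
Qed.

End Destructors.

Section Mapping.
Context {X : Type} {eX : encodable X}.

Lemma PT_map {Y Z} {eY : encodable Y} {eZ : encodable Z}
    (g : X -> Y -> Z) (l : X -> seq Y) :
  PT (fun p : X * Y => g p.1 p.2) -> PT l -> PT (fun x => map (g x) (l x)).
Proof.
move=> pg pl; have [b pb hb] := polytime_size pg.
have H := @polytime_foldl_add X Y (seq Z) eX eY (enc_seq eZ) (fun x z y => g x y :: z)
  (fun=> [::]) l (fun k => b (k + 1) + 1).
apply: PT_ext (PT_rev (H _ _ PT_nil pl _)).
- move=> x; rewrite -[in RHS](revK (l x)) map_rev; congr rev.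
  rewrite -[map _ _]cats0; elim: (l x) [::] => //= y s IH z.
  by rewrite rev_cons map_rcons cat_rcons IH.
- by poly_bound.
- apply: PT_cons.
    apply: (@polytime_comp2 _ _ _ _ _ _ _ _ g) => //.
      by apply: PT_fst; exact: PT_id.
    by do 2!apply: PT_snd; exact: PT_id.
  by apply: PT_fst; apply: PT_snd; exact: PT_id.
- move=> x k z y h; rewrite code_size_cons.
  have := hb (x, y) (k + 1); rewrite code_size_pair /=; lia.
Qed.

Lemma PT_cat {Y} {eY : encodable Y} (l l' : X -> seq Y) :
  PT l -> PT l' -> PT (fun x => l x ++ l' x).
Proof.
move=> pl pl'.
have H := @polytime_foldl_add X Y (seq Y) eX eY (enc_seq eY) (fun _ z y => y :: z) l'
  (fun x => rev (l x)) (fun k => k + 1).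
apply: PT_ext (H _ _ pl' (PT_rev pl) _).
- move=> x; rewrite -[in RHS](revK (l x)).
  by elim: (rev (l x)) (l' x) => //= y s IH z; rewrite IH rev_cons cat_rcons.
- by poly_bound.
- by apply: PT_cons; do !apply: PT_snd || apply: PT_fst; exact: PT_id.
- by move=> x k z y h; rewrite code_size_cons; lia.
Qed.

End Mapping.

Section Flattening.
Context {X : Type} {eX : encodable X}.
Implicit Types (m n : X -> nat).

Lemma PT_flatten {Y} {eY : encodable Y} (l : X -> seq (seq Y)) :
  PT l -> PT (fun x => flatten (l x)).
Proof.
move=> pl.
have H := @polytime_foldl_add X (seq Y) (seq Y) eX (enc_seq eY) (enc_seq eY) (fun _ z y => z ++ y)
  (fun=> [::]) l (fun k => k).
apply: PT_ext (H _ _ PT_nil pl _).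
- move=> x; rewrite -[RHS]cat0s.
  by elim: (l x) [::] => [|y s IH] z /=; rewrite ?cats0 // IH catA.
- by poly_bound.
- by apply: PT_cat; do !apply: PT_snd || apply: PT_fst; exact: PT_id.
- by move=> x k z y h; apply: leq_trans (code_size_cat _ _) _; lia.
Qed.

Lemma PT_size {Y} {eY : encodable Y} (l : X -> seq Y) :
  PT l -> PT (fun x => size (l x)).
Proof.
move=> pl; apply: PT_of_nseq.
apply: PT_ext (PT_map (g := fun _ _ => 0) PT_0 pl) => x.
by elim: (l x) => //= y s ->.
Qed.

Lemma PT_subn m n : PT m -> PT n -> PT (fun x => m x - n x).
Proof.
move=> pm pn; apply: PT_of_nseq.
have H := @polytime_foldl_add X nat (seq nat) eX (enc_nat R P) (enc_seq (enc_nat R P)) (fun _ z _ => behead z)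
  (fun x => nseq (m x) 0) (fun x => nseq (n x) 0) (fun=> 0).
apply: PT_ext (H _ _ (PT_nseq pm) (PT_nseq pn) _).
- move=> x; elim: (n x) (m x) => [|j IH] i /=; first by rewrite subn0.
  by case: i => [|i] /=; [rewrite -[[::]]/(nseq 0 0) IH|rewrite IH].
- by poly_bound.
- by apply: PT_behead; do !apply: PT_snd || apply: PT_fst; exact: PT_id.
- by move=> x k [|z z'] y h //=; rewrite code_size_cons; lia.
Qed.

End Flattening.

Section NatArithmetic.
Context {X : Type} {eX : encodable X}.
Implicit Types (m n : X -> nat).

Lemma PT_muln m n : PT m -> PT n -> PT (fun x => m x * n x).
Proof.
move=> pm pn; apply: PT_of_nseq.
have p : PT (fun p : X * nat => nseq (n p.1) 0).
  by apply: PT_nseq; apply: (ptime_comp pn); apply: PT_fst; exact: PT_id.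
apply: PT_ext (PT_flatten (PT_map (g := fun x _ => nseq (n x) 0) p (PT_nseq pm))).
move=> x; by elim: (m x) => //= i ->; rewrite -nseqD.
Qed.

Lemma PT_leq m n : PT m -> PT n -> PT (fun x => m x <= n x).
Proof.
move=> pm pn; apply: PT_ext (PT_nilp (PT_nseq (PT_subn pm pn))) => x.
by rewrite /nilp size_nseq.
Qed.

Lemma PT_ltn m n : PT m -> PT n -> PT (fun x => m x < n x).
Proof. by move=> pm pn; apply: PT_leq => //; exact: PT_S. Qed.

Lemma PT_eqn m n : PT m -> PT n -> PT (fun x => m x == n x).
Proof.
move=> pm pn; apply: PT_ext (PT_andb (PT_leq pm pn) (PT_leq pn pm)) => x.
by rewrite eqn_leq.
Qed.

Lemma PT_pred n : PT n -> PT (fun x => (n x).-1).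
Proof.
move=> pn; apply: PT_ext (PT_subn pn (PT_S PT_0)) => x.
by rewrite subn1.
Qed.

End NatArithmetic.

Section ListSearch.
Context {X : Type} {eX : encodable X}.
Implicit Types n : X -> nat.

Lemma PT_mem n (l : X -> seq nat) : PT n -> PT l -> PT (fun x => n x \in l x).
Proof.
move=> pn pl.
have H := @polytime_foldl X nat bool eX (enc_nat R P) (enc_bool R P) (fun x z y => z || (y == n x))
  (fun=> false) l (fun=> 3).
apply: PT_ext (H _ _ PT_false pl _).
- move=> x; rewrite -[RHS]orFb.
  elim: (l x) false => [|y s IH] z /=; first by rewrite orbF.
  by rewrite IH inE orbA eq_sym.
- by poly_bound.
- apply: PT_orb; first by apply: PT_fst; apply: PT_snd; exact: PT_id.
  apply: PT_eqn; first by do 2!apply: PT_snd; exact: PT_id.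
  by apply: (ptime_comp pn); apply: PT_fst; exact: PT_id.
- by move=> x k l1 l2 _ _; case: (foldl _ _ _).
Qed.

Lemma PT_nth (l : X -> seq nat) n : PT l -> PT n -> PT (fun x => nth 0 (l x) (n x)).
Proof.
move=> pl pn.
have H := @polytime_foldl_add X nat (seq nat) eX (enc_nat R P) (enc_seq (enc_nat R P)) (fun _ z _ => behead z)
  l (fun x => nseq (n x) 0) (fun=> 0).
apply: PT_ext (PT_head PT_0 (H _ _ pl (PT_nseq pn) _)).
- move=> x; elim: (n x) (l x) => [|j IH] s /=; first by rewrite nth0.
  by rewrite IH nth_behead.
- by poly_bound.
- by apply: PT_behead; do !apply: PT_snd || apply: PT_fst; exact: PT_id.
- by move=> x k [|z z'] y h //=; rewrite code_size_cons; lia.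
Qed.

Lemma PT_sum {Y} {eY : encodable Y} (g : X -> Y -> nat) (l : X -> seq Y) :
  PT (fun p : X * Y => g p.1 p.2) -> PT l ->
  PT (fun x => \sum_(y <- l x) g x y).
Proof.
move=> pg pl; apply: PT_of_nseq.
have pg' : PT (fun p : X * Y => nseq (g p.1 p.2) 0) by exact: PT_nseq.
apply: PT_ext (PT_flatten (PT_map (g := fun x y => nseq (g x y) 0) pg' pl)).
move=> x; elim: (l x) => [|y s IH]; rewrite ?big_nil ?big_cons //=.
by rewrite IH nseqD.
Qed.

Lemma code_size_nat (k : nat) : code k = k.*2.+1.
Proof. by elim: k => //= k IH; rewrite -[LHS]/(1 + code k).+1 IH doubleS. Qed.

Lemma code_size_bound_seq (l : seq nat) (k j : nat) :
  size l <= k -> (forall y, y \in l -> code y <= j) -> code l <= k * j.+1 + 1.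
Proof.
elim: l k => [|y l IH] k lk lj; first by rewrite -[code _]/1 addn1.
case: k lk => // k lk; rewrite code_size_cons mulSn.
have h1 : code l <= k * j.+1 + 1.
  by apply: IH => // z zl; apply: lj; rewrite inE zl orbT.
have h2 : code y <= j by apply: lj; rewrite mem_head.
by lia.
Qed.

Lemma PT_iota n : PT n -> PT (fun x => iota 0 (n x)).
Proof.
move=> pn; have [b pb hb] := polytime_size pn.
have H := @polytime_foldl X nat (seq nat) eX (enc_nat R P) (enc_seq (enc_nat R P)) (fun _ z _ => size z :: z)
  (fun=> [::]) (fun x => nseq (n x) 0) (fun k => b k * (b k + 1).+1 + 1).
have E k : foldl (fun (z : seq nat) (_ : nat) => size z :: z) [::] (nseq k 0) = rev (iota 0 k).
  elim: k => // k IH; rewrite -addn1 nseqD cats1 foldl_rcons IH.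
  by rewrite size_rev size_iota -rev_rcons iotaD cats1.
apply: PT_ext (PT_rev (H _ _ PT_nil (PT_nseq pn) _)).
- by move=> x; rewrite E revK.
- by apply: poly_boundedD; last exact: poly_bounded_cst; apply: poly_boundedM => //;
     apply: (poly_bounded_leq (g := fun k => b k + 2)) => [k|]; [lia|poly_bound].
- by apply: PT_cons; first apply: PT_size; do !apply: PT_snd || apply: PT_fst; exact: PT_id.
- move=> x k l1 l2 el Dx.
  have nk : (n x).*2 < b k by rewrite -code_size_nat; exact: hb.
  have -> : l1 = nseq (size l1) 0.
    apply/all_pred1P/allP => y yl.
    have : y \in nseq (n x) 0 by rewrite el mem_cat yl.
    by rewrite mem_nseq => /andP[_].
  have ln : size l1 <= n x by rewrite -(size_nseq (n x) 0) el size_cat leq_addr.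
  rewrite E; apply: code_size_bound_seq; first by rewrite size_rev size_iota; lia.
  by move=> y; rewrite mem_rev mem_iota code_size_nat; lia.
Qed.

End ListSearch.

End Derived.

(** * The greedy algorithm as a program *)

Section GreedyProgram.
Variables (R : realType) (P : eqType) (A : structure R P).

Local Notation PT := (polytime (R := R) (P := P) A).
Local Notation code := (code_size (R := R) (P := P)).
Local Notation encodable := (encodable R P).
Local Notation candidate := (seq nat * seq P)%type.

Ltac projections := repeat
  lazymatch goal with
  | H : ?G |- ?G => exact: H
  | |- _ (fun x => x) => exact: PT_id
  | |- _ (@fst _ _) => apply: PT_fst
  | |- _ (@snd _ _) => apply: PT_snd
  | |- _ (fun x => @fst _ _ _) => apply: PT_fst
  | |- _ (fun x => @snd _ _ _) => apply: PT_snd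
  end.

Section MergeProgram.
Context {X : Type} {eX : encodable X}.

Lemma PT_merge (lab K : X -> seq nat) : PT lab -> PT K ->
  PT (fun x => merge (lab x) (K x)).
Proof.
move=> pl pK; have pls : PT (fun x => map (nth 0 (lab x)) (K x)).
  apply: PT_map; last by [].
  by apply: PT_nth; [apply: (ptime_comp pl)|]; projections.
have plsl : PT (fun p : X * nat => map (nth 0 (lab p.1)) (K p.1)).
  by apply: (ptime_comp pls); projections.
apply: (@PT_map _ _ _ _ _ _ _ _ _ (fun x l => if l \in map (nth 0 (lab x)) (K x)
  then head l (map (nth 0 (lab x)) (K x)) else l)); last by [].
by apply: PT_if; [apply: PT_mem|apply: PT_head|]; projections.
Qed.

Lemma PT_block_count (lab : X -> seq nat) : PT lab -> PT (fun x => block_count (lab x)).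
Proof.
move=> pl.
have H := @polytime_foldl_add R P A X nat (seq nat) eX (enc_nat R P) (enc_seq (enc_nat R P))
  (fun _ u y => if y \in u then u else y :: u) (fun=> [::]) lab (fun k => k + 1).
apply: PT_ext (PT_size (H _ _ (PT_nil A) pl _)).
- move=> x; rewrite /block_count; set F := foldl _ _ _.
  suff [uF memF] : uniq F /\ F =i lab x.
    by apply/perm_size/uniq_perm; rewrite ?undup_uniq // => y; rewrite mem_undup memF.
  rewrite /F; elim/last_ind: (lab x) => [|s y [us ms]]; first by split.
  rewrite foldl_rcons; case: ifPn => h; split=> //=.
  + by move=> z; rewrite mem_rcons inE ms; case: eqP => // ->; rewrite -ms h.
  + by rewrite h us.
  + by move=> z; rewrite mem_rcons !inE ms.
- by poly_bound.
- by apply: PT_if; [apply: PT_mem| |apply: PT_cons]; projections.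
- by move=> x k z y h; case: ifP => _; rewrite ?code_size_cons; lia.
Qed.

End MergeProgram.

Lemma merge_subset (lab K : seq nat) : {subset merge lab K <= 0 :: lab}.
Proof.
move=> l /mapP[l' l'lab ->]; case: ifP => [h|_]; last by rewrite inE l'lab orbT.
have : head l' (map (nth 0 lab) K) \in map (nth 0 lab) K.
  by case: (map _ _) h => //= *; rewrite mem_head.
case/mapP => i _ ->; case: (ltnP i (size lab)) => il.
  by rewrite inE mem_nth ?orbT.
by rewrite nth_default // mem_head.
Qed.

(** Merging creates no label except possibly 0, the default of [nth]; this bounds the code of every
    labeling met during a loop. *)
Definition relabels (lab0 lab : seq nat) : Prop :=
  size lab = size lab0 /\ {subset lab <= 0 :: lab0}.

Lemma relabels_refl lab : relabels lab lab.
Proof. by split=> // x xl; rewrite inE xl orbT. Qed.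

Lemma relabels_merge lab0 lab K : relabels lab0 lab -> relabels lab0 (merge lab K).
Proof.
move=> [sl sub]; split; first by rewrite size_merge.
by move=> x /merge_subset; rewrite inE => /orP[/eqP ->|/sub //]; rewrite mem_head.
Qed.

Lemma code_size_seq_mem {X : eqType} {eX : encodable X} (x : X) (l : seq X) :
  x \in l -> code x <= code l.
Proof. by case/splitPr => l1 l2; exact: code_size_mem. Qed.

Lemma relabels_code_size lab0 lab k : relabels lab0 lab -> code lab0 <= k ->
  code lab <= k * (k + 1) + 1.
Proof.
move=> [sl sub] h; rewrite [k + 1]addn1; apply: code_size_bound_seq.
  by rewrite sl; apply: leq_trans h; apply/ltnW/size_le_code_size.
move=> y /sub; rewrite inE => /orP[/eqP ->|yl]; apply: leq_trans _ h.
  exact: code_size_gt0.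
exact: code_size_seq_mem.
Qed.

Section CloseProgram.
Context {X : Type} {eX : encodable X}.

Lemma PT_close_upto (C : X -> seq candidate) (j : X -> nat) (lab : X -> seq nat) :
  PT C -> PT j -> PT lab -> PT (fun x => close_upto (C x) (j x) (lab x)).
Proof.
move=> pC pj pl; have [b pb hb] := polytime_size pl.
apply: (@polytime_foldl R P A X candidate (seq nat) _ _ _
  (fun x lab c => if size c.2 <= j x then merge lab c.1 else lab) lab C
  (fun k => b k * (b k + 1) + 1)); [by poly_bound| | by []|by []|].
  apply: PT_if; [apply: PT_leq|apply: PT_merge|]; last 3 first.
  - by projections.
  - by projections.
  - by projections.
  - by apply: PT_size; projections.
  - by apply: (ptime_comp pj); projections.
move=> x k l1 l2 _ Dx; apply: (@relabels_code_size (lab x)).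
  elim/last_ind: l1 => [|l1 c IH]; first exact: relabels_refl.
  by rewrite foldl_rcons; case: ifP => // _; exact: relabels_merge.
exact: hb.
Qed.

End CloseProgram.

Section PotentialProgram.
Context {X : Type} {eX : encodable X}.

Lemma PT_potential (C : X -> seq candidate) (J : X -> nat) (lab : X -> seq nat) :
  PT C -> PT J -> PT lab -> PT (fun x => potential (C x) (J x) (lab x)).
Proof.
move=> pC pJ pl; apply: PT_sum; last exact: PT_iota.
apply: PT_pred; apply: PT_block_count; apply: PT_close_upto.
- by apply: (ptime_comp pC); projections.
- by projections.
- by apply: (ptime_comp pl); projections.
Qed.

End PotentialProgram.

Section GainProgram.
Context {X : Type} {eX : encodable X}.

Lemma PT_gain (C : X -> seq candidate) (J : X -> nat) (lab K : X -> seq nat) :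
  PT C -> PT J -> PT lab -> PT K -> PT (fun x => gain (C x) (J x) (lab x) (K x)).
Proof.
move=> pC pJ pl pK; apply: PT_subn; apply: PT_potential; try assumption.
exact: PT_merge.
Qed.

End GainProgram.

Section BestProgram.
Context {X : Type} {eX : encodable X}.

Lemma PT_best (C : X -> seq candidate) (J : X -> nat) (lab : X -> seq nat) :
  PT C -> PT J -> PT lab -> PT (fun x => best (C x) (J x) (lab x)).
Proof.
move=> pC pJ pl.
have pg : PT (fun p : X * candidate => gain (C p.1) (J p.1) (lab p.1) p.2.1).
  apply: PT_gain; last by projections.
  - by apply: (ptime_comp pC); projections.
  - by apply: (ptime_comp pJ); projections.
  - by apply: (ptime_comp pl); projections.
have pnew : PT (fun p : X * candidate =>
    ((gain (C p.1) (J p.1) (lab p.1) p.2.1, size p.2.2), p.2)).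
  apply: PT_pair; last by projections.
  by apply: PT_pair; [assumption|apply: PT_size; projections].
have [b pb hb] := polytime_size pnew.
apply: (@polytime_foldl_add R P A X candidate ((nat * nat) * candidate) _ _ _
  (fun x => better (C x) (J x) (lab x)) (fun=> ((0, 1), ([::], [::]))) C
  (fun k => b (k + 1))); [by poly_bound| | |by []|].
- have pg2 : PT (fun p : X * (((nat * nat) * candidate) * candidate) =>
      gain (C p.1) (J p.1) (lab p.1) p.2.2.1).
    apply: (ptime_comp (f := fun p : X * (((nat * nat) * candidate) * candidate) => (p.1, p.2.2)) pg).
    by apply: PT_pair; projections.
  apply: PT_if; last by projections.
    apply: PT_ltn; apply: PT_muln; try assumption.
    + by projections.
    + by apply: PT_size; projections.
    + by projections.
  apply: PT_pair; last by projections.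
  by apply: PT_pair; [assumption|apply: PT_size; projections].
- apply: PT_pair; apply: PT_pair; [exact: PT_0|apply: PT_S; exact: PT_0| |]; exact: PT_nil.
- move=> x k z y h; rewrite /better; case: ifP => _; last by rewrite leq_addr.
  apply: leq_trans (leq_addl _ _); apply: (hb (x, y)).
  by rewrite code_size_pair /= addn1.
Qed.

End BestProgram.

Section StepProgram.
Context {X : Type} {eX : encodable X}.

Lemma PT_greedy_step (C : X -> seq candidate) (J : X -> nat) (st : X -> candidate) :
  PT C -> PT J -> PT st -> PT (fun x => greedy_step (C x) (J x) (st x)).
Proof.
move=> pC pJ ps; have pb : PT (fun x => best (C x) (J x) (st x).1).
  by apply: PT_best; projections.
apply: PT_pair; [apply: PT_merge|apply: PT_cat].
- exact: PT_fst.
- exact: (PT_fst (PT_snd pb)).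
- exact: (PT_snd (PT_snd pb)).
- exact: PT_snd.
Qed.

Lemma best_code_size (C : seq candidate) J lab : code (best C J lab).2.2 <= code C.
Proof.
have h : (best C J lab).2 = ([::], [::]) \/ (best C J lab).2 \in C.
  rewrite /best.
  have H (C' : seq candidate) : {subset C' <= C} ->
      (foldl (better C J lab) ((0, 1), ([::], [::])) C').2 = ([::], [::]) \/
      (foldl (better C J lab) ((0, 1), ([::], [::])) C').2 \in C.
    elim/last_ind: C' => [|C' c IH] sub; first by left.
    rewrite foldl_rcons {1 3}/better; case: ifP => _ /=.
      by right; apply: sub; rewrite mem_rcons mem_head.
    by apply: IH => c' c'C; apply: sub; rewrite mem_rcons inE c'C orbT.
  exact: H.
case: h => [->|h]; first exact: code_size_gt0.
apply: leq_trans (code_size_seq_mem h); rewrite code_size_pair.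
by rewrite leqW // leq_addl.
Qed.

End StepProgram.

(** [J] exceeds every cost, yet is bounded by the size of [C]. Each of the [J] thresholds
    contributes at most [size lab] to the potential, so [J * size lab] steps bring it to 0. *)
Definition greedy (C : seq candidate) (lab : seq nat) : seq P :=
  let J := (size (flatten (map snd C))).+1 in
  (iter (J * size lab) (greedy_step C J) (lab, [::])).2.

Lemma PT_greedy : PT (fun p : seq candidate * seq nat => greedy p.1 p.2).
Proof.
pose J (p : seq candidate * seq nat) := (size (flatten (map snd p.1))).+1.
pose N (p : seq candidate * seq nat) := J p * size p.2.
have pJ : PT J.
  apply: PT_S; apply: PT_size; apply: PT_flatten.
  apply: (@PT_map _ _ _ _ _ _ _ _ _ (fun _ => snd)); by projections.
have pN : PT N by apply: PT_muln; [assumption|apply: PT_size; projections].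
have [b pb hb] := polytime_size pN.
apply: (@PT_ext _ _ _ _ _ _ _ (fun p =>
  (foldl (fun st _ => greedy_step p.1 (J p) st) (p.2, [::]) (nseq (N p) 0)).2)).
  move=> p; rewrite /greedy -/(J p) -/(N p); congr _.2.
  by elim: (N p) (p.2, [::]) => // k IH st; rewrite iterSr -IH.
apply: PT_snd; apply: (@polytime_foldl R P A _ nat candidate _ _ _
  (fun p st _ => greedy_step p.1 (J p) st) (fun p => (p.2, [::])) (fun p => nseq (N p) 0)
  (fun k => k * (k + 1) + k * b k + 3)).
- by poly_bound.
- by apply: PT_greedy_step; [|apply: (ptime_comp pJ)|]; projections.
- by apply: PT_pair; [projections|exact: PT_nil].
- by apply: PT_nseq.
move=> p k l1 l2 el Dx.
have Nb : size l1 <= b k.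
  have h : size (nseq (N p) 0) <= b k.
    by rewrite size_nseq; apply: leq_trans (hb _ _ Dx); rewrite code_size_nat; lia.
  by apply: leq_trans h; rewrite el size_cat leq_addr.
have Ck : code p.1 <= k by move: Dx; rewrite code_size_pair; lia.
have Lk : code p.2 <= k by move: Dx; rewrite code_size_pair; lia.
have [h1 h2] : relabels p.2 (foldl (fun st _ => greedy_step p.1 (J p) st) (p.2, [::]) l1).1 /\
    code (foldl (fun st _ => greedy_step p.1 (J p) st) (p.2, [::]) l1).2 <= k * size l1 + 1.
  elim/last_ind: {el Nb} l1 => [|l1 y [IH1 IH2]].
    by split; [exact: relabels_refl|rewrite addn1].
  rewrite foldl_rcons size_rcons; split; first exact: relabels_merge.
  apply: leq_trans (code_size_cat _ _) _.
  rewrite mulnS -addnA; apply: leq_add => //.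
  exact: leq_trans (best_code_size _ _ _) Ck.
have h3 := relabels_code_size h1 Lk.
have h4 : k * size l1 <= k * b k by rewrite leq_mul2l Nb orbT.
by rewrite code_size_pair; lia.
Qed.

Section Candidates.

(** The signature may offer no equality test on points, so repetitions are detected on indices. *)
Definition indexed (T : seq P) : seq (nat * P) := zip (iota 0 (size T)) T.

Lemma PT_zip {X Y Z : Type} {eX : encodable X} {eY : encodable Y} {eZ : encodable Z}
    (l : X -> seq Y) (l' : X -> seq Z) :
  PT l -> PT l' -> PT (fun x => zip (l x) (l' x)).
Proof.
move=> pl pl'.
pose g (_ : X) (st : seq Z * seq (Y * Z)) (y : Y) :=
  if st.1 is z :: t then (t, (y, z) :: st.2) else st.
apply: (@PT_ext _ _ _ _ _ _ _ (fun x => rev (foldl (g x) (l' x, [::]) (l x)).2)).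
  move=> x; rewrite -[RHS]cat0s -[[::] in RHS]/(rev [::]).
  elim: (l x) (l' x) [::] => [|y s IH] [|z t] acc /=.
  - by rewrite cats0.
  - by rewrite cats0.
  - rewrite cats0; have -> : foldl (g x) ([::], acc) s = ([::], acc) by elim: s {IH}.
    by [].
  - by rewrite IH rev_cons cat_rcons.
apply: PT_rev; apply: PT_snd.
apply: (@polytime_foldl_add R P A X Y _ _ _ _ g _ _ (fun k => k + 2)).
- by poly_bound.
- apply: (@PT_uncons _ _ _ _ _ _ _ _ _ (fun p => p.2.1.1) (fun p => p.2.1)
    (fun p q => (q.2, (p.2.2, q.1) :: p.2.1.2))); [by projections|by projections|].
  apply: PT_pair; first by projections.
  apply: PT_cons; last by projections.
  by apply: PT_pair; projections.
- by apply: PT_pair; [assumption|exact: PT_nil].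
- assumption.
- move=> x k [[|z t] acc] y h; rewrite /g /=; first by rewrite leq_addr.
  rewrite !code_size_pair /= !code_size_cons !code_size_pair /=; lia.
Qed.

Definition extend (L : seq (nat * P)) (Ks : seq (seq (nat * P))) :=
  Ks ++ flatten [seq flatten [seq if e.1 \in map fst K then [::] else [:: e :: K]
                             | e <- L] | K <- Ks].

Definition index_sets (k : nat) (T : seq P) : seq (seq (nat * P)) :=
  iter k (extend (indexed T)) [:: [::]].

(** The induction on the constant [k] produces a separate program for each [k]. *)
Lemma PT_index_sets k : PT (index_sets k).
Proof.
have pI : PT indexed.
  apply: PT_zip; last exact: PT_id.
  by apply: PT_iota; apply: PT_size; exact: PT_id.
elim: k => [|k IH]; first by apply: PT_cons; exact: PT_nil.
apply: PT_cat; first exact: IH.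
apply: PT_flatten; apply: PT_map; last exact: IH.
apply: PT_flatten; apply: PT_map; last by apply: (ptime_comp pI); projections.
apply: PT_if; last by apply: PT_cons; [apply: PT_cons; projections|exact: PT_nil].
  apply: PT_mem; first by projections.
  by apply: (@PT_map _ _ _ _ _ _ _ _ _ (fun _ => fst)); projections.
exact: PT_nil.
Qed.

End Candidates.

End GreedyProgram.

(** * The given solver as a component of programs *)

Section Oracle.
Variables (R : realType) (P : eqType) (d : P -> P -> R) (A : structure R P).

Definition small_instance (k : nat) (T : seq P) (n : nat) : Prop :=
  [/\ uniq T, size T <= k & max_dist_le d T n%:R%R].

(** By determinism the output is a function of the input, extracted by choice, with [[::]] where the
    program does not halt with an encoded list. The depth bound on the output supplies its code
    size. *)
Lemma oracle k : solvable_with_terminals d A k ->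
  exists2 sv : seq P -> seq P, ptime A (small_instance k) sv &
    forall T n, small_instance k T n -> optimal d T (sv T).
Proof.
case=> c [p H].
have [sv Hsv] : exists sv : seq P -> seq P, forall T S t, computes c T S t -> sv T = S.
  pose Q T S := exists t, computes c T S t.
  exists (fun T => if pselect (exists S, Q T S) is left h
                   then projT1 (cid h) else [::]) => T S t cT.
  case: pselect => [h|[]]; last by exists S, t.
  case: (cid h) => S' [t' [s' [e' v']]] /=; case: cT => s [e v].
  have [ss _] := exec_deterministic e e'.
  by apply: (@encode_inj R P); rewrite -v' -v ss.
have [V hV] := program_below_ex c.
exists sv; last first.
  by move=> T n /H[S [t [cT [_ opt]]]]; rewrite (Hsv _ _ _ cT).
(* Clearing restores the [Leaf] values that [computes] assumes outside the input variable. *)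
exists (fun m => Seq (clear_from A m.+1 V.+1) (shift_program m c)),
  (fun n => 3 * p.[n]%R + 2 * (k + 2) + V + 3); split.
  by have ph := poly_bounded_horner p; poly_bound.
move=> m s T n Dx sx; have [S [t [cT [tp _]]]] := H _ _ Dx.
rewrite (Hsv _ _ _ cT); case: cT => s' [e v].
have [s1 [e1 f1 l1]] := exec_clear A m.+1 V.+1 s.
have sh : shifted m V.+1 (set_var (fun=> Leaf) 0 (encode R T)) s1.
  move=> x xV; rewrite /set_var; case: eqP => [->|x0].
    by rewrite addn0 f1.
  by apply: l1; lia.
have [s2 [e2 sh2 f2]] := exec_shift e (program_below_mono (leqnSn V) hV) sh.
exists s2, (V.+2 + t); split.
- exact: exec_seq e1 e2.
- by have := sh2 0 isT; rewrite addn0 v.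
- by move=> y ym; rewrite f2 // f1 // ltnW.
- by lia.
have dep x : tree_depth (set_var (fun=> Leaf) 0 (encode R T) x) <= k + 2.
  rewrite /set_var; case: eqP => _ /=; last by rewrite addn2.
  apply: leq_trans (depth_encode R T) _; rewrite addn2 !ltnS.
  by case: Dx.
have := exec_depth e _ dep 0; rewrite addn2 => /(_ isT); rewrite v.
move/(leq_trans (size_le_depth R S)) => hS.
have -> : code_size (R := R) (P := P) S = (size S).*2.+1.
  by elim: (S) => //= x l IH; rewrite -[LHS]/(1 + code_size l).+1 IH doubleS.
by lia.
Qed.

End Oracle.

Section PtimeMap.
Variables (R : realType) (P : Type) (A : structure R P).
Local Notation code := (code_size (R := R) (P := P)).

(** Unlike in [PT_map], the mapped function is polynomial only on a domain, which is all that is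
    known of the solver. *)
Lemma ptime_map (X Y Z : Type)
    (eX : encodable R P X) (eY : encodable R P Y) (eZ : encodable R P Z)
    (D : X -> nat -> Prop) (D' : Y -> nat -> Prop) (h : Y -> Z) (l : X -> seq Y) r :
  poly_bounded r -> ptime A D' h -> ptime A D (fun x => x) -> ptime A D l ->
  (forall x n l1 y l2, D x n -> l x = l1 ++ y :: l2 -> D' y (r n)) ->
  ptime A D (fun x => map h (l x)).
Proof.
move=> pr ph pid pl DD.
have [Ch [Bh [pBh hh]]] := ph; have [Cl [Bl [pBl hl]]] := pl.
have [C0 [B0 [pB0 h0]]] := pid.
have szl x n : D x n -> code (l x) <= Bl n.
  by move=> Dx; have [? [? []]] := hl 0 (fun _ : nat => @enc _ _ X eX x) x n Dx erefl.
have szx x n : D x n -> code x <= B0 n.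
  by move=> Dx; have [? [? []]] := h0 0 (fun _ : nat => @enc _ _ X eX x) x n Dx erefl.
have szh y n : D' y n -> code (h y) <= Bh n.
  by move=> Dx; have [? [? []]] := hh 0 (fun _ : nat => @enc _ _ Y eY y) y n Dx erefl.
pose Bz n := Bl n * (Bh (r n) + 1) + 1.
pose r2 n := B0 n + Bz n + Bl n + 2.
pose D'' (p : X * (seq Z * Y)) n := 
  D' p.2.2 (r n) /\ @code_size R P _ (enc_pair eX (enc_pair (enc_seq eZ) eY)) p <= r2 n.
have pBz : poly_bounded Bz by rewrite /Bz; poly_bound.
have pr2 : poly_bounded r2 by rewrite /r2; poly_bound.
have sub W (eW : encodable R P W) (f : X * (seq Z * Y) -> W) : polytime A f -> ptime A D'' f.
  by apply: ptime_sub pr2 _ => p n [].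
pose g (x : X) (z : seq Z) (y : Y) := h y :: z.
have szz x n l1 l2 : D x n -> l x = l1 ++ l2 ->
    code (foldl (g x) [::] l1) <= Bz n.
  move=> Dx el; have zl1 : size l1 <= Bl n.
    apply: leq_trans (szl _ _ Dx); rewrite el; apply: leq_trans (ltnW (size_le_code_size _)).
    by rewrite size_cat leq_addr.
  have hz : code (foldl (g x) [::] l1) <= size l1 * (Bh (r n) + 1) + 1.
    elim/last_ind: l1 l2 el {zl1} => [|l1 y IH] l2 el //.
    rewrite foldl_rcons size_rcons code_size_cons.
    have el' : l x = l1 ++ y :: l2 by rewrite el cat_rcons.
    have h1 := IH _ el'; have h2 := szh _ _ (DD _ _ _ _ _ Dx el').
    by rewrite mulSn; lia.
  by apply: leq_trans hz _; rewrite leq_add2r leq_mul2r zl1 orbT.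
have pf : ptime A D (fun x => foldl (g x) [::] (l x)).
  apply: (@ptime_foldl R P A X eX D Y (seq Z) eY _ D'' id Bz g (fun=> [::]) l) => //.
  - exact: poly_bounded_id.
  - apply: (@ptime_recode R P A _ _ _ (Z * seq Z)%type _ _ _ (fun p => (h p.2.2, p.2.1))) => //.
    apply: ptime_pair; last first.
      by apply: sub; apply: PT_fst; apply: PT_snd; exact: PT_id.
    apply: (ptime_comp_in (D' := D') pr _ ph); first by move=> p n [].
    by apply: sub; apply: PT_snd; apply: PT_snd; exact: PT_id.
  - exact: ptime_leaf.
  - move=> x n l1 y l2 Dx el; split=> /=; first exact: DD el.
    have h1 := szz _ _ _ _ Dx el; have h2 := szx _ _ Dx.
    have h3 : code y <= Bl n.
      by apply: leq_trans (szl _ _ Dx); rewrite el; exact: code_size_mem.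
    by rewrite !code_size_pair /= /r2; lia.
  - by move=> x n Dx; apply: (szz _ _ _ [::] Dx); rewrite cats0.
apply: ptime_ext (ptime_comp (PT_rev (PT_id A)) pf) => x n _.
rewrite -[in RHS](revK (l x)) map_rev; congr rev.
rewrite -[map _ _]cats0; elim: (l x) [::] => //= y s IH z.
by rewrite rev_cons map_rcons cat_rcons IH.
Qed.

End PtimeMap.

(** * The approximation ratio *)

Section IndexSets.
Variables (P : eqType) (T : seq P) (x0 : P).
Local Notation pt := (nth x0 T).

Lemma mem_indexed e : (e \in indexed T) = (e.1 < size T) && (e.2 == pt e.1).
Proof.
apply/idP/andP => [/(nthP (0, x0))[i]|[e1 /eqP e2]].
  rewrite size_zip size_iota minnn => iT; rewrite nth_zip ?size_iota // nth_iota //.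
  by move=> <-; rewrite add0n.
apply/(nthP (0, x0)); exists e.1; first by rewrite size_zip size_iota minnn.
by rewrite nth_zip ?size_iota // nth_iota // add0n -e2; case: (e).
Qed.

Lemma index_setsP k K : K \in index_sets k T ->
  [/\ uniq (map fst K), size K <= k, below (size T) (map fst K)
    & map snd K = map pt (map fst K)].
Proof.
elim: k K => [|k IH] K; first by rewrite inE => /eqP ->.
rewrite /index_sets iterS -/(index_sets k T) /extend mem_cat => /orP[/IH[h1 h2 h3 h4]|].
  by split=> //; exact: leqW.
case/flattenP => _ /mapP[K' /IH[h1 h2 h3 h4] ->] /flattenP[_ /mapP[e eL ->]].
case: ifPn => // nK; rewrite inE => /eqP ->.
move: eL; rewrite mem_indexed => /andP[eT /eqP e2]; split=> /=.
- by rewrite nK h1.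
- by rewrite ltnS.
- by move=> i; rewrite inE => /orP[/eqP ->|/h3 //]; rewrite mem_iota0.
- by rewrite h4 e2.
Qed.

Lemma index_sets_complete k I : uniq I -> size I <= k -> below (size T) I ->
  exists2 K, K \in index_sets k T & map fst K = I.
Proof.
elim: k I => [|k IH] I uI sI bI.
  by exists [::]; [rewrite inE|case: (I) sI].
rewrite /index_sets iterS -/(index_sets k T) /extend.
case: (leqP (size I) k) => [sk|ks].
  have [K KI eK] := IH _ uI sk bI; exists K => //.
  by rewrite mem_cat KI.
case: I uI sI bI ks => // i I /= /andP[iI uI]; rewrite ltnS => sI bI _.
have [|K KI eK] := IH _ uI sI.
  by move=> j jI; apply: bI; rewrite inE jI orbT.
exists ((i, pt i) :: K); last by rewrite /= eK.
rewrite mem_cat; apply/orP; right; apply/flattenP.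
exists (flatten [seq if e.1 \in map fst K then [::] else [:: e :: K] | e <- indexed T]).
  exact: (map_f (fun K => flatten [seq if e.1 \in map fst K then [::] else [:: e :: K]
                                  | e <- indexed T])).
apply/flattenP; exists [:: (i, pt i) :: K]; last by rewrite mem_head.
apply/mapP; exists (i, pt i); last by rewrite /= eK (negbTE iI).
by rewrite mem_indexed /= eqxx andbT -(mem_iota0 (size T)) bI // mem_head.
Qed.

End IndexSets.

Lemma ln_pred_ge0 (R : realType) (D : nat) : 0 < D -> (0 <= ln (D%:R - 1) :> R)%R.
Proof.
case: D => // -[_|D _].
  (* For [D = 1] the argument is 0, where [ln] takes the value 0. *)
  by rewrite GRing.subrr ln0.
by apply: ln_ge0; rewrite -GRing.natr1 GRing.addrK Num.Theory.ler1n.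
Qed.

(** * Feasibility and cost of the greedy solution *)

Section Approximation.
Import Order.TTheory GRing.Theory Num.Theory.
Local Open Scope ring_scope.
Variables (R : realType) (V : lmodType R) (N : V -> R).
Hypothesis N_triangle : forall x y, N (x + y) <= N x + N y.
Hypothesis N_scale : forall a x, N (a *: x) = `|a| * N x.
Local Notation d := (dist_of_norm N).
Variables (Delta : nat).
Hypothesis packing : forall c s, ball_packing d c s -> (size s <= Delta)%N.
Variables (r' : nat).
Local Notation r := r'.+1.
Local Notation k := (maxn 2 (terminal_bound Delta r')).
Variable sv : seq V -> seq V.

(** The maximum with 2 in [k] puts all pairs of terminals among the candidates; pairs connect
    everything and compare blocks with metric components. *)
Definition candidates (T : seq V) : seq (seq nat * seq V) :=
  [seq (map fst K, sv (map snd K)) | K <- index_sets k T].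

Definition solve (T : seq V) : seq V := greedy (candidates T) (iota 0 (size T)).

Section Instance.
Variables (T : seq V) (x0 : V).
Hypotheses (uT : uniq T) (x0T : x0 \in T).
Hypothesis sv_opt : forall K, uniq K -> (size K <= k)%N -> {subset K <= T} ->
  optimal d K (sv K).
Local Notation n := (size T).
Local Notation pt := (nth x0 T).
Local Notation C := (candidates T).
Local Notation J := (size (flatten (map snd C))).+1.

Lemma d_sym : forall x y, d x y = d y x.
Proof. exact: dist_sym. Qed.

Lemma pt_mem i : (i < n)%N -> pt i \in T.
Proof. exact: mem_nth. Qed.

Lemma index_ptK i : (i < n)%N -> index (pt i) T = i.
Proof. by move=> il; exact: index_uniq. Qed.

Lemma pt_indexK x : x \in T -> pt (index x T) = x.
Proof. exact: nth_index. Qed.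

Lemma map_pt_uniq I : uniq I -> below n I -> uniq (map pt I).
Proof.
move=> uI bI; rewrite map_inj_in_uniq // => i j iI jI e.
by rewrite -(index_ptK (belowP bI iI)) e index_ptK // (belowP bI).
Qed.

Lemma map_pt_subset I : below n I -> {subset map pt I <= T}.
Proof. by move=> bI _ /mapP[i iI ->]; exact/pt_mem/(belowP bI). Qed.

Lemma candidate_optimal c : c \in C ->
  [/\ below n c.1, uniq c.1 & optimal d (map pt c.1) c.2].
Proof.
case/mapP => K /(index_setsP x0)[u s b e] -> /=; rewrite e; split=> //.
apply: sv_opt; [exact: map_pt_uniq|by rewrite !size_map|exact: map_pt_subset].
Qed.

Lemma candidate_ex I : uniq I -> (size I <= k)%N -> below n I ->
  exists2 c, c \in C & c.1 = I.
Proof.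
move=> uI sI bI; have [K KI eK] := index_sets_complete x0 uI sI bI.
by exists (map fst K, sv (map snd K)) => //; apply: map_f.
Qed.

Lemma candidate_below : {in C, forall c, below n c.1}.
Proof. by move=> c /candidate_optimal[]. Qed.

Lemma candidate_cost : {in C, forall c, (size c.2 < J)%N}.
Proof.
move=> c cC; rewrite ltnS size_flatten /shape -map_comp sumnE big_map.
by rewrite (big_rem c) //= leq_addr.
Qed.

Lemma pair_below i j : (i < n)%N -> (j < n)%N -> below n [:: i; j].
Proof. by move=> il jl z; rewrite !inE mem_iota0 => /orP[]/eqP ->. Qed.

Lemma candidate_pair i j : (i < n)%N -> (j < n)%N -> i != j ->
  exists2 c, c \in C & c.1 = [:: i; j].
Proof.
move=> il jl ij; apply: candidate_ex.
- by rewrite /= inE ij.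
- by rewrite leq_max.
- exact: pair_below.
Qed.

Lemma candidates_connecting : connecting n C.
Proof.
move=> E [Er Es Et] CE i j il jl; case: (eqVneq i j) => [->//|ij].
have [c cC ec] := candidate_pair il jl ij.
by apply: (CE _ cC); rewrite ec !inE eqxx ?orbT.
Qed.

(** Two terminals at distance at most [j.+1] are joined by [j] points on their segment, so the
    optimal candidate for this pair costs at most [j] and is merged at threshold [j]. *)
Lemma block_count_le_components j :
  (block_count (close_upto C j (iota 0 n)) <= component_count N j T)%N.
Proof.
set F := close_upto _ _ _.
have sF : size F = n by rewrite size_close_upto size_iota.
have path_label x s : x \in T -> path (unit_disk_graph (scaled N j) T) x s ->
    nth 0%N F (index x T) = nth 0%N F (index (last x s) T).
  elim: s x => //= y s IH x xT /andP[/and3P[_ yT dxy] /(IH y yT) <-].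
  case: (eqVneq x y) => [->//|xy].
  rewrite scaled_le1 in dxy; have [S sS fS] := segment_feasible N_scale dxy.
  have ix : (index x T < n)%N by rewrite index_mem.
  have iy : (index y T < n)%N by rewrite index_mem.
  have [|c cC ec] := candidate_pair ix iy.
    by apply: contraNneq xy => e; rewrite -(pt_indexK xT) e pt_indexK.
  have [_ _ [_ opt]] := candidate_optimal cC.
  have cj : (size c.2 <= j)%N.
    by apply: leq_trans sS; apply: opt; rewrite ec /= !pt_indexK.
  rewrite /F close_uptoE.
  apply: (@merge_all_constant n) (c.1) _ _ _ _ _; rewrite ?size_iota //.
  - by move=> K /mapP[c']; rewrite mem_filter => /andP[_ /candidate_below] + ->.
  - by apply: map_f; rewrite mem_filter cj.
  - by rewrite ec mem_head.
  - by rewrite ec !inE eqxx orbT.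
rewrite (block_count_nth sF) /component_count.
have -> : map (component_repr N j T) T = map (component_repr N j T \o pt) (iota 0 n).
  by rewrite map_comp map_nth_iota0 // take_size.
apply: undup_map_leq => a b; rewrite !mem_iota0 => al bl /= e.
have [s [ps ls]] : connected_in (scaled N j) T (pt a) (pt b).
  by apply/(component_reprP N_scale); rewrite ?pt_mem.
by have := path_label _ _ (pt_mem al) ps; rewrite ls !index_ptK.
Qed.

Lemma component_count_gt0 j : (0 < component_count N j T)%N.
Proof.
rewrite -has_predT; apply/hasP; exists (component_repr N j T x0) => //.
by rewrite mem_undup map_f.
Qed.

Lemma initial_potential S : feasible d T S ->
  (potential C J (iota 0 n) <= Delta.-1 * size S)%N.
Proof.
move=> fS; have T0 : T != [::] by case: (T) x0T.
have := component_count_terminals N_triangle N_scale J packing T0 fS.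
suff : (potential C J (iota 0 n) + J <= \sum_(j <- iota 0 J) component_count N j T)%N.
  by move=> h1 h2; have := leq_trans h1 h2; rewrite addnC leq_add2l.
have {2}-> : J = (\sum_(j <- iota 0 J) 1)%N by rewrite sum1_size size_iota.
rewrite /potential -big_split /=; apply: leq_sum => j _.
have := block_count_le_components j; have := component_count_gt0 j.
by move: (block_count _) => b; case: b => [|b]; rewrite ?addn1.
Qed.

Lemma Delta_gt0 : (0 < Delta)%N.
Proof.
apply: (packing (c := x0) (s := [:: x0])).
by rewrite /ball_packing /= dist_refl // ler01.
Qed.

(** Each piece of the decomposition is replaced by the candidate on the same terminals, whose
    optimal solution is no larger. *)
Lemma restricted_family S : feasible d T S ->
  exists F, [/\ {subset F <= C}, connecting n F
    & (r * (\sum_(c <- F) size c.2) <= (r + 4) * size S)%N].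
Proof.
move=> fS; have T0 : T != [::] by case: (T) x0T.
have D0 := Delta_gt0.
have [F [FT Fconn Fcost]] := restricted_decomposition d_sym packing D0 r' T0 fS.
pose I (c : seq V * seq V) := [seq i <- iota 0 n | pt i \in c.1].
pose G c : seq nat * seq V := (I c, sv (map pt (I c))).
have bI c : below n (I c) by move=> i; rewrite mem_filter => /andP[].
have uI c : uniq (I c) by rewrite filter_uniq // iota_uniq.
have eI c : c \in F -> map pt (I c) =i c.1.
  move=> cF x; have [sub _ _] := FT _ cF; apply/mapP/idP => [[i + ->]|xc].
    by rewrite mem_filter => /andP[].
  have xT := sub _ xc; exists (index x T); last by rewrite pt_indexK.
  by rewrite mem_filter pt_indexK // xc mem_iota0 index_mem.
have sI c : c \in F -> (size (I c) <= k)%N.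
  move=> cF; have [_ sc _] := FT _ cF.
  rewrite leq_max -(size_map pt); apply/orP; right; apply: leq_trans sc.
  by apply: uniq_leq_size; [exact: map_pt_uniq|move=> x; rewrite eI].
exists (map G F); split.
- move=> _ /mapP[c cF ->]; have [K KI eK] := index_sets_complete x0 (uI c) (sI _ cF) (bI c).
  have [_ _ _ e] := index_setsP x0 KI.
  by rewrite /G -eK -e; exact: (map_f (fun K => (map fst K, sv (map snd K)))).
- move=> E [Er Es Et] GE i j il jl.
  (* The relation on indices, transported to points; equality is added to make it reflexive outside
     [T]. *)
  pose E' x y := x = y \/ [/\ x \in T, y \in T & E (index x T) (index y T)].
  have eE' : equivalence_rel_on E'.
    split; first by left.
    + move=> x y [->|[xT yT h]]; first by left.
      by right; split=> //; exact: Es.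
    + move=> x y z [->//|[xT yT h]] [<-|[_ zT h']]; first by right.
      by right; split=> //; exact: Et h'.
  have h : E' (pt i) (pt j).
    apply: (Fconn E' eE'); rewrite ?pt_mem // => c cF x y xc yc; right.
    have [sub _ _] := FT _ cF; have xT := sub _ xc; have yT := sub _ yc.
    split=> //; apply: (GE (G c)); rewrite ?map_f //= mem_filter pt_indexK //.
      by rewrite xc mem_iota0 index_mem.
    by rewrite yc mem_iota0 index_mem.
  case: h => [e|[_ _]]; last by rewrite !index_ptK.
  by rewrite -(index_ptK il) e index_ptK.
- rewrite big_map; apply: leq_trans Fcost; rewrite leq_mul2l; apply/orP; right.
  rewrite /cost big_seq [leqRHS]big_seq; apply: leq_sum => c cF /=.
  have [sub _ fc] := FT _ cF.
  have [|||_ opt] := sv_opt (K := map pt (I c)).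
  + exact: map_pt_uniq.
  + by rewrite size_map sI.
  + exact: map_pt_subset.
  by apply: opt; apply: feasible_eq fc => x; rewrite eI.
Qed.

Local Notation state m := (iter m (greedy_step C J) (iota 0 n, [::])).

Lemma size_state m : size (state m).1 = n.
Proof.
elim: m => [|m IH]; first by rewrite /= size_iota.
by rewrite iterS /greedy_step size_merge.
Qed.

Lemma state_potential m : (potential C J (state m).1 + m <= potential C J (iota 0 n))%N
  \/ potential C J (state m).1 = 0%N.
Proof.
elim: m => [|m IH]; first by left; rewrite addn0.
rewrite iterS; have [c [g [_ e _ _ g0]]] := greedy_step_progress candidate_below
  candidate_cost candidates_connecting (size_state m) (fun _ h => h) candidates_connecting.
case: (posnP (potential C J (state m).1)) => [p0|p0].
  by right; move: e; rewrite p0; lia.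
have := g0 p0; case: IH => [IH|]; last by lia.
by left; lia.
Qed.

Lemma final_potential : potential C J (state (J * n)).1 = 0%N.
Proof.
have : (potential C J (iota 0 n) <= J * n)%N.
  have -> : (J * n = \sum_(j <- iota 0 J) n)%N.
    by rewrite big_const_seq count_predT size_iota iter_addn_0 mulnC.
  apply: leq_sum => j _; apply: leq_trans (leq_pred _) _.
  rewrite /block_count; apply: leq_trans (size_undup _) _.
  by rewrite size_close_upto size_iota.
by case: (state_potential (J * n)) => //; lia.
Qed.

Lemma solve_feasible : feasible d T (solve T).
Proof.
have solveE : solve T = (state (J * n)).2 by rewrite /solve /greedy size_iota.
have sup : supported n C (state (J * n)).
  elim: (J * n)%N => [|m IH].
    by move=> E [Er _ _] _ i j il jl /=; rewrite !nth_iota // !add0n => ->.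
  rewrite iterS; apply: greedy_step_supported IH.
  - exact: candidate_below.
  - exact: size_state.
move=> u v uT' vT'; rewrite -(pt_indexK uT') -(pt_indexK vT').
apply: (@supported_no_potential _ n C J candidate_below _ isT (size_state _) sup final_potential
   (fun i j => connected_in d (T ++ solve T) (pt i) (pt j))); rewrite ?index_mem //.
- have [Er Es Et] := connected_equivalence d_sym (T ++ solve T).
  by split=> [x|x y|x y z]; [exact: Er|exact: Es|exact: Et].
- move=> c cC sub i j ic jc; have [bc _ [fc _]] := candidate_optimal cC.
  apply: connected_sub (fc _ _ (map_f _ ic) (map_f _ jc)) => x.
  rewrite !mem_cat solveE => /orP[/(map_pt_subset bc) ->//|/sub ->]; by rewrite orbT.
Qed.

Lemma solve_cost S : feasible d T S ->
  (size (solve T))%:R <= (1 + 4 / r%:R) * (size S)%:R * (1 + ln (Delta%:R - 1)) :> R.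
Proof.
move=> fS; have solveE : solve T = (state (J * n)).2 by rewrite /solve /greedy size_iota.
have pot0 := initial_potential fS.
have [F [FC Fconn Fcost]] := restricted_family fS.
set q := potential C J (iota 0 n) in pot0.
have progress m := greedy_step_progress candidate_below candidate_cost
  candidates_connecting (size_state m) FC Fconn.
(* A positive potential forces [0 < size S] and [0 < Delta.-1], hence [0 < M] as [log_cost]
   requires. At potential 0 nothing is ever bought. *)
case: (posnP q) => [q0|q_gt0].
  have : size (state (J * n)).2 = 0%N /\ potential C J (state (J * n)).1 = 0%N.
    elim: (J * n)%N => [|m [IH1 IH2]]; first by [].
    rewrite iterS; have [c [g [-> + cg _ _]]] := progress m; lia.
  case=> + _; rewrite solveE => ->.
  by rewrite !mulr_ge0 ?addr_ge0 ?divr_ge0 ?ln_pred_ge0 ?Delta_gt0.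
have [S0 D1] : (0 < size S /\ 0 < Delta.-1)%N.
  by move: (leq_trans q_gt0 pot0); rewrite muln_gt0 => /andP[].
have r0 : 0 < r%:R :> R by rewrite ltr0n.
have S0' : 0 < (size S)%:R :> R by rewrite ltr0n.
set M := (1 + 4 / r%:R) * (size S)%:R.
have SM : (size S)%:R <= M by rewrite /M ler_peMl ?ler0n // lerDl divr_ge0 ?ler0n.
have M0 : 0 < M by apply: lt_le_trans SM.
have FM : (\sum_(c <- F) size c.2)%:R <= M.
  have -> : M = ((r + 4) * size S)%:R / r%:R.
    rewrite /M natrM natrD; move: (r%:R : R) r0 => a a0.
    by field; rewrite gt_eqF.
  by rewrite ler_pdivlMr // -natrM ler_nat mulnC.
have DE : Delta%:R - 1 = Delta.-1%:R :> R.
  by rewrite -{1}(prednK Delta_gt0) -natr1 addrK.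
have D1' : 1 <= Delta.-1%:R :> R by rewrite ler1n.
have inv m : (size (state m).2)%:R <=
    log_cost M q%:R - log_cost M (potential C J (state m).1)%:R.
  elim: m => [|m IH]; first by rewrite /= subrr.
  rewrite iterS; have [c [g [-> e cg cF _]]] := progress m.
  have h : c%:R <= log_cost M (potential C J (state m).1)%:R
      - log_cost M (potential C J (greedy_step C J (state m)).1)%:R.
    apply: log_cost_step => //.
    - by rewrite ler_nat e leq_addr.
    - by rewrite e natrD addrC addKr ler_nat.
    - have -> : (potential C J (state m).1)%:R
          - (potential C J (greedy_step C J (state m)).1)%:R = g%:R :> R.
        by rewrite e natrD addrC addKr.
      apply: le_trans (_ : g%:R * (\sum_(c <- F) size c.2)%:R <= _).
        by rewrite -!natrM ler_nat.
      by rewrite ler_wpM2l.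
  by rewrite natrD; lra.
rewrite solveE; apply: le_trans (inv _) _.
rewrite final_potential log_cost0 // subr0 DE; apply: log_cost_le => //.
apply: le_trans (_ : Delta.-1%:R * (size S)%:R <= _); first by rewrite -natrM ler_nat.
by rewrite ler_wpM2l.
Qed.

End Instance.

End Approximation.

(** * Running time of the greedy algorithm *)

Section PolynomialTime.
Import Order.TTheory GRing.Theory Num.Theory.
Variables (R : realType) (V : lmodType R) (d : V -> V -> R) (A : structure R V).
Variables (Delta r' : nat) (sv : seq V -> seq V).
Local Notation k := (maxn 2 (terminal_bound Delta r')).
Hypothesis sv_ptime : ptime A (small_instance d k) sv.

Lemma ptime_solve (q : {poly nat}) :
  ptime A (fun T n => [/\ uniq T, size T = n & max_dist_le d T (q.[n]%R)%:R%R])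
    (solve Delta r' sv).
Proof.
set D := (X in ptime _ X).
have ph := poly_bounded_horner q.
have codeT T n : D T n -> code_size (R := R) (P := V) T <= n + n + 1.
  move=> [_ <- _].
  have -> : code_size (R := R) (P := V) T = (size T).*2.+1.
    by elim: (T) => //= x l IH; rewrite -[LHS]/(1 + code_size l).+1 IH doubleS.
  by rewrite addn1 addnn.
have sub X (eX : encodable R V X) (f : seq V -> X) : polytime A f -> ptime A D f.
  apply: (ptime_sub (r := fun n => n + n + 1)); first by poly_bound.
  exact: codeT.
have pC : ptime A D (candidates Delta r' sv).
  have pI := PT_index_sets A k; have [b pb hb] := polytime_size pI.
  pose D' (K : seq (nat * V)) n := small_instance d k (map snd K) n /\
    @code_size R V _ (enc_seq (enc_pair (enc_nat R V) (@enc_point R V))) K <= n.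
  have subD' X (eX : encodable R V X) (f : seq (nat * V) -> X) :
      polytime A f -> ptime A D' f.
    by apply: ptime_sub poly_bounded_id _ => K n [].
  (* A single parameter bounds both the terminal distances and the code of an index set. *)
  apply: (@ptime_map R V A _ _ _ _ _ _ D D' (fun K => (map fst K, sv (map snd K)))
    (index_sets k) (fun n => q.[n]%R + b (n + n + 1))).
  - by poly_bound.
  - apply: ptime_pair.
      by apply: subD'; apply: (@PT_map _ _ _ _ _ _ _ _ _ (fun _ => fst)) (PT_id A);
         apply: PT_fst; apply: PT_snd; exact: PT_id.
    apply: (ptime_comp_in (D' := small_instance d k) poly_bounded_id _ sv_ptime).
      by move=> K n [].
    by apply: subD'; apply: (@PT_map _ _ _ _ _ _ _ _ _ (fun _ => snd)) (PT_id A);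
       apply: PT_snd; apply: PT_snd; exact: PT_id.
  - by apply: sub; exact: PT_id.
  - exact: sub.
  move=> T n l1 K l2 DT el; have KI : K \in index_sets k T by rewrite el mem_cat mem_head orbT.
  case: (DT) => uT sT mT; have [u s bK e] := index_setsP 0%R KI; split.
    rewrite e; split; first exact: map_pt_uniq.
      by rewrite !size_map.
    move=> x y /(map_pt_subset bK) xT /(map_pt_subset bK) yT.
    by apply: le_trans (mT _ _ xT yT) _; rewrite ler_nat leq_addr.
  have KT : code_size (R := R) (P := V) K <= code_size (R := R) (P := V) (index_sets k T).
    by rewrite el; exact: code_size_mem.
  apply: leq_trans (leq_addl _ _); apply: leq_trans KT _.
  by apply: hb; exact: codeT.
apply: (ptime_comp (PT_greedy A) (ptime_pair pC _)).
by apply: sub; apply: PT_iota; apply: PT_size; exact: PT_id.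
Qed.

End PolynomialTime.

(** * Choosing the number of residues for a given accuracy *)

Section Ratio.
Import Order.TTheory GRing.Theory Num.Theory.
Local Open Scope ring_scope.

Lemma poly_time_approximation (R : realType) (V : lmodType R) (N : V -> R)
    (N_triangle : forall x y, N (x + y) <= N x + N y)
    (N_scale : forall a x, N (a *: x) = `|a| * N x)
    (Delta : nat) (A : structure R V) :
  is_packing_number (dist_of_norm N) Delta ->
  (forall k, solvable_with_terminals (dist_of_norm N) A k) ->
  forall eps : R, 0 < eps ->
  poly_time_approximable (dist_of_norm N) A (1 + ln (Delta%:R - 1) + eps).
Proof.
move=> [_ packing] solvable eps eps0 q.
have D0 : (0 < Delta)%N.
  apply: (packing 0 [:: 0]).
  by rewrite /ball_packing /= dist_refl // ler01.
have L0 : 0 <= ln (Delta%:R - 1) :> R by exact: ln_pred_ge0.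
set L := ln _ in L0 *.
(* The excess of [(1 + 4 / r) * (1 + L)] over [1 + L] must be at most [eps]. *)
pose r' := Num.bound (4 * (1 + L) / eps).
have hr : 4 / r'.+1%:R * (1 + L) <= eps.
  have h0 : 0 <= 4 * (1 + L) / eps by rewrite divr_ge0 ?mulr_ge0 ?addr_ge0 // ltW.
  have := archi_boundP h0; rewrite -/r' ltr_pdivrMr // => h.
  rewrite mulrAC ler_pdivrMr ?ltr0n //.
  by apply: le_trans (ltW h) _; rewrite mulrC ler_pM2l // ler_nat.
have [sv svt svo] := oracle (solvable (maxn 2 (terminal_bound Delta r'))).
have [C [B [pB H]]] := ptime_solve svt q.
have [p hp] := poly_bounded_poly pB.
exists (C 0%N), p => T n Dom.
have [s' [t [e v _ tB _]]] :=
  H 0%N (set_var (fun=> Leaf) 0%N (encode R T)) T n Dom erefl.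
exists (solve Delta r' sv T), t; split; first by exists s'.
split; first exact: leq_trans tB (hp n).
case: Dom => uT sT mT.
have svT K : uniq K -> (size K <= maxn 2 (terminal_bound Delta r'))%N ->
    {subset K <= T} -> optimal (dist_of_norm N) K (sv K).
  move=> uK sK KT; apply: (svo _ q.[n]); split=> // u w /KT uT' /KT wT.
  exact: mT.
case: T uT sT mT svT {e v} => [_ _ _ _|x0 T0].
  have -> : solve Delta r' sv [::] = [::] by rewrite /solve /greedy muln0.
  by split=> // S' _; rewrite mulr_ge0 // ?addr_ge0 // ltW.
set T := x0 :: T0 => uT sT mT svT; have x0T : x0 \in T by rewrite mem_head.
split; first exact: (solve_feasible N_scale uT x0T svT).
move=> S' fS'.
apply: le_trans (solve_cost N_triangle N_scale packing uT x0T svT fS') _.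
rewrite mulrAC ler_wpM2r //; rewrite -/L mulrDl mul1r lerD2l; exact: hr.
Qed.

End Ratio.

Import Order.TTheory GRing.Theory Num.Theory.
Import numFieldNormedType.Exports.

Local Open Scope ring_scope.

Theorem theorem1 (R : realType) :
  (forall (V : normedModType R) (Delta : nat) (A : structure R V),
     is_packing_number (@norm_dist R V) Delta ->
     (forall k : nat, solvable_with_terminals (@norm_dist R V) A k) ->
     forall eps : R, 0 < eps ->
       poly_time_approximable (@norm_dist R V) A
         (1 + ln (Delta%:R - 1) + eps))
  /\
  [/\ is_packing_number (@eucl_dist R) 5,
      (forall A : structure R 'rV[R]_2,
         (forall k : nat, solvable_with_terminals (@eucl_dist R) A k) ->
         forall eps : R, 0 < eps ->
           poly_time_approximable (@eucl_dist R) A (1 + ln 4 + eps))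
    & (forall eps : R, 0 < eps -> 1 + ln 4 + eps < 2 + 3863 / 10 ^+ 4 + eps)].
Proof.
split.
  move=> V Delta A.
  have -> : @norm_dist R V = dist_of_norm (fun x : V => `|x|%R) by [].
  apply: poly_time_approximation; first exact: Num.Theory.ler_normD.
  by move=> a x; rewrite normrZ.
split; first exact: eucl_packing_number.
  move=> A; have := eucl_packing_number R; rewrite (eucl_distE R) => pack5 solvable eps eps0.
  have := poly_time_approximation (@eucl_norm_triangle R) (@eucl_norm_scale R) pack5 solvable eps0.
  have -> : (5%:R - 1 = 4 :> R)%R by lra.
  by [].
by move=> eps _; have := ln4_lt R; lra.
Qed.
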